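(* Let $m>0$. Let $\pi:\mathbb{R}\to[0,1)$ be smooth and let $\lambda_N:\mathbb{Z}\to[0,1)$, $N\in\mathbb{N}$, be a sequence of profiles with $\lambda_N\approx\pi$, i.e. such that for all $n\ge 1$ and all $y_1,\dots,y_n\in\mathbb{R}$, $$ \lim_{N\to\infty}\int \mathcal{D}\Big(\sum_{i=1}^n\delta_{\lfloor Ny_i\rfloor},\eta\Big)\,\nu_{\lambda_N}^{\otimes\mathbb{Z}}(d\eta)=\prod_{i=1}^n\frac{\pi(y_i)}{1-\pi(y_i)} . $$ Let $\psi(t,y)$ be the solution of the diffusion equation $$ \frac{\partial\psi(t,y)}{\partial t}=\frac m2\,\frac{\partial^2\psi(t,y)}{\partial y^2},\qquad \psi(0,y)=\frac{\pi(y)}{1-\pi(y)} . $$ Then propagation of local equilibrium holds for the symmetric inclusion process $SIP(m)$ on $\mathbb{Z}$: for every $t>0$, every $n\ge1$ and all $y_1,\dots,y_n\in\mathbb{R}$, $$ \lim_{N\to\infty}\int \mathbb{E}_\eta^{SIP(m)}\,\mathcal{D}\Big(\sum_{i=1}^n\delta_{\lfloor Ny_i\rfloor},\eta(N^2t)\Big)\,\nu_{\lambda_N}^{\otimes\mathbb{Z}}(d\eta)=\prod_{i=1}^n\psi(t,y_i). $$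
   Context: Here, in configurations, natural numbers include $0$, and $\Omega=\{0,1,2,\dots\}^{\mathbb{Z}}$. The $SIP(m)$ is the Markov process $(\eta(t))_{t\ge0}$ on $\Omega$ with generator $$ \mathcal{L}f(\eta)=\sum_{i\in\mathbb{Z}}\sum_{j\in\{i-1,i+1\}}\eta_i\Big(\frac m2+\eta_j\Big)\big(f(\eta^{ij})-f(\eta)\big),\qquad \eta^{ij}=\eta-\delta_i+\delta_j, $$ where $\delta_x$ is the configuration with a single particle at $x$ and none elsewhere; $\mathbb{E}_\eta^{SIP(m)}$ is expectation when started from $\eta$. Duality functions: for integers $0\le k\le n$ put $d(k,n)=\frac{n!}{(n-k)!}\frac{\Gamma(m/2)}{\Gamma(m/2+k)}$, and $d(k,n)=0$ for $k>n$. For a configuration $\xi$ with finitely many particles, $\mathcal{D}(\xi,\eta)=\prod_{i\in\mathbb{Z}}d(\xi_i,\eta_i)$. The semigroup of $SIP(m)$ is well defined on polynomials depending on finitely many of the $\eta_i$, through the self-duality relation $\mathbb{E}_\eta^{SIP(m)}\mathcal{D}(\xi,\eta(t))=\mathbb{E}_\xi^{SIP(m)}\mathcal{D}(\xi(t),\eta)$ for $\xi$ with finitely many particles, where $\xi(t)$ is the $SIP(m)$ with finitely many particles started from $\xi$. For $\lambda:\mathbb{Z}\to[0,1)$, $\nu_\lambda^{\otimes\mathbb{Z}}$ denotes the product probability measure on $\Omega$ whose marginal at site $i$ is the negative binomial (discrete Gamma) distribution $$ \nu_{\lambda(i)}(n)=(1-\lambda(i))^{m/2}\,\frac{\lambda(i)^n}{n!}\,\frac{\Gamma(m/2+n)}{\Gamma(m/2)},\qquad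 n=0,1,2,\dots $$ It satisfies $\int\mathcal{D}(\sum_{i=1}^n\delta_{x_i},\eta)\,\nu_\lambda^{\otimes\mathbb{Z}}(d\eta)=\prod_{i=1}^n\frac{\lambda(x_i)}{1-\lambda(x_i)}$.
   Formalization: The formal theorem additionally assumes that for some constants C, a and all large N, λ_N(x)/(1−λ_N(x)) ≤ C·exp(a|x|/N) for all x (the claim fails without such control), and takes ψ to be the solution of at most exponential growth in y. *)

(* Defs.v *)
(* MathComp / MathComp-Analysis *)
From HB Require Import structures.
From mathcomp Require Import all_boot all_order all_algebra.
From mathcomp Require Import finmap multiset.
From mathcomp Require Import all_classical all_reals all_analysis.
Set Implicit Arguments.
Unset Strict Implicit.
Unset Printing Implicit Defensive.
Import Order.TTheory GRing.Theory Num.Theory.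
Import numFieldNormedType.Exports.
Local Open Scope classical_set_scope.
Local Open Scope ring_scope.

Definition Gamma {R : realType} (a : R) : R :=
  \int[lebesgue_measure]_(x in `]0, +oo[) (x `^ (a - 1) * expR (- x)).

(* Omega = {0,1,2,...}^Z with the product of the discrete sigma-algebras. *)
Definition coordinate_events : set (set (int -> nat)) :=
  [set A | exists i k, A = [set eta | eta i = k]].
Definition Omega : measurableType _ := g_sigma_algebraType coordinate_events.

(* Configurations with finitely many particles; xi i is the multiplicity of
   the site i, i.e. the number of particles there. *)
Definition fconf : choiceType := ({mset int})%mset.

(* \sum_(i < n) delta_(x i) *)
Definition sum_delta n (x : 'I_n -> int) : fconf :=
  seq_mset [seq x i | i <- enum 'I_n].

(* xi^{ij} = xi - delta_i + delta_j *)
Definition fmove (i j : int) (xi : fconf) : fconf := (j +` (xi `\ i))%mset.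

Section SIP.
Context {R : realType} (m : R).
Implicit Types (xi zeta : fconf) (eta : int -> nat).

(* The SIP(m) generator on finite configurations; the terms with xi i = 0
   vanish, so the sum over i in Z is the sum over the support of xi. *)
Definition sip_gen (f : fconf -> R) xi : R :=
  \sum_(i <- finsupp xi) \sum_(j <- [:: i - 1; i + 1])
    (xi i)%:R * (m / 2 + (xi j)%:R) * (f (fmove i j xi) - f xi).

(* p t xi zeta = P_xi(xi(t) = zeta) for the Markov process (xi(t))_{t >= 0} on
   the countable state space fconf with generator sip_gen.  The generator has
   bounded jump rates on each set of configurations with a fixed number of
   particles, so it determines p. *)
Record is_fsip (p : R -> fconf -> fconf -> R) : Prop := IsFsip {
  fsip_ge0 : forall t xi zeta, 0 <= t -> 0 <= p t xi zeta ;
  fsip_mass : forall t xi, 0 <= t ->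
    (\esum_(zeta in [set: fconf]) (p t xi zeta)%:E = 1)%E ;
  fsip0 : forall xi zeta, p 0 xi zeta = (xi == zeta)%:R ;
  fsip_semigroup : forall s t xi zeta, 0 <= s -> 0 <= t ->
    (\esum_(chi in [set: fconf]) (p s xi chi * p t chi zeta)%:E
       = (p (s + t) xi zeta)%:E)%E ;
  fsip_gen : forall xi zeta,
    h^-1 * (p h xi zeta - p 0 xi zeta) @[h --> 0^'+]
      --> sip_gen (fun chi => (chi == zeta)%:R) xi }.

(* E_xi f(xi(t)), for nonnegative f *)
Definition fsip_expect (p : R -> fconf -> fconf -> R) (t : R) xi
    (f : fconf -> \bar R) : \bar R :=
  (\esum_(zeta in [set: fconf]) (p t xi zeta)%:E * f zeta)%E.

Definition dual1 (k n : nat) : R :=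
  if (k <= n)%N then n`!%:R / (n - k)`!%:R * (Gamma (m / 2) / Gamma (m / 2 + k%:R))
  else 0.

(* Since dual1 0 n = 1, the product over Z is the product over the support. *)
Definition dual xi eta : R := \prod_(i <- finsupp xi) dual1 (xi i) (eta i).

(* E_eta D(xi, eta(t)) for SIP(m) on Omega, which is defined, as a function of
   the infinite configuration eta, by self-duality:
   E_eta D(xi, eta(t)) = E_xi D(xi(t), eta). *)
Definition sip_expect_dual p (t : R) xi eta : \bar R :=
  fsip_expect p t xi (fun zeta => (dual zeta eta)%:E).

Definition negbin (l : R) (n : nat) : R :=
  (1 - l) `^ (m / 2) * (l ^+ n / n`!%:R) * (Gamma (m / 2 + n%:R) / Gamma (m / 2)).

(* mu is the product measure with marginals negbin (lam i); the finite
   dimensional distributions determine mu. *)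
Definition is_negbin_product (lam : int -> R) (mu : probability Omega R) : Prop :=
  forall (J : {fset int}) (k : int -> nat),
    mu [set eta | forall i, i \in J -> eta i = k i]
      = (\prod_(i <- J) negbin (lam i) (k i))%:E.

End SIP.

Definition smooth {R : realType} (f : R -> R) : Prop :=
  forall k y, derivable (derive1n k f) y 1.

(* psi is a classical solution on [0, +oo[ x R of d_t psi = D d_yy psi with
   initial datum psi0.  Solutions are not unique without a growth condition;
   "the" solution is the one of at most exponential growth in y, locally
   uniformly in t. *)
Record heat_solution {R : realType} (D : R) (psi0 : R -> R) (psi : R -> R -> R)
  : Prop := HeatSolution {
  heat_derivable_t : forall t y, 0 < t -> derivable (psi ^~ y) t 1 ;
  heat_derivable_y : forall t y, 0 < t -> derivable (psi t) y 1 ;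
  heat_derivable_yy : forall t y, 0 < t -> derivable (derive1 (psi t)) y 1 ;
  heat_eq : forall t y, 0 < t ->
    derive1 (psi ^~ y) t = D * derive1n 2 (psi t) y ;
  heat_init : forall y, psi 0 y = psi0 y ;
  heat_continuous :
    {within [set q : R * R | 0 <= q.1], continuous (fun q => psi q.1 q.2)} ;
  heat_growth : forall T, exists C a : R,
    forall t y, 0 <= t <= T -> `|psi t y| <= C * expR (a * `|y|) }.

(* Main.v *)
(** By duality and Tonelli the integral is E_xi (prod_x rho_N(x)) for finitely many
    particles at time N^2 t, where rho_N = lambda_N / (1 - lambda_N).

    For a trigonometric polynomial f, let f_s be its evolution under the
    independent walks of rate m / 2.  The attraction between the particles cancels
    in the generator on one-particle sums, and on products it leaves only terms with
    two discrete derivatives, carried by pairs at distance at most one.  A concave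
    function of the distance shows that such pairs occupy a time O(N) up to N^2 t,
    so E_xi (prod f(x / N)) differs from the product of f_{N^2 t} by O(1 / N), and
    f_{N^2 t} converges to the heat evolution of f.

    Replacing rho_N by f costs one-particle errors only.  A single particle has
    density O(1 / N) at time N^2 t (bound the indicator of a site by a Fejer kernel)
    and exponential moments, so the error is small: rho_N(floor (N y)) converges to
    rho(y) for every y, hence in mean square on compacts by dominated convergence,
    and f approximates rho on a compact while growing no faster than rho.  The
    maximum principle for solutions of exponential growth compares the heat
    evolution of f with psi. *)
Require Import Defs.
From HB Require Import structures.
From mathcomp Require Import all_boot all_order all_algebra.
From mathcomp Require Import finmap multiset.
From mathcomp Require Import all_classical all_reals all_analysis.
From mathcomp Require Import measurable_realfun.
From mathcomp Require Import zify ring lra.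
Set Implicit Arguments.
Unset Strict Implicit.
Unset Printing Implicit Defensive.
Import Order.TTheory GRing.Theory Num.Theory.
Import numFieldNormedType.Exports.
Local Open Scope classical_set_scope.
Local Open Scope ring_scope.

(** The transition function is known only through its derivative at time 0, tested on indicators, so
    no Kolmogorov equation is at hand. On configurations with a fixed number of particles the jump
    rates are bounded, and the axioms yield E f = f + h L f + O(h^2) with a uniform error. Chopping
    [0, t] into short steps then compares expectations with any function that satisfies a one-step
    inequality up to O(h^2). The density bound, the exponential moments and the product estimate are
    all instances of this comparison.

    Trigonometric polynomials serve as test functions because waves are eigenfunctions of both the
    lattice and the continuous Laplacian: both evolutions are explicit and converge mode by mode,
    with no heat kernel or local limit theorem. They are also closed under products, which makes a
    Weierstrass-type approximation possible.

    Expectations are formed for nonnegative functions only; this explains the additive constants M,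
    which cancel by conservation of mass. *)

Section EsumExtra.
Local Open Scope ereal_scope.
Context {R : realType}.

Lemma esum_ge_sum (T : choiceType) (a : T -> \bar R) (s : seq T) :
  (forall x, 0 <= a x) -> uniq s ->
  \sum_(x <- s) a x <= \esum_(x in [set: T]) a x.
Proof.
move=> a0 us; apply: esum_ge; exists [set` s].
  by split => //; exact: finite_seq.
by rewrite -fsbig_seq.
Qed.

Lemma esum_leP (T : choiceType) (a : T -> \bar R) (M : \bar R) :
  (forall s : {fset T}, \sum_(x <- s) a x <= M) ->
  \esum_(x in [set: T]) a x <= M.
Proof.
move=> H; rewrite /esum ge_ereal_sup => // _ [X [finX _]] <-.
by rewrite fsbig_finite.
Qed.

Lemma esumZl (T : choiceType) (c : R) (a : T -> \bar R) :
  (0 <= c)%R -> (forall x, 0 <= a x) ->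
  \esum_(x in [set: T]) (c%:E * a x) = c%:E * \esum_(x in [set: T]) a x.
Proof.
have le (d : R) (b : T -> \bar R) : (0 <= d)%R -> (forall x, 0 <= b x) ->
    \esum_(x in [set: T]) (d%:E * b x) <= d%:E * \esum_(x in [set: T]) b x.
  move=> d0 b0; apply: esum_leP => s.
  rewrite -ge0_sume_distrr//; apply: lee_pmul => //; first exact: sume_ge0.
  exact: esum_ge_sum.
move=> c0 a0; apply/eqP; rewrite eq_le le//=.
have [->|cn0] := eqVneq c 0%R.
  by rewrite mul0e esum_ge0// => x _; rewrite mul0e.
have {}c0 : (0 < c)%R by rewrite lt_neqAle eq_sym cn0.
(* The reverse inequality is the same bound for the constant c^-1 and the function c a. *)
have := @le c^-1%R (fun x => c%:E * a x).
rewrite invr_ge0 (ltW c0) => /(_ isT) H.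
have {}H := H (fun x => mule_ge0 (ltW (c0 : 0 < c%:E)) (a0 x)).
rewrite (eq_esum (b := a)) in H; last first.
  by move=> x _; rewrite muleA -EFinM mulVf// mul1e.
have := lee_pmul (ltW (c0 : 0 < c%:E)) (esum_ge0 (fun x _ => a0 x)) (lexx c%:E) H.
by rewrite [leRHS]muleA -EFinM mulfV// mul1e.
Qed.

Lemma exchange_esum (T T' : choiceType) (a : T -> T' -> \bar R) :
  (forall x y, 0 <= a x y) ->
  \esum_(x in [set: T]) \esum_(y in [set: T']) a x y =
  \esum_(y in [set: T']) \esum_(x in [set: T]) a x y.
Proof.
move=> a0; rewrite !esum_esum//=.
apply: (@reindex_esum R _ _ _ _ (fun k : T' * T => (k.2, k.1))
  (fun k => a k.1 k.2)).
split => //.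
- by move=> [? ?] [? ?] _ _ [-> ->].
- by move=> [x y] _; exists (y, x).
Qed.

End EsumExtra.

(** * Comparison for chains with bounded rates on an invariant set *)

Section BoundedRates.
Context {R : realType} {T : choiceType} (jumps : T -> seq (R * T)).
Context (p : R -> T -> T -> R).

(** The jumps out of a state form a list of pairs (rate, target) in which pairs may repeat:
    particles sharing a site produce identical jumps. *)
Definition jump_gen (f : T -> R) x : R :=
  \sum_(a <- jumps x) a.1 * (f a.2 - f x).

Definition transition_expect (t : R) x (f : T -> \bar R) : \bar R :=
  (\esum_(z in [set: T]) (p t x z)%:E * f z)%E.
Local Notation ex := transition_expect.

Hypothesis p_ge0 : forall (t : R) (x z : T), 0 <= t -> 0 <= p t x z.
Hypothesis p_mass : forall (t : R) (x : T), 0 <= t ->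
  (\esum_(z in [set: T]) (p t x z)%:E = 1)%E.
Hypothesis p_zero : forall x z : T, p 0 x z = (x == z)%:R.
Hypothesis p_semigroup : forall (s t : R) (x z : T), 0 <= s -> 0 <= t ->
  (\esum_(y in [set: T]) (p s x y * p t y z)%:E = (p (s + t) x z)%:E)%E.
Hypothesis p_gen : forall x z : T,
  h^-1 * (p h x z - p 0 x z) @[h --> 0^'+]
    --> jump_gen (fun y => (y == z)%:R) x.

Context (S : pred T) (L : R).
Hypothesis rate_ge0 : forall x (a : R * T), a \in jumps x -> 0 <= a.1.
Hypothesis jump_closed : forall x (a : R * T), S x -> a \in jumps x -> S a.2.
Hypothesis rate_le : forall x, S x -> \sum_(a <- jumps x) a.1 <= L.

Local Notation q x z := (jump_gen (fun y => (y == z)%:R) x).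

Section Expect.
Local Open Scope ereal_scope.

Lemma p_fin_ge0 (t : R) x z : (0 <= t)%R -> 0 <= (p t x z)%:E.
Proof. by move=> t0; rewrite lee_fin p_ge0. Qed.

Lemma ex_ge0 (t : R) x f : (0 <= t)%R -> (forall z, 0 <= f z) -> 0 <= ex t x f.
Proof. by move=> t0 f0; apply: esum_ge0 => z _; rewrite mule_ge0// p_fin_ge0. Qed.

Lemma le_ex (t : R) x f g : (0 <= t)%R -> (forall z, f z <= g z) ->
  ex t x f <= ex t x g.
Proof.
by move=> t0 fg; apply: le_esum => z _; rewrite lee_wpmul2l// p_fin_ge0.
Qed.

Lemma exD (t : R) x f g : (0 <= t)%R -> (forall z, 0 <= f z) -> (forall z, 0 <= g z) ->
  ex t x (f \+ g) = ex t x f + ex t x g.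
Proof.
move=> t0 f0 g0; rewrite /transition_expect -esumD; last 2 first.
- by move=> z _; rewrite mule_ge0// p_fin_ge0.
- by move=> z _; rewrite mule_ge0// p_fin_ge0.
by apply: eq_esum => z _ /=; rewrite ge0_muleDr.
Qed.

Lemma exZ (t : R) x (c : R) f : (0 <= t)%R -> (0 <= c)%R -> (forall z, 0 <= f z) ->
  ex t x (fun z => c%:E * f z) = c%:E * ex t x f.
Proof.
move=> t0 c0 f0; rewrite /transition_expect -esumZl//; last first.
  by move=> z; rewrite mule_ge0// p_fin_ge0.
by apply: eq_esum => z _; rewrite muleCA.
Qed.

Lemma ex_cst (t : R) x (c : R) : (0 <= t)%R -> (0 <= c)%R ->
  ex t x (fun=> c%:E) = c%:E.
Proof.
move=> t0 c0; rewrite /transition_expect.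
under eq_esum do rewrite muleC.
by rewrite esumZl// ?p_mass ?mule1// => z; rewrite p_fin_ge0.
Qed.

Lemma ex_semigroup (s t : R) x f : (0 <= s)%R -> (0 <= t)%R -> (forall z, 0 <= f z) ->
  ex (s + t)%R x f = ex s x (fun y => ex t y f).
Proof.
move=> s0 t0 f0; rewrite /transition_expect.
transitivity (\esum_(z in [set: T]) \esum_(y in [set: T])
    ((p s x y * p t y z)%:E * f z)).
  apply: eq_esum => z _; rewrite -p_semigroup//.
  have pp0 y : 0 <= (p s x y * p t y z)%:E by rewrite lee_fin mulr_ge0// p_ge0.
  (* The value +oo is outside the scope of [esumZl]; both sides are then 0 or +oo according to
     whether some intermediate y has positive weight. *)
  case: (f z) (f0 z) => [r| |] //; last first.
    move=> _; have [/eqP|] := eqVneq (\esum_(y in [set: T]) (p s x y * p t y z)%:E) 0.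
      move=> /eqP e0; rewrite e0 mul0e esum1// => y _.
      have : (p s x y * p t y z)%:E <= 0.
        rewrite -e0; apply: le_trans (@esum_ge_sum R T _ [:: y] _ _) => //.
        by rewrite big_seq1.
      by move=> ple; rewrite (_ : _%:E = 0) ?mul0e//; apply/eqP; rewrite eq_le ple pp0.
    move=> n0; rewrite gt0_muley; last first.
      by rewrite lt_neqAle eq_sym n0/=; apply: esum_ge0.
    have [y yn0] : exists y, (p s x y * p t y z)%:E != 0.
      apply/not_existsP => H; move: n0; rewrite esum1 ?eqxx// => y _.
      by apply/eqP; have /negP := H y; rewrite negbK.
    apply/esym/eqP; rewrite eq_le leey/=; apply: le_trans (@esum_ge_sum R T _ [:: y] _ _) => //.
      by rewrite big_seq1 gt0_muley// lt_neqAle eq_sym yn0 pp0.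
    by move=> y'; rewrite mule_ge0.
  rewrite lee_fin => r0; rewrite muleC -esumZl//.
  by apply: eq_esum => y _; rewrite muleC.
rewrite exchange_esum; last first.
  by move=> z y; rewrite mule_ge0// lee_fin mulr_ge0// p_ge0.
apply: eq_esum => y _; rewrite -esumZl ?p_ge0//; last first.
  by move=> z; rewrite mule_ge0// p_fin_ge0.
by apply: eq_esum => z _; rewrite EFinM muleA.
Qed.

Lemma ex_ge_sum (t : R) x f s : (0 <= t)%R -> (forall z, 0 <= f z) -> uniq s ->
  \sum_(z <- s) (p t x z)%:E * f z <= ex t x f.
Proof. by move=> t0 f0 us; apply: esum_ge_sum => // z; rewrite mule_ge0// p_fin_ge0. Qed.

End Expect.

Lemma p_path (s t : R) x y z : 0 <= s -> 0 <= t -> p s x y * p t y z <= p (s + t) x z.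
Proof.
move=> s0 t0; rewrite -lee_fin -p_semigroup//.
apply: le_trans (@esum_ge_sum R T _ [:: y] _ _) => //; first by rewrite big_seq1.
by move=> y'; rewrite lee_fin mulr_ge0// p_ge0.
Qed.

(** Keeping the intermediate states x and z records one jump from x to z, made either in the second
    or in the first part of the time. *)
Lemma p_path2 (s t : R) x z : x != z -> 0 <= s -> 0 <= t ->
  p s x x * p t x z + p s x z * p t z z <= p (s + t) x z.
Proof.
move=> xz s0 t0; rewrite -lee_fin -p_semigroup//.
apply: le_trans (@esum_ge_sum R T _ [:: x; z] _ _) => //.
- by rewrite big_cons big_seq1.
- by move=> y'; rewrite lee_fin mulr_ge0// p_ge0.
- by rewrite /= inE xz.
Qed.

Lemma q_diag_le0 x : q x x <= 0.
Proof.
rewrite /jump_gen big_seq; apply: sumr_le0 => a ax.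
by rewrite mulr_ge0_le0 ?(rate_ge0 ax)// eqxx subr_le0 lern1 leq_b1.
Qed.

(* Superadditivity of log p t x x, in the polynomial form given by Bernoulli's inequality. *)
Lemma p_diag x (t : R) : 0 <= t -> 1 + q x x * t <= p t x x.
Proof.
move=> t0.
have [->|tn0] := eqVneq t 0; first by rewrite mulr0 addr0 p_zero eqxx.
have {tn0}t0 : 0 < t by rewrite lt_neqAle eq_sym tn0.
apply/ler_addgt0Pr => e e0.
(* An exit rate slightly above the true one, so that 1 - l s bounds p s x x from below for every
   short s. *)
pose l := - q x x + e / t.
have l0 : 0 < l.
  by have := q_diag_le0 x; have : 0 < e / t by [exact: divr_gt0]; rewrite /l; lra.
have : \forall h \near 0^'+, - l < h^-1 * (p h x x - p 0 x x).
  apply: cvgr_gt; first exact: p_gen.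
  by rewrite /l opprD opprK ltrBlDr ltrDl divr_gt0.
case=> d /= d0 Hd.
pose k := (Num.truncn (t / d + t * l)).+1.
have k0 : (0 : R) < k%:R by rewrite ltr0n.
have tk : t / d + t * l < k%:R by rewrite /k; exact: truncnS_gt.
pose s := t / k%:R.
have s0 : 0 < s by rewrite divr_gt0.
have sd : s < d.
  rewrite /s ltr_pdivrMr// -ltr_pdivrMl// mulrC; apply: le_lt_trans tk.
  by rewrite lerDl mulr_ge0// ltW.
have ps : 1 - l * s <= p s x x.
  have : - l < s^-1 * (p s x x - p 0 x x).
    by apply: Hd => //=; rewrite /ball/= sub0r normrN gtr0_norm.
  by rewrite p_zero eqxx ltr_pdivlMl//= => ?; lra.
have H j : 1 - l * s * j%:R <= p (s * j%:R) x x.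
  elim: j => [|j IH]; first by rewrite !mulr0 subr0 p_zero eqxx.
  have sj0 : 0 <= s * j%:R by rewrite mulr_ge0// ltW.
  rewrite -natr1 !mulrDr !mulr1 [s * _ + _]addrC.
  apply: le_trans (p_path x x x (ltW s0) sj0).
  have ppos := p_ge0 x x (ltW s0).
  have [jn|jp] := ltP (1 - l * s * j%:R) 0.
    apply: (@le_trans _ _ 0); last by rewrite mulr_ge0// p_ge0.
    by have := mulr_ge0 (ltW l0) (ltW s0); lra.
  apply: (@le_trans _ _ ((1 - l * s) * (1 - l * s * j%:R))); last first.
    by apply: (@le_trans _ _ (p s x x * (1 - l * s * j%:R))); rewrite ?ler_wpM2r ?ler_wpM2l.
  have : 0 <= (l * s) * (l * s * j%:R) by rewrite !mulr_ge0// ltW.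
  by lra.
have sk : s * k%:R = t by rewrite /s divfK ?gt_eqF.
have := H k; rewrite -mulrA sk /l mulrDl divfK ?gt_eqF//; lra.
Qed.

(** Cut h into equal short steps. The jump may take place in any one of them, the chain waiting at x
    before and at z after, and [p_diag] bounds the waiting probabilities from below; this costs the
    factor 1 - L h. As the steps get shorter, their number times the one-step probability tends to h
    q. *)
Lemma p_offdiag x z (h : R) : x != z -> - L <= q x x -> - L <= q z z -> 0 <= h ->
  h * q x z * (1 - L * h) <= p h x z.
Proof.
move=> xz Lx Lz h0.
have q0 : 0 <= q x z.
  rewrite /jump_gen big_seq; apply: sumr_ge0 => a ax.
  by rewrite (negbTE xz) subr0 mulr_ge0 ?(rate_ge0 ax).
have L0 : 0 <= L by have := q_diag_le0 x; lra.
have [Lh|Lh] := ltP (1 - L * h) 0.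
  apply: (@le_trans _ _ 0); last exact: p_ge0.
  by rewrite mulr_ge0_le0// ?mulr_ge0// ltW.
have [->|hn0] := eqVneq h 0; first by rewrite !mul0r p_ge0.
have {hn0}h0 : 0 < h by rewrite lt_neqAle eq_sym hn0.
have H d j : 0 < d -> L * (d * j%:R) <= 1 ->
    j%:R * p d x z * (1 - L * (d * j%:R)) <= p (d * j%:R) x z.
  move=> d0; elim: j => [|j IH]; first by rewrite !mul0r p_ge0// mulr0.
  have dj0 : 0 <= d * j%:R by rewrite mulr_ge0// ltW.
  have p0 := p_ge0 x z (ltW d0).
  rewrite -natr1 !mulrDr !mulr1 => Lj.
  have Ld0 : 0 <= L * d by rewrite mulr_ge0// ltW.
  rewrite [d * _ + _]addrC.
  apply: le_trans (p_path2 xz (ltW d0) dj0).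
  have Ldj : L * (d * j%:R) <= 1 by lra.
  have {}IH := IH Ldj.
  have Ldj0 : 0 <= L * (d * j%:R) by rewrite mulr_ge0.
  have pxx : 1 - L * d <= p d x x.
    by apply: le_trans (p_diag x (ltW d0)); rewrite lerD2l -mulNr ler_wpM2r// ltW.
  have pzz : 1 - L * (d * j%:R) <= p (d * j%:R) z z.
    by apply: le_trans (p_diag z dj0); rewrite lerD2l -mulNr ler_wpM2r.
  have A1 : 0 <= j%:R * p d x z * (1 - L * (d * j%:R)).
    by rewrite !mulr_ge0// subr_ge0.
  have A2 : (1 - L * d) * (j%:R * p d x z * (1 - L * (d * j%:R)))
      <= p d x x * p (d * j%:R) x z.
    apply: (@le_trans _ _ (p d x x * (j%:R * p d x z * (1 - L * (d * j%:R))))).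
      exact: ler_wpM2r.
    by rewrite ler_wpM2l// p_ge0// ltW.
  have A3 : p d x z * (1 - L * (d * j%:R)) <= p d x z * p (d * j%:R) z z.
    by rewrite ler_wpM2l.
  apply: le_trans (lerD A2 A3).
  have : 0 <= (j%:R * p d x z) * ((L * d) * (L * (d * j%:R))).
    by rewrite !mulr_ge0// ltW.
  have : 0 <= p d x z * (L * d) by rewrite mulr_ge0.
  lra.
apply/ler_addgt0Pr => e e0.
have xz0 : (x == z)%:R = 0 :> R by rewrite (negbTE xz).
have : \forall d \near 0^'+, q x z - e / h < d^-1 * (p d x z - p 0 x z).
  apply: cvgr_gt; first exact: p_gen.
  by rewrite ltrBlDr ltrDl divr_gt0.
case=> d /= d0 Hd.
pose k := (Num.truncn (h / d)).+1.
have k0 : (0 : R) < k%:R by rewrite ltr0n.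
have hk : h / d < k%:R by exact: Num.Theory.truncnS_gt.
pose s := h / k%:R.
have s0 : 0 < s by rewrite divr_gt0.
have sd : s < d by rewrite /s ltr_pdivrMr// -ltr_pdivrMl// mulrC.
have sk : s * k%:R = h by rewrite /s divfK ?gt_eqF.
have ps : s * (q x z - e / h) <= p s x z.
  have : q x z - e / h < s^-1 * (p s x z - p 0 x z).
    by apply: Hd => //=; rewrite /ball/= sub0r normrN gtr0_norm.
  by rewrite p_zero xz0 subr0 ltr_pdivlMl// => /ltW.
have := H s k s0; rewrite sk => /(_ _)/le_trans Hk.
rewrite -lerBlDr; apply: le_trans (Hk _ _ (lexx _)); last by lra.
apply: (@le_trans _ _ (k%:R * (s * (q x z - e / h)) * (1 - L * h))); last first.
  by rewrite ler_wpM2r// ler_wpM2l// ltW.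
have -> : k%:R * (s * (q x z - e / h)) = h * q x z - e.
  by rewrite mulrA (mulrC k%:R) sk mulrBr (mulrC h (e / h)) divfK ?gt_eqF.
have : 0 <= e * (L * h) by rewrite !mulr_ge0// ltW.
lra.
Qed.

(** For f >= 0 the sum may be restricted to x and the targets of a single jump, where [p_diag] and
    [p_offdiag] apply. The error term is what the factor 1 - L h of [p_offdiag] loses. *)
Lemma expect_lower (h : R) x (f : T -> R) (M : R) : S x -> 0 <= h ->
  (forall z, 0 <= f z) -> (forall z, f z <= M) ->
  ((f x + h * jump_gen f x - h ^+ 2 * L ^+ 2 * M)%:E <= ex h x (EFin \o f))%E.
Proof.
move=> Sx h0 f0 fM.
have Lq y : S y -> - L <= q y y.
  move=> Sy; rewrite lerNl; apply: le_trans (rate_le Sy).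
  rewrite /jump_gen -sumrN big_seq [leRHS]big_seq; apply: ler_sum => a ay.
  rewrite eqxx mulrBr mulr1 opprB lerBlDr lerDl mulr_ge0 ?(rate_ge0 ay)//.
have L0 : 0 <= L by have := Lq _ Sx; have := q_diag_le0 x; lra.
(* A target reached by several jumps occurs once in the sum of transition probabilities; [B] below
   recovers the individual rates. *)
pose s := undup [seq a.2 | a <- jumps x & a.2 != x].
have us : uniq (x :: s).
  rewrite /= undup_uniq andbT mem_undup; apply/mapP => -[a].
  by rewrite mem_filter => /andP[ax _] xa; rewrite -xa eqxx in ax.
apply: le_trans (ex_ge_sum (t:=h) x h0 _ us); last by move=> z; rewrite lee_fin.
rewrite big_cons /= -EFinM.
under eq_bigr do rewrite -EFinM.
rewrite sumEFin -EFinD lee_fin.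
have sx z : z \in s -> x != z /\ S z.
  rewrite mem_undup => /mapP[a]; rewrite mem_filter => /andP[ax aj] ->.
  by rewrite eq_sym; split => //; exact: jump_closed aj.
have A : \sum_(z <- s) h * q x z * (1 - L * h) * f z <= \sum_(z <- s) p h x z * f z.
  rewrite big_seq [leRHS]big_seq; apply: ler_sum => z /sx[xz Sz].
  by rewrite ler_wpM2r// p_offdiag ?Lq.
pose J := \sum_(a <- jumps x | a.2 != x) a.1 * f a.2.
have B : \sum_(z <- s) q x z * f z = J.
  transitivity (\sum_(z <- s) \sum_(a <- jumps x) a.1 * (a.2 == z)%:R * f z).
    apply: eq_big_seq => z /sx[xz _]; rewrite /jump_gen mulr_suml.
    by apply: eq_bigr => a _; rewrite (negbTE xz) subr0.
  rewrite exchange_big /= /J [RHS]big_mkcond/=; apply: eq_big_seq => a ax.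
  case: ifPn => [an|/negPn/eqP ae].
    have as_ : a.2 \in s.
      by rewrite mem_undup; apply/mapP; exists a => //; rewrite mem_filter an.
    rewrite (bigD1_seq a.2)//= ?undup_uniq// eqxx mulr1 big1 ?addr0// => z.
    by rewrite eq_sym => /negbTE ->; rewrite mulr0 mul0r.
  rewrite big_seq big1// => z /sx[xz _].
  by rewrite ae (negbTE xz) mulr0 mul0r.
have J0 : 0 <= J.
  by rewrite /J big_seq_cond; apply: sumr_ge0 => a /andP[aj _]; rewrite mulr_ge0 ?(rate_ge0 aj).
have JM : J <= L * M.
  have M0 : 0 <= M := le_trans (f0 x) (fM x).
  apply: (@le_trans _ _ (\sum_(a <- jumps x) a.1 * M)); last first.
    by rewrite -mulr_suml ler_wpM2r// rate_le.
  rewrite /J big_mkcond/= big_seq [leRHS]big_seq; apply: ler_sum => a aj.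
  by case: ifP => _; rewrite ?mulr_ge0 ?ler_wpM2l ?(rate_ge0 aj).
have G : jump_gen f x = J + q x x * f x.
  rewrite /J /jump_gen mulr_suml (big_mkcond (fun a => a.2 != x))/= -big_split/=.
  apply: eq_bigr => a _; rewrite eqxx; case: eqP => [->|_]/=; ring.
have C : (1 + q x x * h) * f x <= p h x x * f x by rewrite ler_wpM2r// p_diag.
apply: le_trans (lerD C A).
rewrite (eq_bigr (fun z => (h * (1 - L * h)) * (q x z * f z))); last by move=> z _; ring.
rewrite -mulr_sumr B G.
have : h ^+ 2 * L * J <= h ^+ 2 * L * (L * M) by rewrite ler_wpM2l// mulr_ge0// exprn_ge0.
lra.
Qed.

(** The lower bound for M - f: since the total mass is 1, no upper bound on the transition
    probabilities is required. *)
Lemma expect_upper (h : R) x (f : T -> R) (M : R) : S x -> 0 <= h ->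
  (forall z, 0 <= f z) -> (forall z, f z <= M) ->
  (ex h x (EFin \o f) <=
   (f x + h * jump_gen f x + h ^+ 2 * L ^+ 2 * M)%:E)%E.
Proof.
move=> Sx h0 f0 fM; have M0 : 0 <= M := le_trans (f0 x) (fM x).
have := @expect_lower h x (fun z => M - f z) M Sx h0.
have -> : jump_gen (fun z => M - f z) x = - jump_gen f x.
  by rewrite /jump_gen -sumrN; apply: eq_bigr => a _; ring.
have fM0 z : 0 <= M - f z by rewrite subr_ge0.
have fM1 z : M - f z <= M by rewrite lerBlDr lerDl.
move=> /(_ fM0 fM1) H.
have E : (ex h x (EFin \o f) + ex h x (EFin \o (fun z => (M - f z)%R)) = M%:E)%E.
  rewrite -exD//.
  rewrite -(ex_cst x h0 M0); congr transition_expect; apply/funext => z /=.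
  by rewrite -EFinD addrC subrK.
have e0 : (0 <= ex h x (EFin \o f))%E by apply: ex_ge0 => // z; rewrite lee_fin.
have e1 : (0 <= ex h x (EFin \o (fun z => (M - f z)%R)))%E.
  by apply: ex_ge0 => // z; rewrite lee_fin subr_ge0.
move: H E e0 e1.
case: (ex h x (EFin \o f)) => [u| |] //; case: (ex h x _) => [v| |] //.
rewrite -EFinD !lee_fin => H [uv] _ _; lra.
Qed.

Lemma support_lower (h : R) x : 0 <= h -> S x ->
  ((1 - h ^+ 2 * L ^+ 2)%:E <= ex h x (fun z => (S z)%:R%:E))%E.
Proof.
move=> h0 Sx.
have := @expect_lower h x (fun z => (S z)%:R) 1 Sx h0.
have -> : jump_gen (fun z => (S z)%:R) x = 0.
  rewrite /jump_gen big_seq big1// => a ax.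
  by rewrite Sx (jump_closed Sx ax) subrr mulr0.
rewrite Sx mulr0 addr0 mulr1; apply => z; first by case: (S z).
by rewrite lern1 leq_b1.
Qed.

Lemma natmulDl1 (h : R) (k : nat) : h * k.+1%:R = h + h * k%:R.
Proof. by rewrite -natr1 mulrDr mulr1 addrC. Qed.

(** The indicator of S has zero generator on S, so a step of length h leaves S with probability at
    most (h L)^2. Over k steps of length t / k the losses add up to O(1 / k). *)
Lemma p_support (t : R) x z : 0 <= t -> S x -> ~~ S z -> p t x z = 0.
Proof.
move=> t0 Sx Sz; apply/eqP; rewrite eq_le p_ge0// andbT.
suff H : (1 <= ex t x (fun z => (S z)%:R%:E))%E.
  have : (ex t x (fun z => (S z)%:R%:E) + ex t x (fun z => (~~ S z)%:R%:E) = 1)%E.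
    rewrite -exD//.
    rewrite -(ex_cst x t0 ler01); congr transition_expect; apply/funext => y /=.
    by rewrite -EFinD; case: (S y); rewrite /= ?addr0 ?add0r.
  have : ((p t x z)%:E <= ex t x (fun z => (~~ S z)%:R%:E))%E.
    apply: le_trans (ex_ge_sum (t:=t) x t0 _ (s:=[:: z]) _) => //.
    by rewrite big_seq1 Sz mule1.
  have : (0 <= ex t x (fun z => (~~ S z)%:R%:E))%E.
    by apply: ex_ge0 => // y; rewrite lee_fin.
  move: H; case: (ex t x _) => [u| |] //; case: (ex t x _) => [v| |] //.
  by rewrite -EFinD !lee_fin => ? ? ? [?]; lra.
have H k : ((1 - k.+1%:R^-1 * t ^+ 2 * L ^+ 2)%:E <= ex t x (fun z => (S z)%:R%:E))%E.
  pose h := t / k.+1%:R.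
  have h0 : 0 <= h by rewrite divr_ge0.
  have hk : h * k.+1%:R = t by rewrite /h divfK ?pnatr_eq0.
  have hL : 0 <= h ^+ 2 * L ^+ 2 by rewrite mulr_ge0 ?sqr_ge0.
  have S0 y : (0 <= (S y)%:R%:E :> \bar R)%E by rewrite lee_fin.
  have J j y : S y -> ((1 - j%:R * (h ^+ 2 * L ^+ 2))%:E <=
      ex (h * j%:R) y (fun z => (S z)%:R%:E))%E.
    have hj0 i : 0 <= h * i%:R by rewrite mulr_ge0.
    elim: j y => [|j IH] y Sy.
      rewrite mul0r mulr0 subr0 -{1}(ex_cst y (lexx 0) ler01).
      apply: le_esum => w _; rewrite p_zero; case: eqP => [<-|_].
        by rewrite Sy.
      by rewrite !mul0e.
    have [jn|jp] := leP (1 - j%:R * (h ^+ 2 * L ^+ 2)) 0.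
      apply: (@le_trans _ _ 0%E); last exact: ex_ge0.
      by rewrite lee_fin -natr1; lra.
    rewrite natmulDl1 ex_semigroup//.
    apply: (@le_trans _ _ ((1 - j%:R * (h ^+ 2 * L ^+ 2))%:E * ex h y (fun z => (S z)%:R%:E))%E).
      apply: (@le_trans _ _ ((1 - j%:R * (h ^+ 2 * L ^+ 2))%:E * (1 - h ^+ 2 * L ^+ 2)%:E)%E).
        rewrite -EFinM lee_fin -natr1.
        have : 0 <= j%:R * (h ^+ 2 * L ^+ 2) * (h ^+ 2 * L ^+ 2).
          by rewrite mulr_ge0 ?hL// mulr_ge0 ?hL.
        lra.
      by rewrite lee_wpmul2l ?lee_fin ?(ltW jp)//; apply: support_lower.
    rewrite -exZ ?(ltW jp)//; apply: le_ex => // w.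
    have [Sw|Sw] := boolP (S w); first by rewrite mule1 IH.
    by rewrite mule0 ex_ge0.
  have := J k.+1 x Sx; rewrite hk; apply: le_trans.
  rewrite lee_fin lerB// /h le_eqVlt; apply/orP; left; apply/eqP.
  by field; rewrite addrC natr1 pnatr_eq0.
apply/lee_addgt0Pr => e e0.
pose k := Num.truncn (t ^+ 2 * L ^+ 2 / e).
have kP : t ^+ 2 * L ^+ 2 / e < k.+1%:R by exact: Num.Theory.truncnS_gt.
apply: (@le_trans _ _ ((1 - k.+1%:R^-1 * t ^+ 2 * L ^+ 2)%:E + e%:E)%E); last first.
  by rewrite leeD2r.
rewrite -EFinD lee_fin -[_ * _ * _]mulrA mulrC.
have : t ^+ 2 * L ^+ 2 / k.+1%:R < e.
  by rewrite ltr_pdivrMr ?ltr0n// (mulrC e) -ltr_pdivrMr.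
by move: (_ / k.+1%:R) => u; lra.
Qed.

Lemma le_ex_supp (t : R) x f g : 0 <= t -> S x ->
  (forall z, S z -> (f z <= g z)%E) -> (ex t x f <= ex t x g)%E.
Proof.
move=> t0 Sx fg; apply: le_esum => z _.
have [Sz|Sz] := boolP (S z); first by rewrite lee_wpmul2l ?fg// p_fin_ge0.
by rewrite (p_support t0 Sx Sz) !mul0e.
Qed.

(** Here s is the remaining time: G s z + M bounds the expectation of f after time s from z. Over k
    steps of length t / k the one-step errors O(h^2) add up to O(1 / k), so G has to be a
    supersolution to first order only. Adding M makes it nonnegative. *)
Lemma ex_supersolution (G : R -> T -> R) (f : T -> \bar R) (t M C : R) x :
  S x -> 0 <= t -> 0 <= C ->
  (forall (s : R) z, 0 <= s <= t -> S z -> `|G s z| <= M) ->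
  (forall (s h : R) z, 0 <= s -> 0 <= h -> s + h <= t -> S z ->
    G s z + h * jump_gen (G s) z <= G (s + h) z + C * h ^+ 2) ->
  (forall z, S z -> (f z <= (G 0%R z + M)%:E)%E) ->
  (ex t x f <= (G t x + M)%:E)%E.
Proof.
move=> Sx t0 C0 GM Gsup fG.
(* Off S nothing is known about G, whereas [expect_upper] asks for bounds at every state; the value
   0 is harmless since S is closed under jumps. *)
pose G' s z := if S z then G s z + M else 0.
have M0 : 0 <= M by apply: le_trans (GM 0 x _ Sx); rewrite ?lexx.
have G'S s z : S z -> G' s z = G s z + M by rewrite /G' => ->.
have G'0 (s : R) z : 0 <= s <= t -> 0 <= G' s z.
  rewrite /G'; case: ifPn => // Sz /GM /(_ Sz); rewrite ler_norml => /andP[]; lra.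
have G'M (s : R) z : 0 <= s <= t -> G' s z <= 2 * M.
  rewrite /G'; case: ifPn => [Sz /GM /(_ Sz)|_ _]; rewrite ?ler_norml ?mulr_ge0//.
  by move=> /andP[]; lra.
have G'gen s z : S z -> jump_gen (G' s) z = jump_gen (G s) z.
  move=> Sz; apply: eq_big_seq => a aj.
  by rewrite !G'S ?(jump_closed Sz aj)//; congr (_ * _); ring.
pose C' := C + L ^+ 2 * (2 * M).
have C'0 : 0 <= C' by rewrite addr_ge0// mulr_ge0 ?sqr_ge0// mulr_ge0.
have step (s h : R) z : 0 <= s -> 0 <= h -> s + h <= t -> S z ->
    (ex h z (EFin \o G' s) <= (G' (s + h) z + C' * h ^+ 2)%:E)%E.
  move=> s0 h0 sh Sz.
  have s1 : 0 <= s <= t by rewrite s0 (le_trans _ sh)// lerDl.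
  apply: le_trans (expect_upper Sz h0 (G'0 s ^~ s1) (G'M s ^~ s1)) _.
  rewrite lee_fin G'gen// !G'S//.
  by have := Gsup s h z s0 h0 sh Sz; rewrite /C'; lra.
have H k : (ex t x (EFin \o G' 0%R) <= (G' t x + C' * t ^+ 2 / k.+1%:R)%:E)%E.
  pose h := t / k.+1%:R.
  have h0 : 0 <= h by rewrite divr_ge0.
  have hk : h * k.+1%:R = t by rewrite /h divfK ?pnatr_eq0.
  have hj0 i : 0 <= h * i%:R by rewrite mulr_ge0.
  have J j z : (j <= k.+1)%N -> S z ->
    (ex (h * j%:R)%R z (EFin \o G' 0%R) <= (G' (h * j%:R) z + j%:R * (C' * h ^+ 2))%:E)%E.
    elim: j z => [|j IH] z jk Sz.
      rewrite mulr0 mul0r addr0.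
      apply: le_trans (expect_upper Sz (lexx 0) (G'0 0 ^~ _) (G'M 0 ^~ _)) _; rewrite ?lexx//.
      by rewrite lee_fin mul0r expr2 !mul0r !addr0.
    have jt : h * j%:R + h <= t.
      by rewrite -hk addrC -natmulDl1 ler_wpM2l// ler_nat.
    have jt' : h * j%:R <= t by apply: le_trans jt; rewrite lerDl.
    rewrite natmulDl1 ex_semigroup//; last first.
      by move=> w; rewrite lee_fin G'0// lexx.
    have c0 : 0 <= j%:R * (C' * h ^+ 2) by rewrite mulr_ge0// mulr_ge0 ?sqr_ge0.
    apply: (@le_trans _ _ (ex h z ((EFin \o G' (h * j%:R)) \+ fun=> (j%:R * (C' * h ^+ 2))%:E))).
      apply: le_ex_supp => // w Sw /=; rewrite -EFinD.
      by apply: IH => //; exact: ltnW.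
    rewrite exD//; last first.
      by move=> w; rewrite lee_fin G'0// hj0.
    rewrite ex_cst//; apply: le_trans (leeD2r _ (step _ _ _ (hj0 j) h0 jt Sz)) _.
    by rewrite -EFinD lee_fin [h * _ + h]addrC -natr1; lra.
  have := J k.+1 x (leqnn _) Sx; rewrite hk => /le_trans; apply.
  rewrite lee_fin lerD2l /h le_eqVlt; apply/orP; left; apply/eqP.
  by field; rewrite addrC natr1 pnatr_eq0.
apply: (@le_trans _ _ (ex t x (EFin \o G' 0%R))).
  by apply: le_ex_supp => // z Sz /=; rewrite G'S// fG.
rewrite -(G'S t x Sx).
apply/lee_addgt0Pr => e e0.
pose k := Num.truncn (C' * t ^+ 2 / e).
have kP : C' * t ^+ 2 / e < k.+1%:R by exact: Num.Theory.truncnS_gt.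
apply: le_trans (H k) _; rewrite -EFinD lee_fin lerD2l.
by rewrite ler_pdivrMr ?ltr0n// (mulrC e) -ler_pdivrMr// ltW.
Qed.

(* The bounded truncations [Num.min W M] are again supersolutions. *)
Lemma ex_exp_supersolution (W : T -> R) (c t : R) x : S x -> 0 <= t -> 0 <= c ->
  (forall z, 0 <= W z) -> (forall z, S z -> jump_gen W z <= c * W z) ->
  (ex t x (EFin \o W) <= (expR (c * t) * W x)%:E)%E.
Proof.
move=> Sx t0 c0 W0 WS.
apply: esum_leP => s.
(* A truncation level above all values of W on the finite set s, so that W and its truncation agree
   in this partial sum. *)
pose M := \sum_(z <- s) W z.
pose WM z := Num.min (W z) M.
have M0 : 0 <= M by apply: sumr_ge0.
have WM0 z : 0 <= WM z by rewrite /WM le_min W0 M0.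
have sM z : z \in s -> W z = WM z.
  move=> zs; rewrite /WM min_l// /M (big_fsetD1 z)//= lerDl; exact: sumr_ge0.
rewrite big_seq (eq_bigr (fun z => ((p t x z)%:E * (WM z)%:E)%E)); last first.
  by move=> z /sM /= ->.
rewrite -big_seq.
apply: (@le_trans _ _ (ex t x (EFin \o WM))).
  by apply: ex_ge_sum => // z; rewrite lee_fin.
have WMgen z : S z -> jump_gen WM z <= c * WM z.
  move=> Sz; have [WzM|MWz] := leP (W z) M.
    apply: (@le_trans _ _ (jump_gen W z)); last by rewrite /WM min_l// WS.
    rewrite /jump_gen big_seq [leRHS]big_seq; apply: ler_sum => a aj.
    rewrite ler_wpM2l ?(rate_ge0 aj)// /WM [in X in _ - X]min_l// lerD2r.
    by rewrite ge_min lexx.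
  apply: (@le_trans _ _ 0); last by rewrite mulr_ge0.
  rewrite /jump_gen big_seq; apply: sumr_le0 => a aj.
  rewrite mulr_ge0_le0 ?(rate_ge0 aj)// subr_le0 /WM [leRHS]min_r ?(ltW MWz)//.
  by rewrite ge_min lexx orbT.
pose B := expR (c * t) * M.
have B0 : 0 <= B by rewrite mulr_ge0// expR_ge0.
have H := @ex_supersolution (fun s z => expR (c * s) * WM z)
  (fun z => (WM z + B)%:E) t B 0 x Sx t0 (lexx 0).
have : (ex t x (fun z => (WM z + B)%:E) <= (expR (c * t) * WM x + B)%:E)%E.
  apply: H => [s' z /andP[s0 st] Sz|s' h z s0 h0 sh Sz|z Sz].
  - rewrite ger0_norm ?mulr_ge0 ?expR_ge0// ler_pM ?expR_ge0//.
      by rewrite ler_expR ler_wpM2l.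
    by rewrite ge_min lexx orbT.
  - have -> : jump_gen (fun z => expR (c * s') * WM z) z = expR (c * s') * jump_gen WM z.
      by rewrite /jump_gen mulr_sumr; apply: eq_bigr => a _; ring.
    rewrite mul0r addr0 mulrDr expRD.
    apply: (@le_trans _ _ (expR (c * s') * ((1 + c * h) * WM z))).
      rewrite mulrCA -mulrDr ler_wpM2l ?expR_ge0// mulrDl mul1r lerD2l.
      by rewrite (mulrC c) -mulrA ler_wpM2l// WMgen.
    by rewrite -mulrA ler_wpM2l ?expR_ge0// ler_wpM2r// expR_ge1Dx.
  - by rewrite mulr0 expR0 mul1r.
have -> : (fun z => (WM z + B)%:E) = ((EFin \o WM) \+ (fun=> B%:E))%E by [].
rewrite exD//.
rewrite ex_cst// EFinD leeD2rE//.
move=> /le_trans; apply; rewrite lee_fin ler_wpM2l ?expR_ge0//.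
by rewrite ge_min lexx.
Qed.

End BoundedRates.

Notation particles xi := (@enum_mset int xi).

(** * The generator on one-particle sums and on products *)

Section Generator.
Context {R : realType} (m : R).
Implicit Types (xi : fconf) (g v : int -> R).

(** Listing particles instead of occupied sites turns the factor xi_i of the rate into repetition of
    the jump. *)
Definition sip_jumps xi : seq (R * fconf) :=
  [seq (m / 2 + (xi j)%:R, fmove i j xi) | i <- particles xi, j <- [:: i - 1; i + 1]].

Lemma sum_sip_jumps xi (F : R * fconf -> R) :
  \sum_(a <- sip_jumps xi) F a =
  \sum_(i <- particles xi) \sum_(j <- [:: i - 1; i + 1]) F (m / 2 + (xi j)%:R, fmove i j xi).
Proof. by rewrite /sip_jumps big_allpairs_dep. Qed.

Lemma sip_gen_jumps f xi : sip_gen m f xi = jump_gen sip_jumps f xi.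
Proof.
rewrite /jump_gen sum_sip_jumps [RHS]big_mset /sip_gen.
apply: eq_bigr => i _; rewrite Monoid.iteropE iter_addr_0 -[RHS]mulr_natl mulr_sumr.
by apply: eq_bigr => j _; rewrite mulrA.
Qed.

Lemma perm_fmove i j xi : perm_eq (particles (fmove i j xi)) (j :: rem i (particles xi)).
Proof.
apply/allP => a _ /=; rewrite count_mem_mset mset1DE msetB1E count_mem_rem.
by rewrite count_mem_mset (eq_sym a j) (eq_sym a i).
Qed.

Lemma size_fmove i j xi : i \in particles xi -> size (particles (fmove i j xi)) = size (particles xi).
Proof.
move=> ixi; rewrite (perm_size (perm_fmove i j xi))/= size_rem// prednK//.
by case: (particles xi) ixi.
Qed.

Lemma sip_jumpsP xi a : a \in sip_jumps xi -> exists i j,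
  [/\ i \in particles xi, j \in [:: i - 1; i + 1] &
      a = (m / 2 + (xi j)%:R, fmove i j xi)].
Proof.
by move=> /allpairsPdep[i [j [ixi ji ->]]]; exists i, j.
Qed.

Lemma big_xi_nat xi j : (xi j)%:R = \sum_(b <- particles xi) (b == j)%:R :> R.
Proof.
rewrite -count_mem_mset -sum1_count natr_sum big_mkcond/=.
by apply: eq_bigr => b _; case: eqP.
Qed.

Lemma xi_le_size xi j : (xi j <= size (particles xi))%N.
Proof. by rewrite -count_mem_mset count_size. Qed.

Definition adj (i b : int) := (b == i - 1) || (b == i + 1).

Lemma adjC i b : adj i b = adj b i.
Proof. by rewrite /adj orbC; congr orb; apply/eqP/eqP => ->; ring. Qed.

Lemma adj_sum (i b : int) : (adj i b)%:R = (b == i - 1)%:R + (b == i + 1)%:R :> R.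
Proof.
rewrite /adj; case: eqP => [->|_] /=; last by rewrite add0r.
have -> : (i - 1 == i + 1) = false by apply/eqP => ?; lia.
by rewrite addr0.
Qed.

(** Occupation numbers are counts of particles, so the attraction becomes a sum over ordered pairs
    of neighbouring particles. A particle is not its own neighbour, so the diagonal contributes
    nothing. *)
Lemma sum_interaction xi (h : int -> int -> R) :
  \sum_(i <- particles xi) \sum_(j <- [:: i - 1; i + 1]) (xi j)%:R * h i j =
  \sum_(i <- particles xi) \sum_(b <- particles xi) (adj i b)%:R * h i b.
Proof.
apply: eq_bigr => i _.
rewrite !big_cons big_nil addr0 !big_xi_nat !mulr_suml -big_split/=.
apply: eq_bigr => b _; rewrite adj_sum mulrDl.
by congr (_ + _); case: eqP => [->//|_]; rewrite !mul0r.
Qed.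

Lemma sum_adj_sym (s : seq int) (h : int -> int -> R) :
  \sum_(i <- s) \sum_(b <- s) (adj i b)%:R * h i b =
  2^-1 * \sum_(i <- s) \sum_(b <- s) (adj i b)%:R * (h i b + h b i).
Proof.
under [in RHS]eq_bigr do under eq_bigr do rewrite mulrDr.
under [in RHS]eq_bigr do rewrite big_split/=.
rewrite big_split/= [X in _ = _ * (_ + X)]exchange_big/=.
under [X in _ = _ * (_ + X)]eq_bigr do under eq_bigr do rewrite adjC.
by lra.
Qed.

(** Independent walks of rate m / 2 to each side, plus, for each ordered pair of neighbours, a jump
    of the first onto the second at rate 1. *)
Lemma sip_genE f xi : sip_gen m f xi =
  m / 2 * (\sum_(i <- particles xi) \sum_(j <- [:: i - 1; i + 1]) (f (fmove i j xi) - f xi)) +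
  \sum_(i <- particles xi) \sum_(b <- particles xi) (adj i b)%:R * (f (fmove i b xi) - f xi).
Proof.
rewrite sip_gen_jumps /jump_gen sum_sip_jumps -sum_interaction mulr_sumr -big_split/=.
apply: eq_bigr => i _; rewrite mulr_sumr -big_split/=.
by apply: eq_bigr => j _; rewrite mulrDl.
Qed.

Definition linf g xi : R := \sum_(x <- particles xi) g x.

Definition dlap g x : R := m / 2 * (g (x + 1) + g (x - 1) - 2 * g x).

Lemma linf_fmove g i j xi : i \in particles xi ->
  linf g (fmove i j xi) - linf g xi = g j - g i.
Proof.
move=> ixi; rewrite /linf (perm_big _ (perm_fmove i j xi)) big_cons.
by rewrite [X in _ - X](big_rem i)//=; ring.
Qed.

(* The interaction terms cancel by antisymmetry. *)
Lemma sip_gen_lin f g xi :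
  (forall i j, i \in particles xi -> adj i j -> f (fmove i j xi) - f xi = g j - g i) ->
  sip_gen m f xi = linf (dlap g) xi.
Proof.
move=> H; rewrite sip_genE.
have -> : \sum_(i <- particles xi) \sum_(b <- particles xi) (adj i b)%:R * (f (fmove i b xi) - f xi) = 0.
  transitivity (\sum_(i <- particles xi) \sum_(b <- particles xi) (adj i b)%:R * (g b - g i)).
    apply: eq_big_seq => i ixi; apply: eq_bigr => b _.
    by case: (boolP (adj i b)) => [/(H _ _ ixi) ->|_] //; rewrite !mul0r.
  rewrite sum_adj_sym big1 ?mulr0// => i _; rewrite big1// => b _.
  by rewrite addrC subrKA subrr mulr0.
rewrite addr0 /linf mulr_sumr; apply: eq_big_seq => i ixi.
rewrite !big_cons big_nil !H// /adj ?eqxx ?orbT// /dlap; ring.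
Qed.

Lemma sip_gen_linf g xi : sip_gen m (linf g) xi = linf (dlap g) xi.
Proof. by apply: sip_gen_lin => i j ixi _; exact: linf_fmove. Qed.

Definition quadf (phi : int -> int -> R) xi : R :=
  2^-1 * \sum_(x <- particles xi) \sum_(y <- particles xi) phi x y.

(** When a particle moves from i to a neighbour j, the condition phi i i = phi i j makes the
    self-interaction terms agree before and after. The increment of [quadf] is then that of a
    one-particle sum, and the attraction cancels as in [sip_gen_lin]. *)
Lemma sip_gen_quadf phi xi : (forall x y, phi x y = phi y x) ->
  (forall i j, adj i j -> phi i i = phi i j) ->
  sip_gen m (quadf phi) xi = \sum_(x <- particles xi) \sum_(y <- particles xi) dlap (phi ^~ y) x.
Proof.
move=> phiC phi_adj.
rewrite (@sip_gen_lin _ (fun x => \sum_(y <- particles xi) phi x y)); last first.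
  move=> i j ixi ij; set s := rem i (particles xi).
  have E k (t : seq int) : perm_eq t (k :: s) -> \sum_(x <- t) \sum_(y <- t) phi x y =
      phi k k + 2 * (\sum_(y <- s) phi k y) + \sum_(x <- s) \sum_(y <- s) phi x y.
    move=> tp.
    have E f : \sum_(y <- t) f y = f k + \sum_(y <- s) f y :> R.
      by rewrite (perm_big _ tp) big_cons.
    rewrite E E [X in _ + X = _](eq_bigr (fun x => phi k x + \sum_(y <- s) phi x y)); last first.
      by move=> x _; rewrite E phiC.
    rewrite big_split/=.
    ring.
  have ps : perm_eq (particles xi) (i :: s) by exact: perm_to_rem.
  rewrite /quadf (E j _ (perm_fmove i j xi)) (E i _ ps).
  have E' f : \sum_(y <- particles xi) f y = f i + \sum_(y <- s) f y :> R.
    by rewrite (perm_big _ ps) big_cons.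
  rewrite !E'.
  have -> : phi j i = phi i i by rewrite phiC -(phi_adj i j).
  have -> : phi j j = phi i i.
    by rewrite (phi_adj j i) 1?adjC// phiC -(phi_adj i j).
  by lra.
rewrite /linf /dlap; apply: eq_bigr => x _.
by rewrite mulr_sumr -big_split/= -sumrB mulr_sumr.
Qed.

Definition prodf v xi : R := \prod_(x <- particles xi) v x.

Lemma prodf_fmove v i j xi : i \in particles xi ->
  prodf v (fmove i j xi) - prodf v xi = (v j - v i) * \prod_(x <- rem i (particles xi)) v x.
Proof.
move=> ixi; rewrite /prodf (perm_big _ (perm_fmove i j xi)) big_cons.
by rewrite [X in _ - X](big_rem i)//=; ring.
Qed.

Lemma prod_norm_le (s : seq int) v (A : R) : (forall x, `|v x| <= A) -> 1 <= A ->
  forall k, (size s <= k)%N -> `|\prod_(x <- s) v x| <= A ^+ k.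
Proof.
move=> vA A1 k sk; rewrite normr_prod; apply: (@le_trans _ _ (A ^+ size s)).
  elim: s {sk} => [|x s IH]; first by rewrite big_nil expr0.
  by rewrite big_cons/= exprS ler_pM// prodr_ge0.
exact: ler_weXn2l.
Qed.

Definition adj_count xi : R := \sum_(x <- particles xi) \sum_(y <- particles xi) (adj x y)%:R.

(* Symmetrizing the interaction in (i, j) turns first differences of v into
   their squares. *)
Lemma sip_gen_prodf v xi (A d : R) : (forall x, `|v x| <= A) -> 1 <= A ->
  (forall x, `|v (x + 1) - v x| <= d) ->
  `|sip_gen m (prodf v) xi - \sum_(i <- particles xi) dlap v i * \prod_(x <- rem i (particles xi)) v x|
    <= 2^-1 * d ^+ 2 * A ^+ size (particles xi) * adj_count xi.
Proof.
move=> vA A1 vd; rewrite sip_genE.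
have -> : m / 2 * (\sum_(i <- particles xi) \sum_(j <- [:: i - 1; i + 1])
    (prodf v (fmove i j xi) - prodf v xi)) =
    \sum_(i <- particles xi) dlap v i * \prod_(x <- rem i (particles xi)) v x.
  rewrite mulr_sumr; apply: eq_big_seq => i ixi.
  by rewrite !big_cons big_nil !prodf_fmove// /dlap; ring.
rewrite addrAC subrr add0r.
have -> : \sum_(i <- particles xi) \sum_(b <- particles xi) (adj i b)%:R *
    (prodf v (fmove i b xi) - prodf v xi) =
    \sum_(i <- particles xi) \sum_(b <- particles xi) (adj i b)%:R *
    ((v b - v i) * \prod_(x <- rem i (particles xi)) v x).
  by apply: eq_big_seq => i ixi; apply: eq_bigr => b _; rewrite prodf_fmove.
rewrite sum_adj_sym normrM ger0_norm ?invr_ge0//.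
set D := d ^+ 2 * A ^+ size (particles xi).
have -> : 2^-1 * d ^+ 2 * A ^+ size (particles xi) * adj_count xi =
    2^-1 * (D * adj_count xi) by rewrite /D; ring.
rewrite ler_wpM2l ?invr_ge0//.
apply: le_trans (ler_norm_sum _ _ _) _; rewrite /adj_count !mulr_sumr.
rewrite [leLHS]big_seq [leRHS]big_seq; apply: ler_sum => i ixi.
apply: le_trans (ler_norm_sum _ _ _) _; rewrite !mulr_sumr.
rewrite [leLHS]big_seq [leRHS]big_seq; apply: ler_sum => b bxi.
have [ab|_] := boolP (adj i b); last by rewrite mul0r normr0 !mulr0.
rewrite mul1r mulr1.
have ib : i != b.
  by apply/eqP => ib; move: ab; rewrite ib /adj => /orP[] /eqP; lia.
have bi : b \in rem i (particles xi) by rewrite (rem_mem _ bxi)// eq_sym.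
have ib' : i \in rem b (particles xi) by rewrite (rem_mem _ ixi).
have P : perm_eq (rem i (rem b (particles xi))) (rem b (rem i (particles xi))).
  by apply/allP => a _ /=; rewrite !count_mem_rem subnAC.
rewrite (big_rem b bi)/= (big_rem i ib')/= (perm_big _ P)/=.
set Z := \prod_(x <- _) _.
have -> : (v b - v i) * (v b * Z) + (v i - v b) * (v i * Z) = (v b - v i) ^+ 2 * Z by ring.
have d0 : 0 <= d := le_trans (normr_ge0 _) (vd 0).
rewrite /D normrM ler_pM// ?normr_ge0//; last first.
  apply: prod_norm_le => //.
  by rewrite !size_rem//; apply: leq_trans (leq_pred _) (leq_pred _).
rewrite normrX lerXn2r ?nnegrE//.
move: ab; rewrite /adj => /orP[]/eqP ->; last exact: vd.
by have := vd (i - 1); rewrite subrK distrC.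
Qed.

End Generator.

(** * Waves as eigenfunctions of the one-particle walk *)

Section Trig.
Context {R : realType}.

Lemma cos_lip (a b : R) : `|cos a - cos b| <= `|a - b|.
Proof.
wlog ba : a b / b < a => [H|].
  have [ba|ab|->] := ltgtP b a; last by rewrite !subrr.
    exact: H.
  by rewrite distrC (distrC a); exact: H.
have dcos x : x \in `]b, a[ -> is_derive x 1 (cos : R -> R) (- sin x).
  by move=> _; exact: is_derive_cos.
have [] := MVT ba dcos.
  by apply: continuous_subspaceT; exact: continuous_cos.
move=> c _ ->; rewrite normrM normrN ler_piMl//; exact: sin_max.
Qed.

(* A mode [(c, th, ph)] stands for the wave c cos (th x + ph), which the walk
   jumping at rate m / 2 to each neighbour damps at rate m (1 - cos th). *)
Definition wave (a : R * R * R) (x : R) : R := a.1.1 * cos (a.1.2 * x + a.2).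

Definition trig (l : seq (R * R * R)) (x : R) : R := \sum_(a <- l) wave a x.

Definition trig_norm (l : seq (R * R * R)) : R := \sum_(a <- l) `|a.1.1|.

Definition trig_lip (l : seq (R * R * R)) : R := \sum_(a <- l) `|a.1.1| * `|a.1.2|.

Lemma wave_norm a x : `|wave a x| <= `|a.1.1|.
Proof. by rewrite normrM ler_piMr// cos_max. Qed.

Variable m : R.
Hypothesis m_gt0 : 0 < m.

Definition damp_rate (th : R) : R := m * (1 - cos th).

Definition damp (s : R) (a : R * R * R) : R * R * R :=
  (expR (- (damp_rate a.1.2 * s)) * a.1.1, a.1.2, a.2).

Definition dtrig l (s : R) (x : int) : R := trig (map (damp s) l) x%:~R.

Lemma damp_rate_ge0 th : 0 <= damp_rate th.
Proof. by rewrite mulr_ge0 ?(ltW m_gt0)// subr_ge0 cos_le1. Qed.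

Lemma dtrigE l s x : dtrig l s x =
  \sum_(a <- l) expR (- (damp_rate a.1.2 * s)) * wave a x%:~R.
Proof.
by rewrite /dtrig /trig big_map; apply: eq_bigr => a _; rewrite /wave/= mulrA.
Qed.

Lemma dtrig0 l x : dtrig l 0 x = trig l x%:~R.
Proof. by rewrite dtrigE; apply: eq_bigr => a _; rewrite mulr0 oppr0 expR0 mul1r. Qed.

Lemma damp_le1 th s : 0 <= s -> expR (- (damp_rate th * s)) <= 1.
Proof. by move=> s0; rewrite -expR0 ler_expR oppr_le0 mulr_ge0// damp_rate_ge0. Qed.

(** For u >= 0, 1 - u <= e^-u <= 1 / (1 + u) <= 1 - u + u^2, the last because (1 - u + u^2)(1 + u) =
    1 + u^3. *)
Lemma damp_step th s : 0 <= s ->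
  `|expR (- (damp_rate th * s)) - 1 + damp_rate th * s| <= (damp_rate th * s) ^+ 2.
Proof.
move=> s0; set u := damp_rate th * s.
have u0 : 0 <= u by rewrite mulr_ge0// damp_rate_ge0.
have lo := expR_ge1Dx (- u).
have hi := expR_ge1Dx u.
have eu : expR (- u) * expR u = 1 by rewrite -expRD addNr expR0.
have e0 := expR_gt0 (- u).
have : expR (- u) * (1 + u) <= 1 by rewrite -[leRHS]eu ler_wpM2l// ltW.
have : 0 <= u ^+ 3 by rewrite exprn_ge0.
rewrite ger0_norm; last by lra.
move=> u3 H.
have : expR (- u) * (1 + u) <= (1 - u + u ^+ 2) * (1 + u) by apply: le_trans H _; lra.
rewrite ler_pM2r; last by lra.
lra.
Qed.

Lemma dtrig_le l s x : 0 <= s -> `|dtrig l s x| <= trig_norm l.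
Proof.
move=> s0; rewrite dtrigE; apply: le_trans (ler_norm_sum _ _ _) _.
apply: ler_sum => a _; rewrite normrM ger0_norm ?expR_ge0//.
by rewrite -[leRHS]mul1r ler_pM ?expR_ge0 ?damp_le1 ?wave_norm.
Qed.

Lemma dtrig_lip l s x : 0 <= s -> `|dtrig l s (x + 1) - dtrig l s x| <= trig_lip l.
Proof.
move=> s0; rewrite !dtrigE -sumrB; apply: le_trans (ler_norm_sum _ _ _) _.
apply: ler_sum => a _; rewrite -mulrBr normrM ger0_norm ?expR_ge0//.
rewrite -[leRHS]mul1r ler_pM ?expR_ge0 ?damp_le1//.
rewrite /wave -mulrBr normrM ler_wpM2l//.
apply: le_trans (cos_lip _ _) _; rewrite rmorphD/=.
by have -> : a.1.2 * (x%:~R + 1) + a.2 - (a.1.2 * x%:~R + a.2) = a.1.2 by ring.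
Qed.

(** By the addition formulas cos (x + th) + cos (x - th) = 2 cos th cos x, so each wave is an
    eigenfunction of [dlap m]. *)
Lemma dlap_dtrig l s x : dlap m (dtrig l s) x =
  - \sum_(a <- l) damp_rate a.1.2 * (expR (- (damp_rate a.1.2 * s)) * wave a x%:~R).
Proof.
rewrite /dlap !dtrigE -big_split/= mulr_sumr -sumrB mulr_sumr -sumrN.
apply: eq_bigr => a _; rewrite rmorphB rmorphD/=.
set e := expR _.
rewrite /wave !mulrDr !mulrN mulr1.
have -> : a.1.2 * x%:~R + a.1.2 + a.2 = (a.1.2 * x%:~R + a.2) + a.1.2 by ring.
have -> : a.1.2 * x%:~R - a.1.2 + a.2 = (a.1.2 * x%:~R + a.2) - a.1.2 by ring.
by rewrite cosD cosB /damp_rate; field.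
Qed.

Definition trig_err (l : seq (R * R * R)) : R := \sum_(a <- l) damp_rate a.1.2 ^+ 2 * `|a.1.1|.

Lemma trig_err_ge0 l : 0 <= trig_err l.
Proof. by apply: sumr_ge0 => a _; rewrite mulr_ge0 ?sqr_ge0. Qed.

Lemma dtrig_step l s h x : 0 <= s -> 0 <= h ->
  `|dtrig l (s + h) x - dtrig l s x - h * dlap m (dtrig l s) x| <= trig_err l * h ^+ 2.
Proof.
move=> s0 h0; rewrite dlap_dtrig !dtrigE mulrN opprK mulr_sumr -sumrB -big_split/=.
apply: le_trans (ler_norm_sum _ _ _) _; rewrite /trig_err mulr_suml.
apply: ler_sum => a _.
rewrite mulrDr opprD expRD.
set e := expR (- (damp_rate a.1.2 * s)); set e' := expR _.
have -> : e * e' * wave a x%:~R - e * wave a x%:~R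
    + h * (damp_rate a.1.2 * (e * wave a x%:~R)) =
    (e * wave a x%:~R) * (e' - 1 + damp_rate a.1.2 * h) by ring.
rewrite normrM mulrC [leRHS]mulrAC -exprMn ler_pM ?damp_step//.
rewrite normrM -[leRHS]mul1r ger0_norm ?expR_ge0//.
by rewrite ler_pM ?expR_ge0 ?damp_le1 ?wave_norm.
Qed.

Lemma dlap_le (v : int -> R) A x : (forall y, `|v y| <= A) -> `|dlap m v x| <= 2 * m * A.
Proof.
move=> vA; rewrite /dlap normrM (ger0_norm (divr_ge0 (ltW m_gt0) _))//.
rewrite (_ : 2 * m * A = m / 2 * (A + A + 2 * A)); last by field.
rewrite ler_wpM2l ?divr_ge0 ?(ltW m_gt0)//.
apply: le_trans (ler_normB _ _) _; rewrite lerD//; last first.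
  by rewrite normrM ger0_norm// ler_wpM2l.
by apply: le_trans (ler_normD _ _) _; rewrite lerD.
Qed.

End Trig.

(** * First-order expansion of products *)

Section ProductStep.
Context {R : realType} {T : eqType}.
Implicit Types (l : seq T) (a b : T -> R).

Lemma derivation_le (A B : R) a b k l : (size l <= k)%N -> 1 <= A -> 0 <= B ->
  (forall x, `|a x| <= A) -> (forall x, `|b x| <= B) ->
  `|\sum_(i <- l) b i * \prod_(x <- rem i l) a x| <= k%:R * (B * A ^+ k).
Proof.
move=> lk A1 B0 aA bB; apply: le_trans (ler_norm_sum _ _ _) _.
apply: (@le_trans _ _ (\sum_(i <- l) B * A ^+ k)); last first.
  rewrite big_const_seq count_predT iter_addr_0 -[leLHS]mulr_natl ler_wpM2r ?ler_nat//.
  by rewrite mulr_ge0// exprn_ge0// (le_trans ler01).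
apply: ler_sum => i _; rewrite normrM ler_pM// normr_prod.
apply: (@le_trans _ _ (A ^+ size (rem i l))).
  elim: (rem i l) => [|x s IH]; first by rewrite big_nil expr0.
  by rewrite big_cons/= exprS ler_pM// prodr_ge0.
by apply: ler_weXn2l => //; apply: leq_trans lk; exact: size_subseq (rem_subseq _ _).
Qed.

(** A discrete Leibniz rule. The constant is chosen before the list and the functions because the
    comparison needs a single one for all configurations and all times. *)
Lemma prod_step (A B E t : R) (k : nat) : 1 <= A -> 0 <= B -> 0 <= E -> 0 <= t ->
  exists2 C, 0 <= C & forall l a a' b h, size l = k -> 0 <= h <= t ->
    (forall x, `|a x| <= A) -> (forall x, `|a' x| <= A) -> (forall x, `|b x| <= B) ->
    (forall x, `|a' x - a x - h * b x| <= E * h ^+ 2) ->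
    `|\prod_(x <- l) a' x - \prod_(x <- l) a x -
      h * \sum_(i <- l) b i * \prod_(x <- rem i l) a x| <= C * h ^+ 2.
Proof.
move=> A1 B0 E0 t0; have A0 : 0 <= A := le_trans ler01 A1.
elim: k => [|k [C C0 IH]].
  exists 0 => // l a a' b h /size0nil -> _ _ _ _ _.
  by rewrite !big_nil subrr mulr0 subr0 normr0 mul0r.
(* The three summands match the three terms of the decomposition below: the induction hypothesis
   times a', the one-factor error times the old product, and the cross term h (a' - a) D. *)
exists (A * C + E * A ^+ k + (B + E * t) * (k%:R * (B * A ^+ k))).
  by rewrite !addr_ge0 ?mulr_ge0 ?addr_ge0 ?mulr_ge0 ?exprn_ge0.
move=> [//|x l] a a' b h [lk] /andP[h0 ht] aA a'A bB step.
have -> : \sum_(i <- x :: l) b i * \prod_(y <- rem i (x :: l)) a y =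
    b x * \prod_(y <- l) a y + a x * \sum_(i <- l) b i * \prod_(y <- rem i l) a y.
  rewrite big_cons /= eqxx mulr_sumr; congr (_ + _).
  apply: eq_big_seq => i il /=; case: eqP => [xi|_].
    by rewrite xi mulrCA; congr (_ * _); rewrite (big_rem i).
  by rewrite big_cons mulrCA.
rewrite !big_cons.
set P' := \prod_(y <- l) a' y; set P := \prod_(y <- l) a y.
set D := \sum_(i <- l) _.
have -> : a' x * P' - a x * P - h * (b x * P + a x * D) =
    a' x * (P' - P - h * D) + (a' x - a x - h * b x) * P + h * (a' x - a x) * D.
  by ring.
have P_le : `|P| <= A ^+ k.
  rewrite normr_prod -lk; elim: (l) => [|y s IHs]; first by rewrite big_nil expr0.
  by rewrite big_cons/= exprS ler_pM// prodr_ge0.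
have D_le : `|D| <= k%:R * (B * A ^+ k) by apply: derivation_le; rewrite ?lk.
have d_le : `|a' x - a x| <= h * (B + E * t).
  rewrite (_ : a' x - a x = (a' x - a x - h * b x) + h * b x); last by ring.
  apply: le_trans (ler_normD _ _) _.
  rewrite mulrDr addrC lerD//; first by rewrite normrM ger0_norm// ler_wpM2l.
  apply: le_trans (step x) _; rewrite expr2 mulrCA ler_wpM2l// ler_wpM2l//.
apply: le_trans (ler_normD _ _) _; rewrite [leRHS]mulrDl [X in _ <= X + _]mulrDl lerD//.
  apply: le_trans (ler_normD _ _) _; rewrite lerD//.
    by rewrite normrM -[leRHS]mulrA ler_pM// IH// h0.
  by rewrite normrM [leRHS]mulrAC ler_pM.
rewrite !normrM ger0_norm//.
rewrite (_ : _ * h ^+ 2 = h * (h * (B + E * t)) * (k%:R * (B * A ^+ k))); last by ring.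
by rewrite ler_pM ?mulr_ge0// ler_wpM2l.
Qed.

End ProductStep.

(** * Finitely many particles *)

Section SipProcess.
Context {R : realType} (m : R) (p : R -> fconf -> fconf -> R).
Hypothesis m_gt0 : 0 < m.
Hypothesis p_sip : is_fsip m p.

Definition sector n : pred fconf := fun xi => size (particles xi) == n.

Lemma sip_rate_ge0 (xi : fconf) (a : R * fconf) : a \in sip_jumps m xi -> 0 <= a.1.
Proof.
by move=> /sip_jumpsP[i [j [_ _ ->]]]/=; rewrite addr_ge0// divr_ge0// ltW.
Qed.

Lemma sip_jump_closed n xi (a : R * fconf) :
  sector n xi -> a \in sip_jumps m xi -> sector n a.2.
Proof.
move=> /eqP <- /sip_jumpsP[i [j [ixi _ ->]]]/=.
by rewrite /sector size_fmove.
Qed.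

Lemma sip_rate_le n xi : sector n xi ->
  \sum_(a <- sip_jumps m xi) a.1 <= n%:R * (2 * (m / 2 + n%:R)).
Proof.
move=> /eqP xin; rewrite sum_sip_jumps -{1}xin.
apply: (@le_trans _ _ (\sum_(i <- particles xi) 2 * (m / 2 + n%:R))); last first.
  by rewrite big_const_seq count_predT iter_addr_0 -[leLHS]mulr_natl.
apply: ler_sum => i _; rewrite !big_cons big_nil addr0/=.
have xiM j : (xi j)%:R <= n%:R :> R by rewrite ler_nat -xin xi_le_size.
have := xiM (i - 1); have := xiM (i + 1); lra.
Qed.

Lemma sip_p_gen (xi ze : fconf) :
  h^-1 * (p h xi ze - p 0 xi ze) @[h --> 0^'+] -->
  jump_gen (sip_jumps m) (fun chi => (chi == ze)%:R) xi.
Proof. by rewrite -sip_gen_jumps; exact: fsip_gen p_sip xi ze. Qed.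

Lemma sip_supersolution n (G : R -> fconf -> R) (f : fconf -> \bar R)
    (t M C : R) xi :
  sector n xi -> 0 <= t -> 0 <= C ->
  (forall (s : R) z, 0 <= s <= t -> sector n z -> `|G s z| <= M) ->
  (forall (s h : R) z, 0 <= s -> 0 <= h -> s + h <= t -> sector n z ->
    G s z + h * sip_gen m (G s) z <= G (s + h) z + C * h ^+ 2) ->
  (forall z, sector n z -> (f z <= (G 0%R z + M)%:E)%E) ->
  (fsip_expect p t xi f <= (G t xi + M)%:E)%E.
Proof.
move=> Sxi t0 C0 GM Gs fG.
apply: (ex_supersolution (fsip_ge0 p_sip) (fsip_mass p_sip) (fsip0 p_sip)
  (fsip_semigroup p_sip) sip_p_gen sip_rate_ge0 (@sip_jump_closed n)
  (@sip_rate_le n) Sxi t0 C0 GM _ fG).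
by move=> s h z s0 h0 sh Sz; rewrite -sip_gen_jumps; exact: Gs.
Qed.

Lemma le_fsip_expect n (t : R) xi f g : 0 <= t -> sector n xi ->
  (forall z, sector n z -> (f z <= g z)%E) ->
  (fsip_expect p t xi f <= fsip_expect p t xi g)%E.
Proof.
exact: (le_ex_supp (fsip_ge0 p_sip) (fsip_mass p_sip) (fsip0 p_sip)
  (fsip_semigroup p_sip) sip_p_gen sip_rate_ge0 (@sip_jump_closed n)
  (@sip_rate_le n)).
Qed.

Lemma fsip_expectD (t : R) xi f g : 0 <= t ->
  (forall z, (0 <= f z)%E) -> (forall z, (0 <= g z)%E) ->
  (fsip_expect p t xi (f \+ g) = fsip_expect p t xi f + fsip_expect p t xi g)%E.
Proof. by move=> t0; exact: (exD (fsip_ge0 p_sip) xi t0). Qed.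

Lemma fsip_expectZ (t c : R) xi f : 0 <= t -> 0 <= c ->
  (forall z, (0 <= f z)%E) ->
  (fsip_expect p t xi (fun z => c%:E * f z) = c%:E * fsip_expect p t xi f)%E.
Proof. by move=> t0; exact: (exZ (fsip_ge0 p_sip) xi t0). Qed.

Lemma fsip_expect_cst (t c : R) xi : 0 <= t -> 0 <= c ->
  fsip_expect p t xi (fun=> c%:E) = c%:E.
Proof. exact: (ex_cst (fsip_ge0 p_sip) (fsip_mass p_sip) xi). Qed.

Lemma fsip_expect_ge0 (t : R) xi f : 0 <= t -> (forall z, (0 <= f z)%E) ->
  (0 <= fsip_expect p t xi f)%E.
Proof. exact: (ex_ge0 (fsip_ge0 p_sip) xi). Qed.

Lemma expect_linf_exp (g : int -> R) (c t : R) xi : 0 <= t -> 0 <= c ->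
  (forall x, 0 <= g x) -> (forall x, dlap m g x <= c * g x) ->
  (fsip_expect p t xi (EFin \o linf g) <= (expR (c * t) * linf g xi)%:E)%E.
Proof.
move=> t0 c0 g0 gc.
apply: (ex_exp_supersolution (fsip_ge0 p_sip) (fsip_mass p_sip) (fsip0 p_sip)
  (fsip_semigroup p_sip) sip_p_gen sip_rate_ge0
  (@sip_jump_closed (size (particles xi))) (@sip_rate_le _) (eqxx _) t0 c0).
- by move=> z; apply: sumr_ge0.
- move=> z _; rewrite -sip_gen_jumps sip_gen_linf /linf mulr_sumr.
  exact: ler_sum.
Qed.

Lemma linf_le n (g : int -> R) A xi : sector n xi -> (forall x, `|g x| <= A) ->
  `|linf g xi| <= n%:R * A.
Proof.
move=> /eqP <- gA; apply: le_trans (ler_norm_sum _ _ _) _.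
apply: (@le_trans _ _ (\sum_(i <- particles xi) A)); first exact: ler_sum.
by rewrite big_const_seq count_predT iter_addr_0 -[leLHS]mulr_natl.
Qed.

(** A one-particle sum evolves as if the particles were independent, so domination by a
    trigonometric polynomial at time 0 propagates. Waves change sign, hence the shift by M, which
    drops out since constants have constant expectation. *)
Lemma expect_linf_trig (g : int -> R) l (t : R) xi : 0 <= t ->
  (forall x, 0 <= g x) -> (forall x, g x <= trig l x%:~R) ->
  (fsip_expect p t xi (EFin \o linf g) <= (linf (dtrig m l t) xi)%:E)%E.
Proof.
move=> t0 g0 gl; pose n := size (particles xi).
pose M := n%:R * trig_norm l.
have M0 : 0 <= M by rewrite mulr_ge0//; apply: sumr_ge0.
have Sxi : sector n xi by exact: eqxx.
have H : (fsip_expect p t xi ((EFin \o linf g) \+ (fun=> M%:E)) <=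
    (linf (dtrig m l t) xi + M)%:E)%E.
  apply: (@sip_supersolution n (fun s => linf (dtrig m l s)) _ t M
    (n%:R * trig_err m l)) => //.
  - by rewrite mulr_ge0// trig_err_ge0.
  - move=> s z /andP[s0 _] Sz; apply: linf_le => // x; exact: dtrig_le.
  - move=> s h z s0 h0 _ Sz; rewrite sip_gen_linf.
    rewrite -lerBlDl.
    have -> : linf (dtrig m l s) z + h * linf (dlap m (dtrig m l s)) z - linf (dtrig m l (s + h)) z
      = linf (fun x => - (dtrig m l (s + h) x - dtrig m l s x - h * dlap m (dtrig m l s) x)) z.
      rewrite /linf mulr_sumr -big_split/= -sumrB; apply: eq_bigr => x _; ring.
    apply: le_trans (ler_norm _) _; rewrite -mulrA.
    by apply: linf_le => // x; rewrite normrN dtrig_step.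
  - move=> z _ /=; rewrite -EFinD lee_fin lerD2r; apply: ler_sum => x _.
    by rewrite dtrig0.
move: H; rewrite fsip_expectD//; last first.
  by move=> z; rewrite lee_fin; exact: sumr_ge0.
by rewrite fsip_expect_cst// EFinD leeD2rE.
Qed.

(** With d = [trig_lip l], the interaction changes the generator on products by at most d^2 A^n / 2
    times the number of adjacent ordered pairs. The time integral of that number has expectation at
    most 2 n^2 (N / m + t / N), by [sip_gen_bdist] and the bound n^2 N / 2 on [quadf (bdist N)]. *)
Definition prod_err (n N : nat) (A t : R) l : R :=
  trig_lip l ^+ 2 * A ^+ n * n%:R ^+ 2 * (N%:R / m + t / N%:R).

(* r^D is a discrete substitute for exp (- D / N), so that phi is bounded by N
   while its discrete Laplacian is at least r at distance 1 and at least - 1 / N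
   elsewhere: it plays the role of the distance |x - y|. *)
Definition bdist (N : nat) (x y : int) : R :=
  N%:R * (1 - (1 - N%:R^-1) ^+ maxn `|x - y| 1).

Lemma bdistC N x y : bdist N x y = bdist N y x.
Proof. by rewrite /bdist distnC. Qed.

Lemma bdist_adj N i j : adj i j -> bdist N i i = bdist N i j.
Proof.
rewrite /adj /bdist subrr absz0 => /orP[]/eqP ->; congr (_ * (_ - _ ^+ _)); lia.
Qed.

Section Ratio.
Variable N : nat.
Hypothesis N2 : (2 <= N)%N.
Let r : R := 1 - N%:R^-1.

Let N0 : (0 : R) < N%:R. Proof. by rewrite ltr0n; lia. Qed.

Let r_half : 1 / 2 <= r.
Proof.
rewrite /r lerBrDr -lerBrDl (_ : 1 - 1 / 2 = 2^-1); last by field.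
by rewrite lef_pV2 ?posrE// ?ler_nat// ltr0n; lia.
Qed.

Lemma bdist_ge0 x y : 0 <= bdist N x y.
Proof.
rewrite /bdist mulr_ge0// subr_ge0 exprn_ile1// -/r; by have := r_half; lra.
Qed.

Lemma bdist_le x y : bdist N x y <= N%:R.
Proof.
rewrite /bdist -[leRHS]mulr1 ler_wpM2l// gerBl exprn_ge0// -/r.
by have := r_half; lra.
Qed.

(** As N (1 - r) = 1, the second difference is r >= 1 / 2 at distance 1, where [maxn _ 1] creates a
    convex corner; it is 0 at distance 0 and - r^k / N at distance k + 1 >= 2. *)
Lemma bdist_dlap x y :
  m / 2 * (2^-1 * (adj x y)%:R - N%:R^-1) <= dlap m (bdist N ^~ y) x.
Proof.
rewrite /dlap ler_wpM2l ?divr_ge0 ?(ltW m_gt0)//.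
have r0 : 0 <= r by have := r_half; lra.
have r1 : 1 - r = N%:R^-1 by rewrite /r; ring.
have Nr : N%:R * (1 - r) = 1 by rewrite r1 mulfV// gt_eqF.
have Ni0 : 0 <= N%:R^-1 :> R by rewrite invr_ge0 ltW.
have r_le1 : r <= 1 by rewrite gerBl.
rewrite /bdist -/r.
have [axy|naxy] := boolP (adj x y); last have [xy|nxy] := eqVneq x y.
- have := axy; rewrite /adj => /orP[]/eqP ->.
  + have -> : maxn `|(x + 1 - (x - 1))%R|%N 1 = 2%N by lia.
    have -> : maxn `|(x - 1 - (x - 1))%R|%N 1 = 1%N by lia.
    have -> : maxn `|(x - (x - 1))%R|%N 1 = 1%N by lia.
    have -> : N%:R * (1 - r ^+ 2) + N%:R * (1 - r ^+ 1) - 2 * (N%:R * (1 - r ^+ 1)) =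
       r * (N%:R * (1 - r)) by ring.
    by rewrite Nr mulr1; have := r_half; lra.
  + have -> : maxn `|(x + 1 - (x + 1))%R|%N 1 = 1%N by lia.
    have -> : maxn `|(x - 1 - (x + 1))%R|%N 1 = 2%N by lia.
    have -> : maxn `|(x - (x + 1))%R|%N 1 = 1%N by lia.
    have -> : N%:R * (1 - r ^+ 1) + N%:R * (1 - r ^+ 2) - 2 * (N%:R * (1 - r ^+ 1)) =
       r * (N%:R * (1 - r)) by ring.
    by rewrite Nr mulr1; have := r_half; lra.
- rewrite xy.
  have -> : maxn `|(y + 1 - y)%R|%N 1 = 1%N by lia.
  have -> : maxn `|(y - 1 - y)%R|%N 1 = 1%N by lia.
  have -> : maxn `|(y - y)%R|%N 1 = 1%N by lia.
  rewrite (_ : _ + _ - _ = 0); last by ring.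
  by rewrite mulr0 sub0r oppr_le0.
- have [k [-> [[-> ->]|[-> ->]]]] : exists k,
      maxn `|(x - y)%R|%N 1 = k.+1 /\
      ((maxn `|(x + 1 - y)%R|%N 1 = k.+2 /\ maxn `|(x - 1 - y)%R|%N 1 = k) \/
       (maxn `|(x + 1 - y)%R|%N 1 = k /\ maxn `|(x - 1 - y)%R|%N 1 = k.+2)).
    exists `|(x - y)%R|%N.-1; move: naxy; rewrite /adj negb_or => /andP[/eqP a /eqP b].
    move/eqP: nxy => c.
    by have [xy|xy] := ltP y x; lia.
  + have rk : r ^+ k <= 1 by apply: exprn_ile1.
    have -> : N%:R * (1 - r ^+ k.+2) + N%:R * (1 - r ^+ k) - 2 * (N%:R * (1 - r ^+ k.+1))
       = - (r ^+ k * (1 - r) * (N%:R * (1 - r))) by rewrite !exprS; ring.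
    by rewrite Nr mulr1 mulr0 add0r lerN2 r1 ler_piMl.
  + have rk : r ^+ k <= 1 by apply: exprn_ile1.
    have -> : N%:R * (1 - r ^+ k) + N%:R * (1 - r ^+ k.+2) - 2 * (N%:R * (1 - r ^+ k.+1))
       = - (r ^+ k * (1 - r) * (N%:R * (1 - r))) by rewrite !exprS; ring.
    by rewrite Nr mulr1 mulr0 add0r lerN2 r1 ler_piMl.
Qed.

Lemma quadf_bdist_ge0 xi : 0 <= quadf (bdist N) xi.
Proof.
by rewrite mulr_ge0// ?invr_ge0//; do 2![apply: sumr_ge0 => ? _]; exact: bdist_ge0.
Qed.

Lemma quadf_bdist_le n xi : sector n xi -> quadf (bdist N) xi <= n%:R ^+ 2 * N%:R / 2.
Proof.
move=> Sxi; rewrite /quadf mulrC ler_wpM2r ?invr_ge0//.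
rewrite expr2 -mulrA; apply: le_trans (ler_norm _) _.
apply: (linf_le Sxi) => x; apply: (linf_le Sxi) => y.
by rewrite ger0_norm ?bdist_ge0// bdist_le.
Qed.

Lemma sip_gen_bdist n xi : sector n xi ->
  m / 2 * (2^-1 * adj_count xi - n%:R ^+ 2 / N%:R) <= sip_gen m (quadf (bdist N)) xi.
Proof.
move=> /eqP Sxi.
rewrite sip_gen_quadf; [|exact: bdistC|exact: bdist_adj].
apply: (@le_trans _ _ (\sum_(x <- particles xi) \sum_(y <- particles xi)
  (m / 2 * (2^-1 * (adj x y)%:R - N%:R^-1)))); last first.
  by do 2![apply: ler_sum => ? _]; exact: bdist_dlap.
under eq_bigr do rewrite -mulr_sumr sumrB -mulr_sumr.
rewrite -mulr_sumr sumrB -mulr_sumr /adj_count.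
have -> : \sum_(x <- particles xi) \sum_(y <- particles xi) N%:R^-1 = n%:R ^+ 2 / N%:R :> R.
  rewrite !big_const_seq !count_predT !iter_addr_0 -mulrnA Sxi.
  by rewrite -[LHS]mulr_natl natrM expr2.
by [].
Qed.

(** The supersolution is the evolved product plus a multiple of the decreasing budget [Qm - quadf],
    which pays for the interaction whenever particles are adjacent, plus a term linear in time. The
    sign [sg] yields upper and lower bounds at once. *)
Lemma expect_prodf_trig n (sg A t : R) l xi : sector n xi -> 0 <= t ->
  `|sg| = 1 -> 1 <= A -> trig_norm l <= A ->
  exists2 M, 0 <= M & (forall z, sector n z -> `|prodf (dtrig m l 0) z| <= M) /\
  (fsip_expect p t xi (fun z => (sg * prodf (dtrig m l 0) z + M)%:E) <=
    (sg * prodf (dtrig m l t) xi + M + prod_err n N A t l)%:E)%E.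
Proof.
move=> Sxi t0 sg1 A1 lA.
pose d := trig_lip l.
have d0 : 0 <= d by apply: sumr_ge0 => a _; rewrite mulr_ge0.
(* Chosen so that a times the adjacency term of [sip_gen_bdist] equals the interaction error of
   [sip_gen_prodf]; the rate [b] then absorbs the leftover n^2 / N. *)
pose a := 2 * d ^+ 2 * A ^+ n / m.
have A0 : 0 <= A := le_trans ler01 A1.
have a0 : 0 <= a by rewrite divr_ge0 ?(ltW m_gt0)// !mulr_ge0 ?exprn_ge0.
pose Qm := n%:R ^+ 2 * N%:R / 2 : R.
have Qm0 : 0 <= Qm by rewrite divr_ge0// mulr_ge0// exprn_ge0.
pose b := a * (m / 2) * (n%:R ^+ 2 / N%:R).
have b0 : 0 <= b.
  apply: mulr_ge0; last by rewrite divr_ge0 ?exprn_ge0.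
  by rewrite mulr_ge0// divr_ge0// ltW.
pose G s z := sg * prodf (dtrig m l s) z + a * (Qm - quadf (bdist N) z) + b * s.
pose M := A ^+ n + a * Qm + b * t.
have vA s x : 0 <= s -> `|dtrig m l s x| <= A.
  by move=> s0; apply: le_trans (dtrig_le m_gt0 l x s0) lA.
have VA s z : 0 <= s -> sector n z -> `|prodf (dtrig m l s) z| <= A ^+ n.
  by move=> s0 /eqP zn; apply: prod_norm_le; rewrite ?zn// => x; exact: vA.
have M0 : 0 <= M by rewrite !addr_ge0 ?exprn_ge0// mulr_ge0.
exists M => //; split.
  move=> z /(VA _ _ (lexx 0))/le_trans; apply.
  by rewrite /M -addrA lerDl addr_ge0// mulr_ge0.
have [C C0 step] := @prod_step R int A (2 * m * A) (trig_err m l) t n A1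
  (mulr_ge0 (mulr_ge0 (ler0n _ _) (ltW m_gt0)) A0) (trig_err_ge0 _ _) t0.
apply: (@le_trans _ _ (G t xi + M)%:E); last first.
  rewrite lee_fin /G /prod_err.
  have -> : trig_lip l ^+ 2 * A ^+ n * n%:R ^+ 2 * (N%:R / m + t / N%:R) =
      a * Qm + b * t.
    by rewrite /b /a /Qm /d; field; rewrite !gt_eqF.
  have : 0 <= a * quadf (bdist N) xi by rewrite mulr_ge0// quadf_bdist_ge0.
  lra.
apply: (@sip_supersolution n G _ t M C) => //.
- move=> s z /andP[s0 st] Sz; rewrite /G /M.
  apply: le_trans (ler_normD _ _) _; rewrite lerD//; last first.
    by rewrite normrM !ger0_norm// ler_wpM2l.
  apply: le_trans (ler_normD _ _) _; rewrite lerD//.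
    by rewrite normrM sg1 mul1r VA.
  have := quadf_bdist_le Sz; have := quadf_bdist_ge0 z; rewrite -/Qm => q0 qm.
  by rewrite normrM !ger0_norm ?subr_ge0// ler_wpM2l// gerBl.
- move=> s h z s0 h0 sh Sz.
  have -> : sip_gen m (G s) z = sg * sip_gen m (prodf (dtrig m l s)) z
      - a * sip_gen m (quadf (bdist N)) z.
    rewrite /sip_gen !mulr_sumr -sumrB; apply: eq_bigr => i _.
    rewrite !mulr_sumr -sumrB; apply: eq_bigr => j _; rewrite /G; ring.
  set I := \sum_(i <- particles z)
    dlap m (dtrig m l s) i * \prod_(x <- rem i (particles z)) dtrig m l s x.
  have H1 : `|sip_gen m (prodf (dtrig m l s)) z - I|
      <= 2^-1 * d ^+ 2 * A ^+ n * adj_count z.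
    rewrite -{1}(eqP Sz); apply: sip_gen_prodf => //; first by move=> x; exact: vA.
    by move=> x; exact: dtrig_lip.
  have H2 : `|prodf (dtrig m l (s + h)) z - prodf (dtrig m l s) z - h * I| <= C * h ^+ 2.
    apply: step; first exact/eqP.
    - by rewrite h0 (le_trans _ sh)// lerDr.
    - by move=> x; exact: vA.
    - by move=> x; apply: vA; rewrite addr_ge0.
    - by move=> x; apply: dlap_le => // y; exact: vA.
    - by move=> x; exact: dtrig_step.
  have H3 := sip_gen_bdist Sz.
  have {H3} H3 : a * (m / 2 * (2^-1 * adj_count z - n%:R ^+ 2 / N%:R)) <=
      a * sip_gen m (quadf (bdist N)) z by rewrite ler_wpM2l.
  have E3 : a * (m / 2 * (2^-1 * adj_count z - n%:R ^+ 2 / N%:R)) =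
      2^-1 * d ^+ 2 * A ^+ n * adj_count z - b.
    by rewrite /b /a; field; rewrite !gt_eqF.
  have H1' : sg * sip_gen m (prodf (dtrig m l s)) z - sg * I <=
      2^-1 * d ^+ 2 * A ^+ n * adj_count z.
    by rewrite -mulrBr (le_trans (ler_norm _))// normrM sg1 mul1r.
  have H2' : sg * prodf (dtrig m l s) z + h * (sg * I) - sg * prodf (dtrig m l (s + h)) z
      <= C * h ^+ 2.
    apply: le_trans (ler_norm _) _; rewrite (_ : _ - _ = - sg *
      (prodf (dtrig m l (s + h)) z - prodf (dtrig m l s) z - h * I)); last by ring.
    by rewrite normrM normrN sg1 mul1r.
  rewrite E3 in H3.
  have H4 : h * (sg * sip_gen m (prodf (dtrig m l s)) z - a * sip_gen m (quadf (bdist N)) z)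
     <= h * (sg * I + b) by rewrite ler_wpM2l//; lra.
  rewrite /G; lra.
- move=> z Sz; rewrite lee_fin /G mulr0 addr0 lerD2r lerDl.
  by rewrite mulr_ge0// subr_ge0 quadf_bdist_le.
Qed.

End Ratio.

(** With V the trigonometric product, the upper bound comes from H + M <= (V + M) + D and the lower
    one from M <= (M - V) + H + D. All functions involved are nonnegative, so expectations may be
    added even if that of H is infinite. *)
Lemma expect_close_trig n N (A t del : R) l xi (H D : fconf -> R) :
  (2 <= N)%N -> sector n xi -> 0 <= t -> 1 <= A -> trig_norm l <= A ->
  (forall z, 0 <= H z) -> (forall z, 0 <= D z) ->
  (forall z, sector n z -> `|H z - prodf (dtrig m l 0) z| <= D z) ->
  (fsip_expect p t xi (EFin \o D) <= del%:E)%E ->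
  ((prodf (dtrig m l t) xi - del - prod_err n N A t l)%:E <=
   fsip_expect p t xi (EFin \o H) <=
   (prodf (dtrig m l t) xi + del + prod_err n N A t l)%:E)%E.
Proof.
move=> N2 Sxi t0 A1 lA H0 D0 HD EDd; set err := prod_err n N A t l.
(* The constant M makes the shifted product nonnegative on the sector only; elsewhere the function
   is set to 0. *)
pose cut (f : fconf -> R) := fun z => (if sector n z then f z else 0)%:E.
have eH0 : (0 <= fsip_expect p t xi (EFin \o H))%E.
  by apply: fsip_expect_ge0 => // z; rewrite lee_fin.
have eD0 : (0 <= fsip_expect p t xi (EFin \o D))%E.
  by apply: fsip_expect_ge0 => // z; rewrite lee_fin.
apply/andP; split.
- have [M M0 [VM]] := @expect_prodf_trig N N2 n (-1) A t l xi Sxi t0 (normrN1 _) A1 lA.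
  pose F := cut (fun z => -1 * prodf (dtrig m l 0) z + M).
  have F0 z : (0 <= F z)%E.
    rewrite /F /cut lee_fin; case: ifPn => // /VM; rewrite ler_norml => /andP[]; lra.
  move=> UB.
  have {}UB : (fsip_expect p t xi F <= (-1 * prodf (dtrig m l t) xi + M + err)%:E)%E.
    by apply: le_trans UB; apply: (@le_fsip_expect n) => // z Sz; rewrite /F /cut Sz.
  have : (M%:E <= fsip_expect p t xi F + (fsip_expect p t xi (EFin \o H) +
       fsip_expect p t xi (EFin \o D)))%E.
    rewrite -(fsip_expect_cst xi t0 M0) -!fsip_expectD//; last first.
      by move=> z; rewrite /= -EFinD lee_fin addr_ge0.
    apply: (@le_fsip_expect n) => // z Sz.
    rewrite /F /cut Sz /= -!EFinD lee_fin.
    by have := HD z Sz; rewrite ler_norml => /andP[]; lra.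
  have eF0 : (0 <= fsip_expect p t xi F)%E by exact: fsip_expect_ge0.
  move: UB eF0 EDd eD0 eH0.
  case: (fsip_expect p t xi F) => [u| |] //.
  case: (fsip_expect p t xi (EFin \o D)) => [v| |] //.
  case: (fsip_expect p t xi (EFin \o H)) => [w| |] //.
    by rewrite !lee_fin; lra.
  by move=> *; rewrite leey.
- have [M M0 [VM]] := @expect_prodf_trig N N2 n 1 A t l xi Sxi t0 (normr1 _) A1 lA.
  pose F := cut (fun z => 1 * prodf (dtrig m l 0) z + M).
  have F0 z : (0 <= F z)%E.
    rewrite /F /cut lee_fin; case: ifPn => // /VM; rewrite ler_norml => /andP[]; lra.
  move=> UB.
  have {}UB : (fsip_expect p t xi F <= (1 * prodf (dtrig m l t) xi + M + err)%:E)%E.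
    by apply: le_trans UB; apply: (@le_fsip_expect n) => // z Sz; rewrite /F /cut Sz.
  have : (fsip_expect p t xi (EFin \o H) + M%:E <=
      fsip_expect p t xi F + fsip_expect p t xi (EFin \o D))%E.
    rewrite -(fsip_expect_cst xi t0 M0) -!fsip_expectD//.
    apply: (@le_fsip_expect n) => // z Sz.
    rewrite /F /cut Sz /= -!EFinD lee_fin.
    by have := HD z Sz; rewrite ler_norml => /andP[]; lra.
  have eF0 : (0 <= fsip_expect p t xi F)%E by exact: fsip_expect_ge0.
  move: UB eF0 EDd eD0 eH0.
  case: (fsip_expect p t xi F) => [u| |] //.
  case: (fsip_expect p t xi (EFin \o D)) => [v| |] //.
  case: (fsip_expect p t xi (EFin \o H)) => [w| |] //.
  by rewrite !lee_fin; lra.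
Qed.

End SipProcess.

(** * Lower bounds for 1 - cos and geometric sums *)

Section TrigBounds.
Context {R : realType}.

Lemma sin_ge_linear (x : R) : 0 <= x <= 1 -> x * cos 1 <= sin x.
Proof.
move=> /andP[]; rewrite le_eqVlt => /predU1P[<- _|x0 x1]; first by rewrite mul0r sin0.
have dsin y : y \in `]0, x[ -> is_derive y 1 (sin : R -> R) (cos y).
  by move=> _; exact: is_derive_sin.
have [] := MVT x0 dsin.
  by apply: continuous_subspaceT; exact: continuous_sin.
move=> c; rewrite in_itv/= => /andP[c0 cx]; rewrite sin0 !subr0 => ->.
rewrite mulrC ler_wpM2r// ?ltW//.
have p2 := @pi_ge2 R.
have c1 : c < 1 := lt_le_trans cx x1.
rewrite ltr_cos// in_itv/=; apply/andP; split; lra.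
Qed.

Lemma one_sub_cos (x : R) : 1 - cos x = 2 * sin (x / 2) ^+ 2.
Proof.
have -> : cos x = cos (x / 2 + x / 2) by rewrite -splitr.
by rewrite cosD -!expr2 cos2sin2; ring.
Qed.

(** The constant 2 (cos 1 / 2)^2 obtained from 1 - cos x = 2 sin^2 (x / 2) and sin u >= u cos 1 on
    [0, 1]. *)
Definition cos_gap : R := cos 1 ^+ 2 / 2.

Lemma cos_gap_gt0 : 0 < cos_gap.
Proof. by rewrite divr_gt0// exprn_gt0// cos1_gt0. Qed.

Lemma one_sub_cos_ge (x : R) : `|x| <= 1 -> cos_gap * x ^+ 2 <= 1 - cos x.
Proof.
wlog x0 : x / 0 <= x => [H|].
  have [/H//|/ltW x0] := lerP 0 x.
  by rewrite -normrN -cosN -sqrrN => /H; apply; rewrite oppr_ge0.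
rewrite ger0_norm// => x1.
rewrite one_sub_cos /cos_gap.
have := @sin_ge_linear (x / 2); have c1 := @cos1_gt0 R.
have -> : 0 <= x / 2 <= 1 by apply/andP; split; lra.
move=> /(_ isT) H.
have : (x / 2 * cos 1) ^+ 2 <= sin (x / 2) ^+ 2.
  have P0 : 0 <= x / 2 * cos 1 by rewrite mulr_ge0 ?divr_ge0// ltW.
  by rewrite lerXn2r ?nnegrE// (le_trans P0 H).
by rewrite exprMn; lra.
Qed.

Lemma geometric_le (q : R) k : 0 <= q -> q < 1 -> \sum_(0 <= i < k) q ^+ i <= (1 - q)^-1.
Proof.
move=> q0 q1; have q1' : 0 < 1 - q by rewrite subr_gt0.
rewrite -[leRHS]mul1r ler_pdivlMr//.
elim: k => [|k IH]; first by rewrite big_geq// mul0r.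
rewrite big_nat_recl// expr0; under eq_bigr do rewrite exprS.
by rewrite -mulr_sumr; have := ler_wpM2l q0 IH; lra.
Qed.

Lemma two_sided_geometric_le (q : R) k N : 0 <= q -> q < 1 -> (k <= N)%N ->
  \sum_(0 <= j < N) q ^+ `|k - j|%N <= 2 / (1 - q).
Proof.
move=> q0 q1 kN; have q1' : 0 < 1 - q by rewrite subr_gt0.
rewrite (@big_cat_nat _ _ _ k)//= (_ : 2 = 1 + 1)// mulrDl mul1r lerD//.
  have -> : \sum_(0 <= j < k) q ^+ `|k - j|%N = q * \sum_(0 <= i < k) q ^+ i.
    rewrite big_nat_rev/= mulr_sumr; apply: eq_big_nat => i /andP[_ ik].
    by rewrite -exprS; congr (_ ^+ _); lia.
  apply: le_trans (geometric_le k q0 q1).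
  by rewrite ler_piMl ?(ltW q1)// sumr_ge0// => i _; rewrite exprn_ge0.
rewrite -{1}(add0n k) big_addn; apply: le_trans (geometric_le (N - k) q0 q1).
rewrite le_eqVlt; apply/orP; left; apply/eqP; apply: eq_big_nat => i _.
by congr (_ ^+ _); lia.
Qed.

End TrigBounds.

(** * Estimates at time N^2 t *)

Section Scaling.
Context {R : realType} (m : R) (p : R -> fconf -> fconf -> R).
Hypothesis m_gt0 : 0 < m.
Hypothesis p_sip : is_fsip m p.

(** The squared modulus of the average over k < N of exp (i k (x - z) / N), expanded into N^2 waves.
    It is nonnegative and equals 1 at z, hence dominates the indicator of z. *)
Definition fejer (N : nat) (z : int) : seq (R * R * R) :=
  [seq (N%:R ^- 2, (k%:R - j%:R) / N%:R, - ((k%:R - j%:R) / N%:R * z%:~R))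
  | k <- index_iota 0 N, j <- index_iota 0 N].

Lemma trig_fejer N z x : trig (fejer N z) x =
  N%:R ^- 2 * ((\sum_(0 <= k < N) cos (k%:R / N%:R * (x - z%:~R))) ^+ 2 +
               (\sum_(0 <= k < N) sin (k%:R / N%:R * (x - z%:~R))) ^+ 2).
Proof.
rewrite /trig /fejer big_allpairs_dep/= !expr2 !mulr_suml -big_split/= mulr_sumr.
apply: eq_bigr => k _; rewrite !mulr_sumr -big_split/= mulr_sumr.
apply: eq_bigr => j _; rewrite /wave/=; congr (_ * _).
rewrite -cosB; congr cos; ring.
Qed.

Lemma fejer_ge N z (x : int) : (0 < N)%N ->
  (x == z)%:R <= trig (fejer N z) x%:~R.
Proof.
move=> N0; rewrite trig_fejer; case: eqP => [->|_]; last first.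
  by rewrite mulr_ge0 ?invr_ge0 ?exprn_ge0// addr_ge0// sqr_ge0.
rewrite subrr (eq_bigr (fun=> 1)); last by move=> k _; rewrite mulr0 cos0.
rewrite [X in _ + X ^+ 2](eq_bigr (fun=> 0)); last by move=> k _; rewrite mulr0 sin0.
rewrite [X in _ + X ^+ 2]big1// expr0n addr0 big_const_seq count_predT iter_addr_0.
by rewrite size_iota subn0 mulVf// expf_neq0// pnatr_eq0 -lt0n.
Qed.

(** At time N^2 t the wave of frequency (k - j) / N is damped by at least exp (- m [cos_gap] t (k -
    j)^2), and (k - j)^2 >= |k - j| for integers. The sum over j is then geometric and bounded, so N
    values of k and the prefactor N^-2 leave O(1 / N). *)
Lemma damped_fejer_le (t : R) (x z : int) N : 0 < t -> (0 < N)%N ->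
  dtrig m (fejer N z) (N%:R ^+ 2 * t) x <=
    2 / (1 - expR (- (m * cos_gap * t))) / N%:R.
Proof.
move=> t0 N0; set q := expR _.
have N0' : (0 : R) < N%:R by rewrite ltr0n.
have q0 : 0 <= q := expR_ge0 _.
have q1 : q < 1.
  by rewrite -expR0 ltr_expR oppr_lt0 mulr_gt0// mulr_gt0// cos_gap_gt0.
rewrite dtrigE /fejer big_allpairs_dep/=.
apply: (@le_trans _ _ (\sum_(0 <= k < N) \sum_(0 <= j < N) N%:R ^- 2 * q ^+ `|k - j|%N)).
  rewrite !big_nat; apply: ler_sum => k /andP[_ kN].
  rewrite !big_nat; apply: ler_sum => j /andP[_ jN].
  apply: le_trans (ler_norm _) _; rewrite normrM ger0_norm ?expR_ge0// mulrC.
  apply: ler_pM; [by []|exact: expR_ge0| |].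
    apply: le_trans (wave_norm _ _) _ => /=.
    by rewrite ger0_norm// invr_ge0 exprn_ge0.
  rewrite /q -expRM_natl ler_expR mulrN lerN2 mulrC /damp_rate.
  set d : R := (k%:R - j%:R) / N%:R.
  have kj : `|k%:R - j%:R| = (`|k - j|%N)%:R :> R.
    by rewrite natr_absz intr_norm rmorphB.
  have d1 : `|d| <= 1.
    rewrite normrM normfV (ger0_norm (ltW N0')) ler_pdivrMr// mul1r kj ler_nat; lia.
  have := one_sub_cos_ge d1.
  have kj2 : (`|k - j|%N)%:R <= (N%:R * d) ^+ 2.
    rewrite /d mulrC divfK ?gt_eqF// -real_normK ?num_real// kj -natrX ler_nat.
    by rewrite -mulnn; case: (`|k - j|%N) => // i; rewrite leq_pmulr.
  move=> H; have c0 := @cos_gap_gt0 R.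
  have A1 : m * t * N%:R ^+ 2 * (cos_gap * d ^+ 2) <= m * t * N%:R ^+ 2 * (1 - cos d).
    by rewrite ler_wpM2l// !mulr_ge0 ?ltW// exprn_gt0.
  have A2 : m * cos_gap * t * (`|k - j|%N)%:R <= m * cos_gap * t * (N%:R * d) ^+ 2.
    by rewrite ler_wpM2l// mulr_ge0 ?(ltW t0)// mulr_ge0// ltW.
  rewrite exprMn in A2; lra.
apply: (@le_trans _ _ (\sum_(0 <= k < N) N%:R ^- 2 * (2 / (1 - q)))).
  rewrite !big_nat; apply: ler_sum => k /andP[_ kN].
  rewrite -mulr_sumr ler_wpM2l ?invr_ge0 ?exprn_ge0//.
  by apply: two_sided_geometric_le => //; exact: ltnW.
rewrite big_const_seq count_predT iter_addr_0 size_iota subn0 -[leLHS]mulr_natl.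
rewrite le_eqVlt; apply/orP; left; apply/eqP; field.
by rewrite !gt_eqF// subr_gt0.
Qed.

Lemma expect_site_le (t : R) xi z N : 0 < t -> (0 < N)%N ->
  (fsip_expect p (N%:R ^+ 2 * t) xi (EFin \o linf (fun x => (x == z)%:R)) <=
   ((size (particles xi))%:R * (2 / (1 - expR (- (m * cos_gap * t))) / N%:R))%:E)%E.
Proof.
move=> t0 N0; apply: le_trans (expect_linf_trig m_gt0 p_sip (l := fejer N z) _ _ _ _) _.
- by rewrite mulr_ge0 ?exprn_ge0// ltW.
- by [].
- by move=> x; exact: fejer_ge.
- rewrite lee_fin /linf.
  apply: (@le_trans _ _ (\sum_(x <- particles xi) 2 / (1 - expR (- (m * cos_gap * t))) / N%:R)).
    by apply: ler_sum => x _; exact: damped_fejer_le.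
  by rewrite big_const_seq count_predT iter_addr_0 -[leLHS]mulr_natl.
Qed.

Definition expw (b : R) (N : nat) (x : int) : R := expR (b * (`|x%:~R| / N%:R)).

(** With u = b / N, the weight exp (u |x|) lies within a factor 2 of W = e^(u x) + e^(- u x), an
    exact eigenfunction of [dlap m]. Its eigenvalue m / 2 (e^(u/2) - e^(-u/2))^2 is at most m / 2
    u^2 e^b, so the growth rate over the time N^2 t does not depend on N. *)
Lemma expect_expw_le (b t : R) xi N : 0 <= b -> 0 <= t -> (0 < N)%N ->
  (fsip_expect p (N%:R ^+ 2 * t) xi (EFin \o linf (expw b N)) <=
   (2 * expR (m / 2 * b ^+ 2 * expR b * t) * linf (expw b N) xi)%:E)%E.
Proof.
move=> b0 t0 N0.
have N0' : (0 : R) < N%:R by rewrite ltr0n.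
pose u := b / N%:R.
have u0 : 0 <= u by rewrite divr_ge0.
pose W (x : int) := expR (u * x%:~R) + expR (- (u * x%:~R)).
pose c := m / 2 * (expR u + expR (- u) - 2).
have cE : expR u + expR (- u) - 2 = (expR (u / 2) - expR (- (u / 2))) ^+ 2.
  have e1 : expR (u / 2) * expR (u / 2) = expR u by rewrite -expRD -splitr.
  have e2 : expR (- (u / 2)) * expR (- (u / 2)) = expR (- u).
    by rewrite -expRD -opprD -splitr.
  have e3 : expR (u / 2) * expR (- (u / 2)) = 1 by rewrite -expRD subrr expR0.
  by rewrite -e1 -e2 expr2; lra.
have c0 : 0 <= c by rewrite /c cE mulr_ge0 ?divr_ge0 ?sqr_ge0 ?ltW.
have cle : c * (N%:R ^+ 2 * t) <= m / 2 * b ^+ 2 * expR b * t.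
  have h1 : 0 <= expR (u / 2) - expR (- (u / 2)).
    by rewrite subr_ge0 ler_expR; lra.
  have h2 : expR (u / 2) - expR (- (u / 2)) <= u * expR (u / 2).
    have := expR_ge1Dx (- u); have e0 := expR_ge0 (u / 2).
    have -> : expR (- (u / 2)) = expR (u / 2) * expR (- u).
      by rewrite -expRD; congr expR; field.
    by move=> H; have := ler_wpM2l e0 H; lra.
  have h3 : expR u + expR (- u) - 2 <= u ^+ 2 * expR b.
    rewrite cE; apply: (@le_trans _ _ ((u * expR (u / 2)) ^+ 2)).
      by rewrite lerXn2r ?nnegrE// mulr_ge0// expR_ge0.
    rewrite exprMn ler_wpM2l ?sqr_ge0// expr2 -expRD -splitr ler_expR.
    by rewrite /u ler_pdivrMr// ler_peMr// ler1n.
  rewrite /c; have := ler_wpM2l (mulr_ge0 (divr_ge0 (ltW m_gt0) (ler0n _ 2))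
    (mulr_ge0 (exprn_ge0 2 (ltW N0')) t0)) h3.
  rewrite -[X in _ <= X -> _](_ : m / 2 * (N%:R * u) ^+ 2 * expR b * t = _); last by ring.
  by rewrite /u [N%:R * _]mulrC divfK ?gt_eqF//; lra.
have eE x : expw b N x = expR (u * `|x%:~R|).
  by rewrite /expw /u; congr expR; ring.
have We x : expw b N x <= W x.
  rewrite eE /W.
  have [x0|/ltW x0] := leP 0 (x%:~R : R); first by rewrite ger0_norm// lerDl expR_ge0.
  by rewrite ler0_norm// mulrN lerDr expR_ge0.
have eW x : W x <= 2 * expw b N x.
  rewrite eE /W mulr_natl mulr2n.
  apply: lerD; rewrite ler_expR; first by rewrite ler_wpM2l// ler_norm.
  by rewrite -mulrN ler_wpM2l// -normrN ler_norm.
apply: (@le_trans _ _ (fsip_expect p (N%:R ^+ 2 * t) xi (EFin \o linf W))).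
  apply: (le_fsip_expect m_gt0 p_sip (n := size (particles xi))).
  - by rewrite mulr_ge0 ?exprn_ge0.
  - exact: eqxx.
  - by move=> z _; rewrite lee_fin; apply: ler_sum.
apply: le_trans (expect_linf_exp m_gt0 p_sip xi (c := c) _ c0 _ _) _.
- by rewrite mulr_ge0 ?exprn_ge0.
- by move=> x; rewrite addr_ge0 ?expR_ge0.
- move=> x; rewrite /dlap /W /c rmorphB rmorphD/= !mulrDr !mulrN mulr1 !opprD opprK !expRD.
  by rewrite le_eqVlt; apply/orP; left; apply/eqP; ring.
- rewrite lee_fin [leRHS](_ : _ = expR (m / 2 * b ^+ 2 * expR b * t) *
    (2 * linf (expw b N) xi)); last by ring.
  rewrite ler_pM ?expR_ge0 ?ler_expR//.
  + by apply: sumr_ge0 => x _; rewrite addr_ge0 ?expR_ge0.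
  + by rewrite /linf mulr_sumr; apply: ler_sum => x _.
Qed.

Definition site_const (t : R) : R := 2 / (1 - expR (- (m * cos_gap * t))).

Definition expw_const (b t : R) : R := 2 * expR (m / 2 * b ^+ 2 * expR b * t).

(** Three sorts of one-particle error: at listed sites, where the density bound supplies the factor
    1 / N that turns the sum into a Riemann sum; uniform; and exponentially weighted, for the
    tails. *)
Lemma expect_linf_error (t : R) xi N (s : seq int) (g h : int -> R) (e c b : R) :
  0 < t -> (0 < N)%N -> (forall z, 0 <= g z) -> 0 <= e -> 0 <= c -> 0 <= b ->
  (forall x, h x <= \sum_(z <- s) g z * (x == z)%:R + e + c * expw b N x) ->
  (fsip_expect p (N%:R ^+ 2 * t) xi (EFin \o linf h) <=
   ((size (particles xi))%:R * site_const t * (N%:R^-1 * \sum_(z <- s) g z) +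
    (size (particles xi))%:R * e + c * (expw_const b t * linf (expw b N) xi))%:E)%E.
Proof.
move=> t0 N0 g0 e0 c0 b0 hle; set n := size (particles xi).
have T0 : 0 <= N%:R ^+ 2 * t by rewrite mulr_ge0 ?exprn_ge0// ltW.
have lw0 z : 0 <= linf (expw b N) z by apply: sumr_ge0 => x _; exact: expR_ge0.
pose S z : R := \sum_(y <- s) g y * linf (fun x => (x == y)%:R) z.
have S0 z : 0 <= S z.
  by apply: sumr_ge0 => y _; rewrite mulr_ge0//; exact: sumr_ge0.
have ES : (fsip_expect p (N%:R ^+ 2 * t) xi (EFin \o S) <=
    (n%:R * site_const t * (N%:R^-1 * \sum_(z <- s) g z))%:E)%E.
  rewrite /S; elim: (s) => [|y r IH].
    rewrite big_nil !mulr0 -(fsip_expect_cst p_sip xi T0 (lexx 0)).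
    apply: (le_fsip_expect m_gt0 p_sip (n := n)); rewrite ?/sector// => z _.
    by rewrite /= big_nil.
  rewrite [X in fsip_expect _ _ _ X](_ : _ =
      ((fun z => (g y)%:E * (EFin \o linf (fun x => (x == y)%:R)) z) \+
       (EFin \o (fun z => (\sum_(y <- r) g y * linf (fun x => (x == y)%:R) z)%R)))%E); last first.
    by apply/funext => z /=; rewrite big_cons EFinD EFinM.
  rewrite (fsip_expectD p_sip)//; last 2 first.
  - by move=> z; rewrite -EFinM lee_fin mulr_ge0//; exact: sumr_ge0.
  - move=> z; rewrite lee_fin; apply: sumr_ge0 => y' _.
    by rewrite mulr_ge0//; exact: sumr_ge0.
  rewrite (fsip_expectZ p_sip)//; last by move=> z; rewrite lee_fin; exact: sumr_ge0.
  rewrite big_cons !mulrDr EFinD; apply: leeD => //.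
  apply: (@le_trans _ _ ((g y)%:E * (n%:R * (site_const t / N%:R))%:E)%E).
    by apply: lee_wpmul2l; rewrite ?lee_fin//; exact: expect_site_le.
  by rewrite -EFinM lee_fin le_eqVlt; apply/orP; left; apply/eqP; ring.
apply: (@le_trans _ _ (fsip_expect p (N%:R ^+ 2 * t) xi ((EFin \o S) \+
   ((fun=> (n%:R * e)%:E) \+ (fun z => c%:E * (EFin \o linf (expw b N)) z)))%E)).
  apply: (le_fsip_expect m_gt0 p_sip (n := n)); rewrite ?/sector// => z /eqP zn.
  rewrite /= -EFinM -!EFinD lee_fin.
  apply: (@le_trans _ _ (linf (fun x => \sum_(z <- s) g z * (x == z)%:R + e + c * expw b N x) z)).
    exact: ler_sum.
  rewrite /linf !big_split/= -mulr_sumr -addrA.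
  rewrite big_const_seq count_predT iter_addr_0 zn -[_ *+ n]mulr_natl.
  rewrite lerD2r /S exchange_big/= le_eqVlt; apply/orP; left; apply/eqP.
  by apply: eq_bigr => y _; rewrite mulr_sumr.
rewrite (fsip_expectD p_sip)//; last first.
  by move=> z; rewrite /= -EFinM -EFinD lee_fin addr_ge0 ?mulr_ge0.
rewrite (fsip_expectD p_sip)//; last 2 first.
- by move=> z; rewrite lee_fin mulr_ge0.
- by move=> z; rewrite /= -EFinM lee_fin mulr_ge0.
rewrite (fsip_expect_cst p_sip)// ?mulr_ge0//.
rewrite (fsip_expectZ p_sip)//.
rewrite -addrA EFinD; apply: leeD => //.
rewrite EFinD leeD2lE// EFinM; apply: lee_wpmul2l => //.
by apply: expect_expw_le => //; exact: ltW.
Qed.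

End Scaling.

(** * Negative binomial moments and duality *)

Section GammaFunction.
Context {R : realType}.
Implicit Types a x : R.
Local Notation mu := (@lebesgue_measure R).

Let g a x : R := x `^ (a - 1) * expR (- x).

Let I a : \bar R := (\int[mu]_(x in `]0%R, +oo[) (g a x)%:E)%E.

(** A compact exhaustion of the half-line; the shift by 2 keeps the interval nondegenerate at k =
    0. *)
Let F (k : nat) : set R := `[k.+2%:R^-1, k.+2%:R]%classic.

Let lo_gt0 k : (0 : R) < k.+2%:R^-1.
Proof. by rewrite invr_gt0 ltr0n. Qed.

Let lo_lt_hi k : k.+2%:R^-1 < k.+2%:R :> R.
Proof.
by apply: (@lt_trans _ _ 1); rewrite ?invf_lt1 ?ltr0n ?ltr1n.
Qed.

Let measurable_g a (D : set R) : measurable D -> measurable_fun D (g a).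
Proof.
move=> mD; apply: measurable_funTS.
apply: measurable_funM; first exact: measurable_powR.
apply: measurableT_comp; first exact: measurable_expR.
exact: measurable_funN.
Qed.

Let g_ge0 a x : 0 <= g a x.
Proof. by rewrite mulr_ge0 ?powR_ge0 ?expR_ge0. Qed.

Let is_derive_powR_expR a x : 0 < x ->
  is_derive x 1 (fun y : R => y `^ a * expR (- y)) (a * g a x - g (a + 1) x).
Proof.
move=> x0.
have d1 : is_derive x 1 (fun y : R => expR (- y)) (- expR (- x)).
  have dN : is_derive x (1 : R) (fun y : R => - y) (-1) by apply: is_deriveN.
  by rewrite -mulrN1; exact: (is_derive1_comp (is_derive_expR (- x)) dN).
have d2 := is_derive1_powR a x0.
apply: (is_derive_eq (is_deriveM d2 d1)).
by rewrite /g addrK /GRing.scale/=; ring.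
Qed.

Let cont_g a k : {within F k, continuous (g a)}.
Proof.
apply: derivable_within_continuous => x; rewrite in_itv/= => /andP[lx _].
have x0 : 0 < x := lt_le_trans (lo_gt0 k) lx.
by have [] := is_derive_powR_expR (a - 1) x0.
Qed.

(** Integration by parts on a compact interval: the derivative of x^a e^-x is the difference of the
    integrands. *)
Let compact_identity a k :
  (a%:E * \int[mu]_(x in F k) (g a x)%:E =
   \int[mu]_(x in F k) (g (a + 1) x)%:E +
   (k.+2%:R `^ a * expR (- k.+2%:R) - k.+2%:R^-1 `^ a * expR (- k.+2%:R^-1))%:E)%E.
Proof.
have cf : {within F k, continuous (fun x => a * g a x - g (a + 1) x)}.
  move=> x; apply: cvgB; last exact: cont_g.
  by apply: cvgM; [exact: cvg_cst|exact: cont_g].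
have der x : x \in `[k.+2%:R^-1, k.+2%:R] -> is_derive x 1 (fun y : R => y `^ a * expR (- y))
    (a * g a x - g (a + 1) x).
  rewrite in_itv/= => /andP[lx _]; apply: is_derive_powR_expR.
  exact: lt_le_trans (lo_gt0 k) lx.
have ctn x : x \in `[k.+2%:R^-1, k.+2%:R] -> {for x, continuous (fun y : R => y `^ a * expR (- y))}.
  move=> /der [dx _]; apply: differentiable_continuous; exact/derivable1_diffP.
have dF : derivable_oo_LRcontinuous (fun y : R => y `^ a * expR (- y)) k.+2%:R^-1 k.+2%:R.
  split.
  - move=> x xk; have [] // := der x _.
    by apply: subset_itv_oo_cc xk.
  - apply: cvg_at_right_filter; apply: ctn.
    by rewrite in_itv/= lexx ltW.
  - apply: cvg_at_left_filter; apply: ctn.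
    by rewrite in_itv/= lexx andbT ltW.
have := continuous_FTC2 (lo_lt_hi k) cf dF.
have mF : measurable (F k) by exact: measurable_itv.
have ig b : mu.-integrable (F k) (EFin \o g b).
  by apply: continuous_compact_integrable; [exact: segment_compact|exact: cont_g].
rewrite -/(F k) => H.
have : (\int[mu]_(x in F k) (a * g a x - g (a + 1) x)%:E =
   a%:E * \int[mu]_(x in F k) (g a x)%:E - \int[mu]_(x in F k) (g (a + 1) x)%:E)%E.
  under eq_integral do rewrite EFinB EFinM.
  rewrite integralB//; last 2 first.
  - by apply: integrableZl => //; exact: ig.
  - exact: ig.
  by rewrite integralZl//; exact: ig.
rewrite H; last first.
  move=> x xk; rewrite derive1E.
  have xk' : x \in `[k.+2%:R^-1, k.+2%:R] by apply: subset_itv_oo_cc xk.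
  by have [_ ->] := der _ xk'.
have : (\int[mu]_(x in F k) (g a x)%:E)%E \is a fin_num by exact: integrable_fin_num (ig a).
have : (\int[mu]_(x in F k) (g (a + 1) x)%:E)%E \is a fin_num by exact: integrable_fin_num (ig _).
case: (\int[mu]_(x in F k) (g (a + 1) x)%:E)%E => [u| |] // _.
case: (\int[mu]_(x in F k) (g a x)%:E)%E => [v| |] // _.
by rewrite -!EFinB -!EFinM => -[E]; congr EFin; lra.
Qed.

Let cvg_compact a :
  (\int[mu]_(x in F k) (g a x)%:E)%E @[k --> \oo] --> I a.
Proof.
have FU : `]0, +oo[%classic = \bigcup_k F k :> set R.
  apply/seteqP; split=> x /=; rewrite in_itv/= ?andbT.
    move=> x0; pose k := Num.truncn (x + x^-1).
    have kP : x + x^-1 < k.+1%:R by exact: Num.Theory.truncnS_gt.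
    have xi0 : 0 < x^-1 by rewrite invr_gt0.
    have kk : k.+1%:R < k.+2%:R :> R by rewrite ltr_nat.
    exists k => //; rewrite /F/= in_itv/=; apply/andP; split; last by lra.
    by rewrite -[leRHS]invrK lef_pV2 ?posrE//; lra.
  move=> [k _]; rewrite /F/= in_itv/= => /andP[lx _].
  exact: lt_le_trans (lo_gt0 k) lx.
rewrite /I FU; apply: ge0_nondecreasing_set_cvg_integral.
- apply/nondecreasing_seqP => k; apply/subsetPset => x; rewrite /F/=.
  rewrite !in_itv/= => /andP[lx xh]; apply/andP; split.
    by apply: le_trans lx; rewrite lef_pV2 ?posrE// ler_nat.
  by apply: le_trans xh _; rewrite ler_nat.
- by move=> k; exact: measurable_itv.
- by move=> k; apply/measurable_EFinP; apply: measurable_g; exact: measurable_itv.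
- by move=> k x _; rewrite lee_fin; exact: g_ge0.
Qed.

Let cvg_boundary a : 0 < a ->
  k.+2%:R `^ a * expR (- k.+2%:R) - k.+2%:R^-1 `^ a * expR (- k.+2%:R^-1)
    @[k --> \oo] --> (0 : R).
Proof.
move=> a0; rewrite -[X in _ --> X](subr0 0); apply: cvgB.
(* For y = k + 2, y^a <= y^j and e^y >= y^(j+1) / (j+1)!, so the upper boundary term is O(1 / k). *)
- pose j := (Num.truncn a).+1.
  have aj : a <= j%:R by apply: ltW; exact: Num.Theory.truncnS_gt.
  apply: (@squeeze_cvgr _ _ _ _ (fun=> 0) (fun k : nat => j.+1`!%:R * k.+1%:R^-1)).
  + apply: nearW => k; rewrite mulr_ge0 ?powR_ge0 ?expR_ge0//=.
    have k0 : 0 < k.+2%:R :> R by rewrite ltr0n.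
    apply: (@le_trans _ _ (k.+2%:R ^+ j * expR (- k.+2%:R))).
      rewrite ler_wpM2r ?expR_ge0// -powR_mulrn ?ler0n//.
      by rewrite ler_powR// ler1n.
    rewrite expRN ler_pdivrMr ?expR_gt0//.
    have := @expR_ge1Dxn R k.+2%:R j (ltW k0).
    have f0 : 0 < (j.+1)`!%:R :> R by rewrite ltr0n fact_gt0.
    move=> H; have {}H : k.+2%:R ^+ j.+1 / j.+1`!%:R <= expR k.+2%:R :> R by lra.
    apply: (@le_trans _ _ (j.+1`!%:R / k.+1%:R * (k.+2%:R ^+ j.+1 / j.+1`!%:R))); last first.
      by rewrite ler_wpM2l// divr_ge0.
    have u0 : 0 < k.+1%:R :> R by rewrite ltr0n.
    have uv : k.+1%:R <= k.+2%:R :> R by rewrite ler_nat.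
    move: (k.+1%:R : R) (k.+2%:R : R) (j.+1`!%:R : R) u0 uv f0 k0 {H} => u v f u0 uv f0 v0.
    rewrite [leRHS](_ : _ = v ^+ j * (v / u)).
      by rewrite ler_peMr ?exprn_ge0 ?(ltW v0)// ler_pdivlMr// mul1r.
    by rewrite exprS; field; rewrite !gt_eqF.
  + exact: cvg_cst.
  + rewrite -[X in _ --> X](mulr0 (j.+1`!%:R : R)).
    by apply: cvgM; [exact: cvg_cst|exact: cvg_harmonic].
- apply: (@squeeze_cvgr _ _ _ _ (fun=> 0) (fun k : nat => k.+2%:R^-1 `^ a)).
  + apply: nearW => k; rewrite mulr_ge0 ?powR_ge0 ?expR_ge0//=.
    by rewrite ler_piMr ?powR_ge0// -expR0 ler_expR oppr_le0.
  + exact: cvg_cst.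
  + have := powR_cvg0 a0 => /cvg_at_rightP; apply; split => //.
    by have := @cvg_harmonic R; rewrite -cvg_shiftS.
Qed.

(** Stated for extended reals, hence available before finiteness is known; finiteness and positivity
    are then transported along it. *)
Let I_rec a : 0 < a -> (a%:E * I a = I (a + 1))%E.
Proof.
move=> a0.
have h1 := cvgeZl (y := a%:E) isT (@cvg_compact a).
rewrite -(cvg_lim (@ereal_hausdorff R) h1); apply/cvg_lim => //.
have -> : (fun k => a%:E * \int[mu]_(x in F k) (g a x)%:E)%E = (fun k =>
   \int[mu]_(x in F k) (g (a + 1) x)%:E +
   (k.+2%:R `^ a * expR (- k.+2%:R) - k.+2%:R^-1 `^ a * expR (- k.+2%:R^-1))%:E)%E.
  by apply/funext => k; exact: compact_identity.
rewrite -[X in _ --> X]adde0; apply: cvgeD => //.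
  by rewrite fin_num_adde_defl.
by apply: cvg_EFin; [exact: nearW|exact: cvg_boundary].
Qed.

Let I_ge0 a : (0 <= I a)%E.
Proof. by apply: integral_ge0 => x _; rewrite lee_fin. Qed.

Let I1_fin : (I 1 < +oo)%E.
Proof.
have : (I 1 <= \int[mu]_x (exponential_pdf 1 x)%:E)%E.
  rewrite /I integral_mkcond; apply: ge0_le_integral => //.
  - by move=> x _; rewrite /patch; case: ifPn => //; rewrite lee_fin.
  - by apply/(measurable_restrictT _ _).1; [exact: measurable_itv|apply/measurable_EFinP; apply: measurable_g; exact: measurable_itv].
  - by apply/measurable_EFinP; exact: measurable_exponential_pdf.
  - move=> x _; rewrite /patch; case: ifPn; last by rewrite lee_fin exponential_pdf_ge0.
    rewrite inE/= in_itv/= andbT => x0.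
    rewrite lee_fin /g subrr powRr0 mul1r /exponential_pdf patchE mem_set/=.
      by rewrite mul1r mulN1r.
    by rewrite in_itv/= andbT ltW.
by rewrite integral_exponential_pdf// => /le_lt_trans; apply; rewrite ltry.
Qed.

Let I_nat_fin k : (I k.+1%:R < +oo)%E.
Proof.
elim: k => [|k IH]; first exact: I1_fin.
rewrite -natr1 -I_rec ?ltr0n// lte_mul_pinfty ?lee_fin//.
Qed.

(** For b >= 1, x^(b - 1) <= 1 + x^j with an integer j >= b, which reduces to integer arguments;
    smaller arguments follow from [I_rec]. *)
Let I_fin a : 0 < a -> (I a < +oo)%E.
Proof.
have big b : 1 <= b -> (I b < +oo)%E.
  move=> b1; pose j := (Num.truncn b).+1.
  have bj : b <= j%:R by apply: ltW; exact: Num.Theory.truncnS_gt.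
  apply: (@le_lt_trans _ _ (I 1 + I j.+1%:R)%E); last by rewrite lte_add_pinfty ?I1_fin ?I_nat_fin.
  have mE c : measurable_fun (`]0, +oo[%classic : set R) (fun x : measurableTypeR R => (g c x)%:E).
    by apply/measurable_EFinP; apply: measurable_g; exact: measurable_itv.
  have gE c (x : measurableTypeR R) : (`]0, +oo[%classic : set R) x -> (0 <= (g c x)%:E)%E.
    by rewrite lee_fin.
  rewrite /I -(ge0_integralD _ _ (gE 1) (mE 1) (gE j.+1%:R) (mE _))//.
  apply: ge0_le_integral => //=.
  - by move=> x _; rewrite lee_fin.
  - by apply/measurable_EFinP; apply: measurable_g; exact: measurable_itv.
  - by apply: emeasurable_funD; apply/measurable_EFinP; apply: measurable_g; exact: measurable_itv.
  - move=> x; rewrite in_itv/= andbT => x0; rewrite -EFinD lee_fin /g -mulrDl ler_wpM2r ?expR_ge0//.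
    rewrite subrr powRr0; have [x1|x1] := leP x 1.
      apply: (@le_trans _ _ 1); last by rewrite lerDl powR_ge0.
      have e1 : 1 `^ (b - 1) = 1 :> R by rewrite powR1.
      by rewrite -[leRHS]e1 ge0_ler_powR ?nnegrE ?(ltW x0)// subr_ge0.
    apply: (@le_trans _ _ (x `^ (j.+1%:R - 1))); last by rewrite lerDr.
    by rewrite ler_powR ?(ltW x1)// lerD2r (le_trans bj)// ler_nat.
move=> a0; have := big (a + 1); rewrite lerDr (ltW a0) => /(_ isT).
rewrite -(I_rec a0); have := I_ge0 a.
by case: (I a) => [u| |] // _; rewrite ?ltry// mulry gtr0_sg// mul1e.
Qed.

Let I_gt0 a : 0 < a -> (0 < I a)%E.
Proof.
have big b : 1 <= b -> (0 < I b)%E.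
  move=> b1.
  apply: (@lt_le_trans _ _ (\int[mu]_(x in `[1%R, 2%R]) (expR (- 2))%:E)%E).
    rewrite integral_cst//= lebesgue_measure_itv/= lte_fin ltr1n -EFinB.
    rewrite mule_gt0// lte_fin ?expR_gt0//; lra.
  apply: (@le_trans _ _ (\int[mu]_(x in `[1%R, 2%R]) (g b x)%:E)%E).
    apply: ge0_le_integral => //=.
    - by apply/measurable_EFinP; apply: measurable_g; exact: measurable_itv.
    - move=> x; rewrite in_itv/= => /andP[x1 x2]; rewrite lee_fin /g.
      rewrite -[leLHS]mul1r ler_pM ?expR_ge0 ?ler_expR ?lerN2//.
      have e1 : 1 `^ (b - 1) = 1 :> R by rewrite powR1.
      by rewrite -[leLHS]e1 ge0_ler_powR ?nnegrE ?subr_ge0// (le_trans _ x1).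
  apply: ge0_subset_integral => //=.
  - by apply/measurable_EFinP; apply: measurable_g; exact: measurable_itv.
  - by move=> x _; rewrite lee_fin.
  - by move=> x /=; rewrite !in_itv/= andbT => /andP[x1 _]; rewrite (lt_le_trans _ x1).
move=> a0; have := big (a + 1); rewrite lerDr (ltW a0) => /(_ isT).
by rewrite -(I_rec a0) pmule_rgt0 ?lte_fin.
Qed.

Lemma Gamma_gt0 a : 0 < a -> 0 < Gamma a.
Proof.
by move=> a0; rewrite /Gamma /Rintegral fine_gt0// I_gt0//= I_fin.
Qed.

Lemma Gamma_rec a : 0 < a -> Gamma (a + 1) = a * Gamma a.
Proof.
move=> a0; rewrite /Gamma /Rintegral -[LHS]/(fine (I (a + 1))) -(I_rec a0) fineM//.
rewrite ge0_fin_numE ?I_ge0//; exact: I_fin.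
Qed.

End GammaFunction.

(** * Factorial moments of the negative binomial law *)

Section NegativeBinomial.
Context {R : realType}.

(** The sequence v is the convolution of u with the powers of l. Monotone partial sums with an a
    priori bound give convergence, and the recursion then forces the value of the sum. *)
Lemma series_geometric_convolution (l S : R) (u v : nat -> R) : 0 <= l < 1 ->
  (forall n, 0 <= u n) -> v 0%N = u 0%N ->
  (forall n, v n.+1 = u n.+1 + l * v n) ->
  series u @ \oo --> S -> series v @ \oo --> S / (1 - l).
Proof.
move=> /andP[l0 l1] u0 v0 vS uS.
have l1' : 0 < 1 - l by rewrite subr_gt0.
have vge0 n : 0 <= v n.
  by elim: n => [|n IH]; rewrite ?v0// vS addr_ge0// mulr_ge0.
have rec n : series v n.+1 = series u n.+1 + l * series v n.
  rewrite !seriesEnat/=; elim: n => [|n IH].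
    by rewrite !big_nat1 big_geq// mulr0 addr0.
  rewrite big_nat_recr//= [X in _ = X + _]big_nat_recr//=.
  by rewrite [X in _ = _ + l * X]big_nat_recr//= IH vS; ring.
have nd (w : nat -> R) : (forall n, 0 <= w n) -> {homo series w : n m / (n <= m)%N >-> n <= m}.
  move=> w0; apply/nondecreasing_seqP => n; rewrite !seriesEnat/= big_nat_recr//=.
  by rewrite lerDl.
have uleS n : series u n <= S.
  rewrite -(cvg_lim _ uS)//; apply: nondecreasing_cvgn_le; first exact: nd.
  by apply/cvg_ex; exists S.
have vb n : series v n <= S / (1 - l).
  rewrite ler_pdivlMr// mulrBr mulr1 lerBlDr mulrC.
  apply: (@le_trans _ _ (series v n.+1)); first exact: (nd _ vge0).
  by rewrite rec lerD2r.
have cv : cvgn (series v).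
  apply: nondecreasing_is_cvgn; first exact: nd.
  by exists (S / (1 - l)) => _ [n _ <-].
suff -> : S / (1 - l) = limn (series v) by [].
have h1 : series v n.+1 @[n --> \oo] --> limn (series v) by rewrite cvg_shiftS.
have h2 : series v n.+1 @[n --> \oo] --> S + l * limn (series v).
  under eq_fun do rewrite rec.
  apply: cvgD; first by rewrite cvg_shiftS.
  by apply: cvgM => //; exact: cvg_cst.
have E : limn (series v) = S + l * limn (series v).
  exact: (cvg_unique _ h1 h2).
apply: (@mulIf _ (1 - l)); first by rewrite gt_eqF.
by rewrite divfK ?gt_eqF// mulrBr mulr1 {1}E; ring.
Qed.

Context (m : R).
Hypothesis m_gt0 : 0 < m.
Variable l : R.
Hypothesis l01 : 0 <= l < 1.

Let a : R := m / 2.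
Let a_gt0 : 0 < a. Proof. exact: divr_gt0. Qed.

(** The terms of the binomial series of (1 - l)^-(a + k). *)
Let c (k n : nat) : R :=
  l ^+ n / n`!%:R * (Gamma (a + k%:R + n%:R) / Gamma (a + k%:R)).

Let ak_gt0 (k : nat) : 0 < a + k%:R.
Proof. by rewrite ltr_pwDl. Qed.

Let c_ge0 k n : 0 <= c k n.
Proof.
have /andP[l0 _] := l01.
rewrite /c mulr_ge0// divr_ge0// ?exprn_ge0//; apply: ltW; apply: Gamma_gt0 => //.
exact: ltr_pwDl.
Qed.

Let c0 k : c k 0 = 1.
Proof.
by rewrite /c expr0 fact0 divr1 mul1r addr0 mulfV// gt_eqF// Gamma_gt0.
Qed.

(** Pascal's rule for rising factorials, that is, multiplication of the series by 1 / (1 - l). *)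
Let cS k n : c k.+1 n.+1 = c k n.+1 + l * c k.+1 n.
Proof.
rewrite /c.
have G0 := Gamma_gt0 (ak_gt0 k).
have -> : a + k.+1%:R = a + k%:R + 1 by rewrite -addrA natr1.
have -> : a + k%:R + 1 + n.+1%:R = (a + k%:R + 1 + n%:R) + 1 by rewrite -[in RHS]addrA natr1.
have -> : a + k%:R + n.+1%:R = a + k%:R + 1 + n%:R by rewrite -natr1; ring.
have P1 : 0 < a + k%:R + 1 + n%:R by rewrite ltr_pwDl// addr_gt0.
rewrite (Gamma_rec P1) (Gamma_rec (ak_gt0 k)).
have n0 : 0 < n.+1%:R :> R by rewrite ltr0n.
have f0 : 0 < n`!%:R :> R by rewrite ltr0n fact_gt0.
rewrite factS natrM exprS.
have a0 := ak_gt0 k.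
move: (Gamma (_ + n%:R)) => X; move: (Gamma _) G0 => Y Y0.
have -> : n%:R = n.+1%:R - 1 :> R by rewrite -natr1 addrK.
move: (n.+1%:R : R) (n`!%:R : R) (l ^+ n) (a + k%:R) n0 f0 a0
  => u f L b u0 f0 b0.
by field; rewrite !gt_eqF.
Qed.

Let cvg_c (k : nat) (S : R) : series (c 0) @ \oo --> S ->
  series (c k) @ \oo --> S / (1 - l) ^+ k.
Proof.
move=> H; elim: k => [|k IH]; first by rewrite expr0 divr1.
rewrite exprSr invfM mulrA.
apply: (series_geometric_convolution l01 (c_ge0 k) _ (cS k) IH).
by rewrite c0 c0.
Qed.

Lemma dual1_ge0 k n : 0 <= dual1 m k n.
Proof.
rewrite /dual1; case: ifP => // _.
by rewrite mulr_ge0 ?divr_ge0// ltW// Gamma_gt0.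
Qed.

Lemma negbin_ge0 n : 0 <= negbin m l n.
Proof.
have /andP[l0 l1] := l01.
rewrite /negbin mulr_ge0 ?mulr_ge0 ?divr_ge0 ?powR_ge0 ?exprn_ge0//.
  by rewrite ltW// Gamma_gt0// ltr_pwDl.
by rewrite invr_ge0 ltW// Gamma_gt0.
Qed.

(** The factor n! / (n - k)! shifts the index by k and leaves (1 - l)^a l^k times the binomial
    series with parameter a + k. Its sum is deduced from the case k = 0, which is the hypothesis of
    unit mass and is supplied later by the product measure. *)
Lemma negbin_moment k :
  (\sum_(n <oo) (negbin m l n)%:E = 1)%E ->
  (\sum_(n <oo) (dual1 m k n * negbin m l n)%:E = ((l / (1 - l)) ^+ k)%:E)%E.
Proof.
have /andP[l0 l1] := l01.
have l1' : 0 < 1 - l by rewrite subr_gt0.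
have P0 : 0 < (1 - l) `^ a by rewrite powR_gt0.
move=> S1.
have cvg_sum (u : nat -> R) (s : R) : (forall n, 0 <= u n) ->
    (\sum_(n <oo) (u n)%:E = s%:E)%E <-> series u @ \oo --> s.
  move=> u0.
  have E : (fun n => \sum_(0 <= i < n) (u i)%:E)%E = EFin \o series u.
    by apply/funext => n; rewrite /= seriesEnat/= sumEFin.
  split => [H|H].
    have : (fun n => \sum_(0 <= i < n) (u i)%:E)%E @ \oo --> s%:E.
      by rewrite -H; apply: is_cvg_nneseries => n _ _; rewrite lee_fin.
    by rewrite E => /fine_cvgP[_].
  by apply/cvg_lim => //; rewrite E; apply: cvg_EFin => //; exact: nearW.
have Sc : series (c 0) @ \oo --> ((1 - l) `^ a)^-1.
  have /cvg_sum H := S1.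
  have {}H := H negbin_ge0.
  have -> : series (c 0) = (fun n => ((1 - l) `^ a)^-1 * series (negbin m l) n).
    apply/funext => n; rewrite !seriesEnat/= mulr_sumr; apply: eq_bigr => i _.
    by rewrite /c /negbin -/a addr0 -(mulrA (_ `^ _)) mulKf// gt_eqF.
  rewrite -[X in _ --> X]mulr1; apply: cvgM => //; exact: cvg_cst.
apply/cvg_sum.
  by move=> n; rewrite mulr_ge0 ?dual1_ge0 ?negbin_ge0.
rewrite -(cvg_shiftn k) /=.
have -> : (fun n => series (fun n => dual1 m k n * negbin m l n) (n + k)) =
    (fun n => (1 - l) `^ a * l ^+ k * series (c k) n).
  apply/funext => n; rewrite !seriesEnat/=.
  rewrite (@big_cat_nat _ _ _ k) ?leq_addl//= big_nat big1 ?add0r; last first.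
    by move=> i /andP[_ ik]; rewrite /dual1 leqNgt ik mul0r.
  rewrite -{1}(add0n k) big_addn addnK mulr_sumr; apply: eq_bigr => i _.
  rewrite /dual1 leq_addl addnK /negbin /c -/a.
  have -> : a + k%:R + i%:R = a + (i + k)%:R by rewrite natrD; ring.
  have G0 := Gamma_gt0 a_gt0; have G1 := Gamma_gt0 (ak_gt0 k).
  have f1 : 0 < i`!%:R :> R by rewrite ltr0n fact_gt0.
  have f2 : 0 < (i + k)`!%:R :> R by rewrite ltr0n fact_gt0.
  move: (Gamma (a + k%:R)) (Gamma a) G0 G1 => Y X X0 Y0.
  move: (Gamma _) (i`!%:R : R) ((i + k)`!%:R : R) f1 f2 (_ `^ _) => Z f1 f2 f1_gt0 f2_gt0 P.
  by rewrite exprD; field; rewrite !gt_eqF.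
have -> : (l / (1 - l)) ^+ k = (1 - l) `^ a * l ^+ k * (((1 - l) `^ a)^-1 / (1 - l) ^+ k).
  by rewrite expr_div_n; field; rewrite !gt_eqF ?exprn_gt0.
by apply: cvgM; [exact: cvg_cst|exact: cvg_c].
Qed.

End NegativeBinomial.

(** * Integration against the product measure *)

Section CoordinateMeasurability.
Context {R : realType}.

Lemma measurable_coordinate i (Y : set nat) :
  measurable [set eta : Omega | Y (eta i)].
Proof.
have -> : [set eta : Omega | Y (eta i)] =
    \bigcup_(k in Y) [set eta : Omega | eta i = k].
  apply/seteqP; split=> eta /=; first by move=> Yi; exists (eta i).
  by move=> [k Yk /= ->].
apply: bigcup_measurable => k _; apply: sub_sigma_algebra.
by exists i, k.
Qed.

Lemma measurable_fun_coordinate (g : nat -> R) i :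
  measurable_fun [set: Omega] (fun eta : Omega => g (eta i)).
Proof.
move=> _ Y mY; rewrite setTI.
exact: (@measurable_coordinate i [set n | Y (g n)]).
Qed.

Lemma measurable_fun_prod_coordinate (g : int -> nat -> R) (s : seq int) :
  measurable_fun [set: Omega] (fun eta : Omega => \prod_(i <- s) g i (eta i)).
Proof.
elim: s => [|i s IH].
  rewrite (_ : (fun eta : Omega => _) = cst 1); first exact: measurable_cst.
  by apply/funext => eta; rewrite big_nil.
rewrite (_ : (fun eta : Omega => _) =
    (fun eta : Omega => g i (eta i) * \prod_(j <- s) g j (eta j))); last first.
  by apply/funext => eta; rewrite big_cons.
by apply: measurable_funM => //; exact: measurable_fun_coordinate.
Qed.

Definition cylinder (t : {fset int}) (k : int -> nat) : set Omega :=
  [set eta | forall i, i \in t -> eta i = k i].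

Lemma measurable_cylinder t k : measurable (cylinder t k).
Proof.
have -> : cylinder t k = \bigcap_(i in [set` t]) [set eta : Omega | eta i = k i].
  by apply/seteqP; split.
apply: fin_bigcap_measurable; first exact: finite_fset.
by move=> i _; exact: (@measurable_coordinate i [set n | n = k i]).
Qed.

Lemma cylinder_fsetU1 t k i n eta : i \notin t ->
  \1_(cylinder (i |` t)%fset (fun j => if j == i then n else k j)) eta =
  (eta i == n)%:R * \1_(cylinder t k) eta :> R.
Proof.
move=> it; rewrite !indicE -natrM mulnb; congr (nat_of_bool _)%:R.
apply/idP/andP.
  rewrite inE => H; split.
    by apply/eqP; rewrite (H i) ?fset1U1// eqxx.
  rewrite inE => j jt; rewrite (H j) ?fset1Ur//.
  by case: eqP => // ji; rewrite -ji jt in it.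
move=> [/eqP ein]; rewrite !inE => H j.
rewrite !inE => /orP[/eqP ->|jt]; first by rewrite eqxx.
by case: eqP => [->//|_]; exact: H.
Qed.

End CoordinateMeasurability.

Section ProductIntegral.
Context {R : realType} (m : R) (lam : int -> R) (mu : probability Omega R).
Hypothesis m_gt0 : 0 < m.
Hypothesis lam01 : forall i, 0 <= lam i < 1.
Hypothesis mu_product : is_negbin_product m lam mu.

Lemma mu_cylinder t k : mu (cylinder t k) = (\prod_(i <- t) negbin m (lam i) (k i))%:E.
Proof. exact: mu_product. Qed.

(** The values of one coordinate partition [Omega], so the total mass of [mu] gives the binomial
    series without any analysis. *)
Lemma negbin_mass i : (\sum_(n <oo) (negbin m (lam i) n)%:E = 1)%E.
Proof.
rewrite -(@probability_setT _ _ _ mu).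
have -> : [set: Omega] = \bigcup_n cylinder [fset i]%fset (fun=> n).
  apply/seteqP; split=> eta //= _; exists (eta i) => // j.
  by rewrite inE => /eqP ->.
rewrite measure_bigcup//; last 2 first.
- by move=> n _; exact: measurable_cylinder.
- apply/trivIsetP => n n' _ _ nn'; apply/seteqP; split=> eta //= [H H'].
  move: nn'; rewrite -(H i) ?inE// -(H' i) ?inE// eqxx//.
rewrite [RHS]eseries_mkcond; apply: eq_eseriesr => n _.
by rewrite in_setT; apply/esym; rewrite [LHS]mu_cylinder big_seq_fset1.
Qed.

(** The measure is given on cylinders only. Each factor is split according to the value of its
    coordinate, which is then absorbed into the cylinder, and series and integral are exchanged by
    monotone convergence. *)
Lemma integral_cylinder_prod (g : int -> nat -> R) (M : int -> R) (s : seq int) t k :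
  uniq s -> (forall i, i \in s -> i \notin t) -> (forall i n, 0 <= g i n) ->
  (forall i, (\sum_(n <oo) (g i n * negbin m (lam i) n)%:E = (M i)%:E)%E) ->
  (\int[mu]_eta (\1_(cylinder t k) eta * \prod_(i <- s) g i (eta i))%:E =
   (\prod_(i <- t) negbin m (lam i) (k i) * \prod_(i <- s) M i)%:E)%E.
Proof.
move=> us st g0 gM; elim: s us t k st => [_|i s IH /= /andP[iNs us]] t k st.
  rewrite big_nil mulr1 -mu_cylinder.
  transitivity (\int[mu]_eta (\1_(cylinder t k) eta)%:E)%E.
    by apply: eq_integral => eta _; rewrite big_nil mulr1.
  by rewrite integral_indic ?setIT//; exact: measurable_cylinder.
have iNt : i \notin t by rewrite st ?mem_head.
pose f n (eta : Omega) : \bar R := ((g i n)%:E *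
  (\1_(cylinder (i |` t)%fset (fun j => if j == i then n else k j)) eta *
   \prod_(i <- s) g i (eta i))%:E)%E.
have f0 n eta : (0 <= f n eta)%E.
  rewrite /f -EFinM lee_fin !mulr_ge0//.
  by apply: prodr_ge0 => j _; exact: g0.
have mP n : measurable_fun [set: Omega] (fun eta : Omega =>
    (\1_(cylinder (i |` t)%fset (fun j => if j == i then n else k j)) eta *
     \prod_(i <- s) g i (eta i))%:E).
  apply/measurable_EFinP; apply: measurable_funM; last exact: measurable_fun_prod_coordinate.
  by apply: measurable_indic; exact: measurable_cylinder.
have mf n : measurable_fun [set: Omega] (f n).
  by apply: measurable_funeM; exact: mP.
transitivity (\int[mu]_eta (\sum_(n <oo) f n eta))%E.
  apply: eq_integral => eta _.
  rewrite (nneseriesD1 (n := eta i))//.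
  rewrite eseries0 ?adde0; last first.
    move=> n _ /= /eqP nE; rewrite /f cylinder_fsetU1// eq_sym.
    by case: eqP => // _; rewrite !mul0r mule0.
  rewrite /f cylinder_fsetU1// eqxx mul1r big_cons -EFinM.
  by congr EFin; ring.
rewrite integral_nneseries//.
transitivity (\sum_(n <oo) ((\prod_(i <- t) negbin m (lam i) (k i) * \prod_(i <- s) M i)%:E *
   (g i n * negbin m (lam i) n)%:E))%E.
  apply: eq_eseriesr => n _; rewrite /f ge0_integralZl//; last 2 first.
  - by move=> eta _; rewrite lee_fin mulr_ge0//; apply: prodr_ge0 => j _; exact: g0.
  - by rewrite lee_fin.
  rewrite IH//; last first.
    move=> j js; rewrite !inE negb_or st ?inE ?js ?orbT// andbT.
    by apply: contraNneq iNs => <-.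
  rewrite big_fsetU1//= eqxx -!EFinM; congr EFin.
  have -> : \prod_(j <- t) negbin m (lam j) (if j == i then n else k j) =
      \prod_(j <- t) negbin m (lam j) (k j).
    apply: eq_big_seq => j jt; rewrite (_ : j == i = false)//.
    by apply: contraNF iNt => /eqP <-.
  ring.
have neg0 j n : 0 <= negbin m (lam j) n by exact: negbin_ge0.
rewrite nneseriesZl; last by move=> n _; rewrite lee_fin mulr_ge0.
by rewrite gM -EFinM big_cons; congr EFin; ring.
Qed.

Lemma integral_dual xi :
  (\int[mu]_eta (dual m xi eta)%:E =
   (prodf (fun x => lam x / (1 - lam x)) xi)%:E)%E.
Proof.
pose M i := (lam i / (1 - lam i)) ^+ (xi i).
transitivity (\int[mu]_eta (\1_(cylinder fset0 (fun=> 0%N)) eta *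
   \prod_(i <- finsupp xi) dual1 m (xi i) (eta i))%:E)%E.
  apply: eq_integral => eta _; rewrite indicE mem_set ?mul1r//.
rewrite (@integral_cylinder_prod (fun i n => dual1 m (xi i) n) M)//.
- rewrite big_seq_fset0 mul1r /prodf [in RHS]big_mset; congr EFin.
- exact: fset_uniq.
- by move=> i n; exact: dual1_ge0.
- by move=> i; apply: negbin_moment => //; exact: negbin_mass.
Qed.

Lemma measurable_dual xi : measurable_fun [set: Omega] (fun eta : Omega => (dual m xi eta)%:E).
Proof.
apply/measurable_EFinP.
exact: (measurable_fun_prod_coordinate (fun i n => dual1 m (xi i) n)).
Qed.

Lemma dual_ge0 xi (eta : int -> nat) : 0 <= dual m xi eta.
Proof. by apply: prodr_ge0 => i _; exact: dual1_ge0. Qed.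

(** The sum over configurations has to be a series before it can be exchanged with the integral.
    Configurations are numbered through codes of lists, and [code] keeps one number for each, so
    that [decode] is injective there. *)
Let decode (n : nat) : fconf :=
  seq_mset (odflt [::] (choice.unpickle n : option (seq int))).

Let code (n : nat) : bool := choice.pickle (particles (decode n)) == n.

Lemma integral_sip_expect_dual p t xi : is_fsip m p -> 0 <= t ->
  (\int[mu]_eta sip_expect_dual m p t xi eta =
   fsip_expect p t xi (EFin \o prodf (fun x => (lam x / (1 - lam x))%R)))%E.
Proof.
move=> p_sip t0.
have setE : [set: fconf] = decode @` [set n | code n].
  apply/seteqP; split=> // ze _; exists (choice.pickle (particles ze)) => /=.
    by rewrite /code /decode choice.pickleK/= seq_mset_id.
  by rewrite /decode choice.pickleK/= seq_mset_id.
have inj : set_inj [set n | code n] decode.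
  move=> n n' /[!inE] /= /eqP cn /eqP cn' E.
  by rewrite -cn -cn' E.
have esumE (a : fconf -> \bar R) : (forall z, 0 <= a z)%E ->
    (\esum_(z in [set: fconf]) a z = \sum_(n <oo) (if code n then a (decode n) else 0))%E.
  move=> a0; rewrite setE esum_pred_image//; first exact: eseries_mkcond.
have p0 z : (0 <= (p t xi z)%:E)%E by rewrite lee_fin (fsip_ge0 p_sip).
rewrite /sip_expect_dual /fsip_expect.
transitivity (\int[mu]_eta \sum_(n <oo)
   (if code n then (p t xi (decode n))%:E * (dual m (decode n) eta)%:E else 0))%E.
  apply: eq_integral => eta _; apply: esumE => z.
  by rewrite mule_ge0// lee_fin dual_ge0.
rewrite integral_nneseries//; last 2 first.
- move=> n; case: (code n); last exact: measurable_cst.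
  by apply: measurable_funeM; exact: measurable_dual.
- by move=> n eta _; case: ifP => // _; rewrite mule_ge0// lee_fin dual_ge0.
rewrite esumE; last first.
  move=> z; rewrite mule_ge0// lee_fin; apply: prodr_ge0 => x _.
  by have /andP[l0 /ltW l1] := lam01 x; rewrite divr_ge0// subr_ge0.
apply: eq_eseriesr => n _; case: (code n); last by rewrite integral0.
rewrite ge0_integralZl//; last 2 first.
- exact: measurable_dual.
- by move=> eta _; rewrite lee_fin dual_ge0.
by rewrite integral_dual.
Qed.

End ProductIntegral.

(** * The heat equation *)

Section DerivativeTests.
Context {R : realType}.
Implicit Types (f : R -> R) (x e : R).

Lemma derivable_quotient f x e : derivable f x 1 -> 0 < e ->
  exists2 d, 0 < d & forall h, h != 0 -> `|h| < d ->
    `|f^`()%classic x - h^-1 * (f (x + h) - f x)| < e.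
Proof.
move=> dfx e0.
have cv : h^-1 *: ((f \o shift x) (h *: (1 : R)) - f x) @[h --> 0^'] --> 'D_1 f x.
  exact: dfx.
have /cvgr_dist_lt /(_ _ e0) [d /= d0 Hd] := cv.
exists d => // h hn0 hd.
have := Hd h; rewrite /ball/= sub0r normrN hd => /(_ isT hn0).
by rewrite derive1E /= /shift/= /GRing.scale/= mulr1 (addrC h).
Qed.

(** One-sided, because the maximum over a time interval may sit at its right end. *)
Lemma derive1_ge_left_max f x c a : a < x -> derivable f x 1 ->
  (forall y, a <= y <= x -> f y - c * y <= f x - c * x) -> c <= f^`()%classic x.
Proof.
move=> ax dfx fmax; rewrite leNgt; apply/negP => fc.
have [|d d0 Hd] := derivable_quotient dfx (e := c - f^`()%classic x).
  by rewrite subr_gt0.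
pose h := - Num.min (d / 2) (x - a).
have m0 : 0 < Num.min (d / 2) (x - a) by rewrite lt_min subr_gt0 ax divr_gt0.
have h0 : h < 0 by rewrite oppr_lt0.
have hd : `|h| < d.
  rewrite /h normrN gtr0_norm// gt_min; apply/orP; left; lra.
have hn0 : h != 0 by rewrite lt_eqF.
have := Hd h hn0 hd; rewrite ltr_norml => /andP[H _].
have {}H : h^-1 * (f (x + h) - f x) < c by lra.
have : c * h < f (x + h) - f x.
  by rewrite -(ltr_nM2l (_ : h^-1 < 0)) ?invr_lt0// mulrCA mulVf// mulr1.
have : f (x + h) - c * (x + h) <= f x - c * x.
  apply: fmax; apply/andP; split; last by lra.
  have : Num.min (d / 2) (x - a) <= x - a by rewrite ge_min lexx orbT.
  rewrite /h; lra.
lra.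
Qed.

(** The second derivative need not be continuous. If it were positive at x, the first derivative,
    which vanishes at x, would be positive just to the right, and the mean value theorem would
    contradict the maximum. *)
Lemma derive1_derive1_le0_at_max f x r : 0 < r ->
  (forall y, `|y - x| < r -> derivable f y 1) ->
  derivable (f^`()%classic) x 1 ->
  (forall y, `|y - x| < r -> f y <= f x) -> (f^`()^`())%classic x <= 0.
Proof.
move=> r0 df ddf fmax.
have itvE y : y \in `]x - r, x + r[ -> `|y - x| < r.
  by rewrite in_itv/= ltr_norml => /andP[? ?]; apply/andP; split; lra.
have f'0 : f^`()%classic x = 0.
  have xlt : x - r <= x + r by rewrite lerD2l (le_trans _ (ltW r0))// oppr_le0 ltW.
  have xin : x \in `]x - r, x + r[ by rewrite in_itv/= ltrDl r0 gtrDl oppr_lt0 r0.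
  have dfI y : y \in `]x - r, x + r[ -> derivable f y 1 by move/itvE; exact: df.
  have maxI y : y \in `]x - r, x + r[ -> f y <= f x by move/itvE; exact: fmax.
  by have [_ E] := derive1_at_max xlt dfI xin maxI; rewrite derive1E.
rewrite leNgt; apply/negP => s0.
have [d d0 Hd] := derivable_quotient ddf s0.
pose h := Num.min (d / 2) (r / 2).
have h0 : 0 < h by rewrite lt_min !divr_gt0.
have hd : h <= d / 2 by rewrite ge_min lexx.
have hr : h <= r / 2 by rewrite ge_min lexx orbT.
move: h h0 hd hr => h h0 hd hr.
have gpos k : 0 < k -> k <= h -> 0 < f^`()%classic (x + k).
  move=> k0 kh; have kn0 : k != 0 by rewrite gt_eqF.
  have kd : `|k| < d by rewrite gtr0_norm//; lra.
  have := Hd k kn0 kd; rewrite f'0 subr0 ltr_norml => /andP[_ H].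
  by have : 0 < k^-1 * f^`()%classic (x + k) by [lra]; rewrite pmulr_rgt0// invr_gt0.
have xh : x < x + h by rewrite ltrDl.
have der y : y \in `]x, x + h[ -> is_derive y 1 f (f^`()%classic y).
  rewrite in_itv/= => /andP[xy yh].
  rewrite derive1E; apply/derivableP; apply: df.
  by rewrite ltr_norml; apply/andP; split; lra.
have [] := MVT xh der.
  apply: derivable_within_continuous => y; rewrite in_itv/= => /andP[xy yh].
  by apply: df; rewrite ltr_norml; apply/andP; split; lra.
move=> c; rewrite in_itv/= => /andP[xc ch] E.
have : 0 < f^`()%classic c.
  have -> : c = x + (c - x) by ring.
  by apply: gpos; lra.
have : f (x + h) <= f x.
  by apply: fmax; rewrite ltr_norml; apply/andP; split; lra.
move=> fh f'c; have : 0 < f^`()%classic c * (x + h - x) by rewrite mulr_gt0//; lra.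
lra.
Qed.

End DerivativeTests.

Section HeatMaximumPrinciple.
Context {R : realType} (D : R).

Lemma derive1n2 (f : R -> R) y : derive1n 2 f y = (f^`()^`())%classic y.
Proof. by []. Qed.

Lemma heat_solution_lin (u0 v0 : R -> R) (u v : R -> R -> R) (a b : R) :
  heat_solution D u0 u -> heat_solution D v0 v ->
  heat_solution D (fun y => a * u0 y + b * v0 y) (fun t y => a * u t y + b * v t y).
Proof.
move=> hu hv.
have lin_der (f g : R -> R) x : derivable f x 1 -> derivable g x 1 ->
    derivable (fun y => a * f y + b * g y) x 1 /\
    (fun y => a * f y + b * g y)^`()%classic x = a * f^`()%classic x + b * g^`()%classic x.
  move=> df dg.
  have H : is_derive x (1 : R) (a *: f + b *: g) (a *: 'D_1 f x + b *: 'D_1 g x).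
    by apply: is_deriveD; apply: is_deriveZ; exact/derivableP.
  split; first by case: H.
  by rewrite !derive1E; case: H.
split.
- move=> t y t0.
  exact: (lin_der (u ^~ y) (v ^~ y) t (heat_derivable_t hu t0) (heat_derivable_t hv t0)).1.
- move=> t y t0.
  exact: (lin_der (u t) (v t) y (heat_derivable_y hu t0) (heat_derivable_y hv t0)).1.
- move=> t y t0.
  have -> : (fun y => a * u t y + b * v t y)^`()%classic =
      (fun y => a * (u t)^`()%classic y + b * (v t)^`()%classic y).
    apply/funext => z.
    exact: (lin_der (u t) (v t) z (heat_derivable_y hu t0) (heat_derivable_y hv t0)).2.
  exact: (lin_der ((u t)^`()%classic) ((v t)^`()%classic) y (heat_derivable_yy hu t0) (heat_derivable_yy hv t0)).1.
- move=> t y t0.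
  have [_ e1] := lin_der (u ^~ y) (v ^~ y) t (heat_derivable_t hu t0) (heat_derivable_t hv t0).
  have E : (fun y => a * u t y + b * v t y)^`()%classic =
      (fun y => a * (u t)^`()%classic y + b * (v t)^`()%classic y).
    apply/funext => z.
    exact: (lin_der (u t) (v t) z (heat_derivable_y hu t0) (heat_derivable_y hv t0)).2.
  have [_ e2] := lin_der ((u t)^`()%classic) ((v t)^`()%classic) y
    (heat_derivable_yy hu t0) (heat_derivable_yy hv t0).
  rewrite derive1n2 E e2; apply: (eq_trans e1).
  rewrite (heat_eq hu y t0) (heat_eq hv y t0).
  have lin_eq (p q : R) : a * (D * p) + b * (D * q) = D * (a * p + b * q) by ring.
  exact: lin_eq.
- by move=> y; rewrite (heat_init hu) (heat_init hv).
- move=> q; apply: cvgD; (apply: cvgM; first exact: cvg_cst).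
    exact: (heat_continuous hu).
  exact: (heat_continuous hv).
- move=> T; have [C1 [a1 H1]] := heat_growth hu T; have [C2 [a2 H2]] := heat_growth hv T.
  exists (`|a| * `|C1| + `|b| * `|C2|), (`|a1| + `|a2|) => t y tT.
  have K (C c c' : R) : 0 <= c' -> C * expR (c * `|y|) <= `|C| * expR ((`|c| + c') * `|y|).
    move=> c'0; apply: (@le_trans _ _ (`|C| * expR (c * `|y|))).
      by rewrite ler_wpM2r ?expR_ge0 ?ler_norm.
    rewrite ler_wpM2l// ler_expR ler_wpM2r//.
    by have := ler_norm c; lra.
  apply: le_trans (ler_normD _ _) _; rewrite !normrM mulrDl -!mulrA.
  apply: lerD; apply: ler_wpM2l => //.
    by apply: le_trans (H1 _ _ tT) _; exact: K.
  by rewrite addrC; apply: le_trans (H2 _ _ tT) _; exact: K.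
Qed.

Lemma heat_solution_separated (k : R) (f f' : R -> R) :
  (forall y, is_derive y (1 : R) f (f' y)) ->
  (forall y, is_derive y (1 : R) f' (k * f y)) ->
  (exists C a : R, forall y, `|f y| <= C * expR (a * `|y|)) ->
  heat_solution D f (fun t y => expR (D * k * t) * f y).
Proof.
move=> df df' fgrow.
have scale_der (c : R) (g : R -> R) (x d : R) : is_derive x (1 : R) g d ->
    is_derive x (1 : R) (fun y => c * g y) (c * d).
  by move=> dg; exact: is_deriveZ.
have exp_der (c x : R) : is_derive x (1 : R) (fun x : R => expR (c * x)) (c * expR (c * x)).
  have d1 : is_derive x (1 : R) (fun x : R => c * x) c.
    rewrite -[X in is_derive _ _ _ X]mulr1; exact: scale_der.
  by have := is_derive1_comp (is_derive_expR (c * x)) d1; rewrite mulrC.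
have t_der t y : is_derive t (1 : R) (fun t => expR (D * k * t) * f y)
    (D * k * expR (D * k * t) * f y).
  rewrite (_ : (fun t => _) = (fun t => f y * expR (D * k * t))); last first.
    by apply/funext => s; rewrite mulrC.
  by rewrite [X in is_derive _ _ _ X]mulrC; apply: scale_der.
have y1 t : (fun y => expR (D * k * t) * f y)^`()%classic = (fun y => expR (D * k * t) * f' y).
  apply/funext => y; rewrite derive1E.
  by have [] := scale_der (expR (D * k * t)) f y (f' y) (df y).
have y2 t y : is_derive y (1 : R) (fun y => expR (D * k * t) * f' y)
    (expR (D * k * t) * (k * f y)).
  exact: scale_der.
split.
- by move=> t y _; case: (t_der t y).
- by move=> t y _; case: (scale_der (expR (D * k * t)) f y (f' y) (df y)).
- by move=> t y _; rewrite y1; case: (y2 t y).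
- move=> t y _.
  have e2 : derive1n 2 (fun y => expR (D * k * t) * f y) y = expR (D * k * t) * (k * f y).
    apply: (eq_trans (derive1n2 _ _)); rewrite y1 derive1E.
    by have [_ E] := y2 t y; exact: E.
  apply: (@eq_trans _ _ (D * k * expR (D * k * t) * f y)); last first.
    by rewrite e2; move: (expR _) (f y) => e z; ring.
  by rewrite derive1E; have [_ E] := t_der t y; exact: E.
- by move=> y; rewrite mulr0 expR0 mul1r.
- apply: continuous_subspaceT => q.
  apply: cvgM.
    apply: (@continuous_comp _ _ _ fst (fun s => expR (D * k * s))); first exact: cvg_fst.
    apply: differentiable_continuous; apply/derivable1_diffP.
    by case: (exp_der (D * k) q.1).
  apply: (@continuous_comp _ _ _ snd f); first exact: cvg_snd.
  by apply: differentiable_continuous; apply/derivable1_diffP; case: (df q.2).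
- move=> T; have [C [a fCa]] := fgrow.
  exists (expR (`|D * k| * T) * C), a => t y /andP[t0 tT].
  rewrite normrM (ger0_norm (expR_ge0 _)) -[leRHS]mulrA.
  apply: ler_pM; rewrite ?expR_ge0 ?normr_ge0 ?fCa// ler_expR.
  apply: (@le_trans _ _ (`|D * k| * t)); first by rewrite ler_wpM2r// ler_norm.
  by rewrite ler_wpM2l.
Qed.

Lemma is_derive_affine_comp (f : R -> R) (d c e x : R) :
  is_derive (c * x + e) (1 : R) f d -> is_derive x (1 : R) (fun x : R => f (c * x + e)) (c * d).
Proof.
have d1 : is_derive x (1 : R) (fun x : R => c * x + e) c.
  have H : is_derive x (1 : R) (c *: (id : R -> R) + cst e) (c *: 1 + 0).
    by apply: is_deriveD; apply: is_deriveZ.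
  by move: H; rewrite /GRing.scale/= addr0 mulr1.
by move=> df; have := @is_derive1_comp _ f (fun x => c * x + e) x d c df d1; rewrite mulrC.
Qed.

Lemma heat_solution_exp (b : R) :
  heat_solution D (fun y => expR (b * y)) (fun t y => expR (D * b ^+ 2 * t) * expR (b * y)).
Proof.
have der y : is_derive y (1 : R) (fun y => expR (b * y)) (b * expR (b * y)).
  have -> : (fun y => expR (b * y)) = (fun y => expR (b * y + 0)).
    by apply/funext => z; rewrite addr0.
  have -> : expR (b * y) = expR (b * y + 0) by rewrite addr0.
  exact: is_derive_affine_comp.
have der2 y : is_derive y (1 : R) (fun y => b * expR (b * y)) (b ^+ 2 * expR (b * y)).
  by rewrite expr2 -mulrA; exact: is_deriveZ.
apply: (heat_solution_separated der der2).
exists 1, `|b| => y; rewrite mul1r ger0_norm ?expR_ge0// ler_expR -normrM.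
exact: ler_norm.
Qed.

Lemma heat_solution_cos (th ph : R) :
  heat_solution D (fun y => cos (th * y + ph))
    (fun t y => expR (D * (- th ^+ 2) * t) * cos (th * y + ph)).
Proof.
have der1 y : is_derive y (1 : R) (fun y => cos (th * y + ph)) (- th * sin (th * y + ph)).
  by rewrite mulNr -mulrN; exact: is_derive_affine_comp.
have der2 y : is_derive y (1 : R) (fun y => - th * sin (th * y + ph))
    (- th ^+ 2 * cos (th * y + ph)).
  rewrite (_ : _ * cos _ = - th * (th * cos (th * y + ph))); last by ring.
  by apply: is_deriveZ; exact: is_derive_affine_comp.
apply: (heat_solution_separated der1 der2).
by exists 1, 0 => y; rewrite mul0r expR0 mulr1 cos_max.
Qed.

(** Subtracting a small multiple of two exponential solutions that outgrow u confines positive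
    values to a compact box, and subtracting d t makes the inequality strict: at a positive maximum
    the time derivative is at least d while the second space derivative is at most 0. *)
Lemma heat_max_principle (u0 : R -> R) (u : R -> R -> R) : 0 < D ->
  heat_solution D u0 u -> (forall y, u0 y <= 0) -> forall t y, 0 <= t -> u t y <= 0.
Proof.
move=> D0 hu u00 t0 y0 t00; rewrite leNgt; apply/negP => s0; set s := u t0 y0 in s0.
have {t00} t0_gt0 : 0 < t0.
  rewrite lt_neqAle t00 andbT; apply/eqP => t0E.
  by move: s0; rewrite /s -t0E (heat_init hu) ltNge u00.
have [C [a ua]] := heat_growth hu t0.
pose b := `|a| + 1.
pose W t y := expR (D * b ^+ 2 * t) * expR (b * y) +
              expR (D * (- b) ^+ 2 * t) * expR (- b * y).
have W0 t y : 0 < W t y by rewrite addr_gt0// mulr_gt0// expR_gt0.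
(* Barrier and drift are tuned to cost s / 4 each at (t0, y0), which leaves the value s / 2 > 0
   there. *)
pose eta := s / (4 * W t0 y0).
have eta0 : 0 < eta by rewrite divr_gt0// mulr_gt0.
pose v t y := 1 * u t y + (- eta) * (1 * (expR (D * b ^+ 2 * t) * expR (b * y)) +
              1 * (expR (D * (- b) ^+ 2 * t) * expR (- b * y))).
have hv : heat_solution D _ v :=
  heat_solution_lin 1 (- eta) hu (heat_solution_lin 1 1 (heat_solution_exp b) (heat_solution_exp (- b))).
have vE t y : v t y = u t y - eta * W t y by rewrite /v /W !mul1r mulNr.
have etaW : eta * W t0 y0 = s / 4.
  by rewrite /eta; have := W0 t0 y0; move: (W t0 y0) => w w0; field; rewrite gt_eqF.
pose d := s / (4 * t0).
have d0 : 0 < d by rewrite divr_gt0// mulr_gt0.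
have dt0 : d * t0 = s / 4 by rewrite /d; field; rewrite gt_eqF.
(* The first term gives e^|y| >= |C| / eta beyond M, so that the barrier beats the growth bound of
   u; the second puts (t0, y0) inside the box. *)
pose M := `|C| / eta + `|y0| + 1.
have Ceta : 0 <= `|C| / eta by rewrite divr_ge0// ltW.
have M0 : 0 < M by rewrite /M; have := normr_ge0 y0; lra.
have far t y : 0 <= t <= t0 -> M <= `|y| -> v t y <= 0.
  move=> tt My; rewrite vE subr_le0.
  apply: le_trans (ler_norm _) _; apply: le_trans (ua _ _ tt) _.
  apply: (@le_trans _ _ (eta * expR (b * `|y|))); last first.
    rewrite ler_pM2l// /W.
    have e1 c : 1 <= expR (D * c ^+ 2 * t).
      rewrite -expR0 ler_expR; case/andP: tt => tt _.
      by rewrite mulr_ge0// mulr_ge0 ?sqr_ge0// ltW.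
    have wpos c z : 0 <= expR (D * c ^+ 2 * t) * expR z by rewrite mulr_ge0 ?expR_ge0.
    have wge c z : expR z <= expR (D * c ^+ 2 * t) * expR z.
      by rewrite ler_peMl ?expR_ge0.
    have [y_ge0|y_lt0] := leP 0 y.
      by rewrite ger0_norm//; apply: le_trans (wge b _) _; rewrite lerDl.
    rewrite ltr0_norm// mulrN -mulNr.
    by apply: le_trans (wge (- b) _) _; rewrite lerDr.
  apply: (@le_trans _ _ (`|C| * expR (`|a| * `|y|))).
    apply: (@le_trans _ _ (`|C| * expR (a * `|y|))).
      by rewrite ler_wpM2r ?expR_ge0 ?ler_norm.
    by rewrite ler_wpM2l// ler_expR ler_wpM2r// ler_norm.
  rewrite /b mulrDl mul1r expRD mulrCA mulrC ler_wpM2l ?expR_ge0//.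
  have : `|C| / eta <= expR `|y|.
    apply: le_trans (expR_ge1Dx _); move: My; rewrite /M.
    by have := normr_ge0 y0; lra.
  by rewrite ler_pdivrMr// mulrC.
have v_init y : v 0 y <= 0.
  rewrite vE (heat_init hu); have := mulr_gt0 eta0 (W0 0 y); have := u00 y; lra.
pose K := (`[0, t0] `*` `[- M, M] : set (R * R)).
have K0 : K !=set0.
  by exists (0, 0); split; rewrite /= in_itv/=; apply/andP; split; lra.
have Kc : compact K by apply: compact_setX; exact: segment_compact.
have cont : {within K, continuous (fun q : R * R => v q.1 q.2 - d * q.1)}.
  apply: (@continuous_subspaceW _ _ _ [set q : R * R | 0 <= q.1]).
    by move=> [t y] [/=]; rewrite in_itv/= => /andP[].
  move=> q; apply: cvgB; first exact: (heat_continuous hv).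
  apply: cvgM; first exact: cvg_cst.
  have : {within [set q : R * R | 0 <= q.1], continuous (fst : R * R -> R)}.
    by apply: continuous_subspaceT => z; exact: cvg_fst.
  exact.
have [[t1 y1] q1K vmax] := compact_EVT_max K0 Kc cont.
have t0K : (t0, y0) \in K.
  rewrite inE; split; rewrite /= in_itv/=; first by rewrite lexx ltW.
  by rewrite -ler_norml /M; lra.
have {vmax} vmax t y : 0 <= t <= t0 -> `|y| <= M -> v t y - d * t <= v t1 y1 - d * t1.
  move=> tt yM; apply: (vmax (t, y)); rewrite inE; split; rewrite /= in_itv/=//.
  by rewrite -ler_norml.
have [/= t1t y1M] : K (t1, y1) by rewrite inE in q1K.
rewrite in_itv/= in t1t; rewrite in_itv/= -ler_norml in y1M.
have vpos : 0 < v t1 y1 - d * t1.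
  apply: (@lt_le_trans _ _ (v t0 y0 - d * t0)); last first.
    by apply: vmax; rewrite ?lexx ?ltW// /M; lra.
  by rewrite vE etaW dt0 -/s; lra.
have t1_gt0 : 0 < t1.
  case/andP: (t1t) => t1_ge0 _; rewrite lt_neqAle t1_ge0 andbT; apply/eqP => t1E.
  by move: vpos; rewrite -t1E mulr0 subr0 ltNge v_init.
have y1_lt : `|y1| < M.
  rewrite ltNge; apply/negP => /(far _ _ t1t) vle.
  have : 0 <= d * t1 by rewrite mulr_ge0// ltW.
  lra.
have H1 : d <= (v ^~ y1)^`()%classic t1.
  apply: (@derive1_ge_left_max R (v ^~ y1) t1 d 0 t1_gt0 (heat_derivable_t hv t1_gt0)) => t /andP[t_ge0 tt1].
  apply: vmax; last exact: ltW.
  by rewrite t_ge0 (le_trans tt1)//; case/andP: t1t.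
have H2 : ((v t1)^`()^`())%classic y1 <= 0.
  apply: (@derive1_derive1_le0_at_max _ _ _ (M - `|y1|)).
  - by rewrite subr_gt0.
  - by move=> y _; exact: (heat_derivable_y hv t1_gt0).
  - exact: (heat_derivable_yy hv t1_gt0).
  - move=> y yr; have yM : `|y| <= M.
      have -> : y = (y - y1) + y1 by ring.
      by apply: le_trans (ler_normD _ _) _; lra.
    by have := vmax t1 y t1t yM; lra.
have := heat_eq hv y1 t1_gt0; rewrite (derive1n2 (v t1) y1) => E.
have : D * ((v t1)^`()^`())%classic y1 <= 0 by rewrite pmulr_rle0.
by rewrite -E; move: H1 d0 => /=; lra.
Qed.

End HeatMaximumPrinciple.

(** * Comparison of solutions of the heat equation *)

Section HeatComparison.
Context {R : realType} (D : R).

Definition heat_trig (l : seq (R * R * R)) (t y : R) : R :=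
  \sum_(a <- l) expR (- (D * a.1.2 ^+ 2 * t)) * wave a y.

Lemma heat_solution_trig l : heat_solution D (trig l) (heat_trig l).
Proof.
elim: l => [|a l IH].
  have := heat_solution_lin 0 0 (heat_solution_exp D 0) (heat_solution_exp D 0).
  congr heat_solution; apply/funext => y; last (apply/funext => z);
    by rewrite ?/trig ?/heat_trig big_nil !mul0r addr0.
have := heat_solution_lin a.1.1 1 (heat_solution_cos D a.1.2 a.2) IH.
congr heat_solution; apply/funext => y; last (apply/funext => z).
  by rewrite mul1r /trig big_cons.
rewrite mul1r /heat_trig big_cons /wave mulrCA; congr (expR _ * _ + _).
by rewrite mulrN mulNr.
Qed.

Lemma heat_comparison (u0 v0 : R -> R) (u v : R -> R -> R) (e A b : R) : 0 < D ->
  heat_solution D u0 u -> heat_solution D v0 v ->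
  (forall y, `|u0 y - v0 y| <= e + A * (expR (b * y) + expR (- b * y))) ->
  forall t y, 0 <= t ->
    `|u t y - v t y| <= e + A * (expR (D * b ^+ 2 * t) * (expR (b * y) + expR (- b * y))).
Proof.
move=> D0 hu hv uv0 t y t0.
(* Minus the right-hand side is itself a heat solution, the constant e being carried by the
   exponential solution of rate 0. *)
have barrier := heat_solution_lin (- e) (- A) (heat_solution_exp D 0)
  (heat_solution_lin 1 1 (heat_solution_exp D b) (heat_solution_exp D (- b))).
have one_sided (f0 g0 : R -> R) (f g : R -> R -> R) :
    heat_solution D f0 f -> heat_solution D g0 g ->
    (forall y, f0 y - g0 y <= e + A * (expR (b * y) + expR (- b * y))) ->
    f t y - g t y <= e + A * (expR (D * b ^+ 2 * t) * (expR (b * y) + expR (- b * y))).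
  move=> hf hg fg.
  have H := heat_max_principle D0
    (heat_solution_lin 1 1 (heat_solution_lin 1 (-1) hf hg) barrier) _ y t0.
  move: H; rewrite /= !mul1r !mulN1r !mul0r expr0n/= mulr0 !mul0r expR0 mulr1 sqrrN => H.
  suff : f t y - g t y + (- e + - A *
      (expR (D * b ^+ 2 * t) * expR (b * y) + expR (D * b ^+ 2 * t) * expR (- b * y))) <= 0.
    rewrite mulrDr; lra.
  rewrite -[X in X + - A * _]mulr1; apply: H => z.
  rewrite !mul1r !mulN1r mul0r expR0 mulr1.
  by have := fg z; lra.
rewrite ler_norml; apply/andP; split.
  rewrite -lerN2 opprK opprB; apply: (one_sided _ _ _ _ hv hu) => z.
  by apply: le_trans (uv0 z); rewrite distrC ler_norm.
by apply: (one_sided _ _ _ _ hu hv) => z; apply: le_trans (uv0 z); exact: ler_norm.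
Qed.

End HeatComparison.

(** * Approximation of the profile *)

Section TrigonometricApproximation.
Context {R : realType}.
Implicit Types (s x y z : R) (f g rho : R -> R).

Definition is_trig f := exists l, f = trig l.

Lemma is_trig_wave (c th ph : R) : is_trig (fun y => c * cos (th * y + ph)).
Proof. by exists [:: (c, th, ph)]; apply/funext => y; rewrite /trig big_seq1. Qed.

Lemma is_trigD f g : is_trig f -> is_trig g -> is_trig (fun y => f y + g y).
Proof.
by move=> [l1 ->] [l2 ->]; exists (l1 ++ l2); apply/funext => y; rewrite /trig big_cat.
Qed.

Lemma is_trigM f g : is_trig f -> is_trig g -> is_trig (fun y => f y * g y).
Proof.
move=> [l1 ->] [l2 ->]; elim: l1 => [|a l1 [l IH]].
  by exists [::]; apply/funext => y; rewrite /trig !big_nil mul0r.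
suff Ha : is_trig (fun y => wave a y * trig l2 y).
  have [l' E] := is_trigD Ha (ex_intro _ l erefl).
  exists l'; rewrite -E -IH; apply/funext => y.
  by rewrite [in LHS]/trig big_cons mulrDl.
elim: l2 {IH} => [|b l2 IH].
  by exists [::]; apply/funext => y; rewrite /trig !big_nil mulr0.
have Hab : is_trig (fun y => wave a y * wave b y).
  have [l' E] := is_trigD (is_trig_wave (a.1.1 * b.1.1 / 2) (a.1.2 + b.1.2) (a.2 + b.2))
                          (is_trig_wave (a.1.1 * b.1.1 / 2) (a.1.2 - b.1.2) (a.2 - b.2)).
  exists l'; rewrite -E; apply/funext => y; rewrite /wave.
  have -> : (a.1.2 + b.1.2) * y + (a.2 + b.2) = (a.1.2 * y + a.2) + (b.1.2 * y + b.2) by ring.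
  have -> : (a.1.2 - b.1.2) * y + (a.2 - b.2) = (a.1.2 * y + a.2) - (b.1.2 * y + b.2) by ring.
  move: (a.1.2 * y + a.2) (b.1.2 * y + b.2) => p r.
  by rewrite cosD cosB; field.
have [l' E] := is_trigD Hab IH.
by exists l'; rewrite -E; apply/funext => y; rewrite /trig big_cons mulrDr.
Qed.

Lemma is_trig_cst (c : R) : is_trig (fun=> c).
Proof.
have [l E] := is_trig_wave c 0 0.
by exists l; rewrite -E; apply/funext => y; rewrite mul0r addr0 cos0 mulr1.
Qed.

Lemma is_trig_sin (th : R) : is_trig (fun y => sin (th * y)).
Proof.
have [l E] := is_trig_wave 1 th (- (pi / 2)).
by exists l; rewrite -E; apply/funext => y; rewrite mul1r -cosBpihalf.
Qed.

(* The mean of [phi] under the binomial law with parameters [n] and [s], that is,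
   the Bernstein polynomial of [phi (n x)]. *)
Fixpoint bernstein n (phi : nat -> R) s : R :=
  if n is k.+1 then s * bernstein k (phi \o S) s + (1 - s) * bernstein k phi s
  else phi 0%N.

(** Chebyshev's argument: averaging (k - x)^2 over the binomial law gives squared bias plus
    variance. The free x lets the induction shift k by one. *)
Lemma bernstein_error n phi s x (c e q : R) : 0 <= s <= 1 ->
  (forall k, (k <= n)%N -> `|phi k - c| <= e + q * (k%:R - x) ^+ 2) ->
  `|bernstein n phi s - c| <= e + q * ((n%:R * s - x) ^+ 2 + n%:R * (s * (1 - s))).
Proof.
move=> /andP[s0 s1]; elim: n phi x => [|n IH] phi x H /=.
  by apply: le_trans (H 0%N _) _; rewrite // mul0r !sub0r mul0r addr0.
have -> : s * bernstein n (phi \o S) s + (1 - s) * bernstein n phi s - c =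
  s * (bernstein n (phi \o S) s - c) + (1 - s) * (bernstein n phi s - c) by ring.
apply: le_trans (ler_normD _ _) _.
rewrite !normrM (ger0_norm s0) (@ger0_norm _ (1 - s)) ?subr_ge0//.
apply: (@le_trans _ _
  (s * (e + q * ((n%:R * s - (x - 1)) ^+ 2 + n%:R * (s * (1 - s)))) +
   (1 - s) * (e + q * ((n%:R * s - x) ^+ 2 + n%:R * (s * (1 - s)))))).
  apply: lerD; rewrite ler_wpM2l ?subr_ge0//; apply: IH => k kn.
    by apply: le_trans (H _ _) _; rewrite // -natr1 opprB addrA.
  by apply: H; exact: leqW.
by rewrite -natr1 le_eqVlt; apply/orP; left; apply/eqP; ring.
Qed.

Lemma is_trig_bernstein n phi f : is_trig f -> is_trig (fun y => bernstein n phi (f y)).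
Proof.
move=> tf; elim: n phi => [|n IH] phi /=; first exact: is_trig_cst.
apply: is_trigD; apply: is_trigM => //.
apply: is_trigD; first exact: is_trig_cst.
rewrite (_ : (fun y => - f y) = (fun y => -1 * f y)); last first.
  by apply/funext => y; rewrite mulN1r.
exact: is_trigM (is_trig_cst _) tf.
Qed.

Lemma cos_le_cos (a b : R) : 0 <= a -> a <= b -> b <= pi -> cos b <= cos a.
Proof.
move=> a0 ab bpi; rewrite leNgt ltr_cos -?leNgt// in_itv/=; apply/andP; split=> //.
  exact: le_trans a0 ab.
exact: le_trans ab bpi.
Qed.

(** Beyond 1, monotonicity of the cosine keeps the value at 1, and 16 bounds pi^2 because pi <=
    4. *)
Lemma one_sub_cos_ge_pi x : `|x| <= pi -> cos_gap / 16 * x ^+ 2 <= 1 - cos x.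
Proof.
move=> xpi; have c0 : 0 < cos_gap :> R := cos_gap_gt0.
have pi4 : pi <= 4 :> R by have /andP[_] := @pihalf_02 R; lra.
have [x1|x1] := lerP `|x| 1.
  apply: le_trans (one_sub_cos_ge x1); rewrite ler_wpM2r ?sqr_ge0//; lra.
apply: (@le_trans _ _ cos_gap).
  rewrite -mulrA ler_piMr// ?(ltW c0)//.
  rewrite -real_normK ?num_real//.
  have : `|x| ^+ 2 <= 4 ^+ 2 by rewrite lerXn2r// ?nnegrE// (le_trans xpi).
  lra.
have := @one_sub_cos_ge R 1; rewrite normr1 lexx expr1n mulr1 => /(_ isT) H.
apply: le_trans H _; rewrite lerD2l lerN2.
have <- : cos `|x| = cos x.
  by have [|] := ger0P x; rewrite // cosN.
have pi1 : 1 <= pi :> R by have := @pi_ge2 R; lra.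
by apply: cos_le_cos => //; exact: ltW.
Qed.

(** [asin] is only Hölder of exponent 1 / 2 at the ends, hence the fourth power. With half
    difference u >= 0 and half sum v, |v| <= pi / 2 - u gives cos v >= sin u, so sin a - sin b = 2
    sin u cos v >= 1 - cos (a - b). *)
Lemma sin_gap (a b : R) : `|a| <= pi / 2 -> `|b| <= pi / 2 ->
  (a - b) ^+ 4 <= (16 / cos_gap) ^+ 2 * (sin a - sin b) ^+ 2.
Proof.
move=> ha hb.
have c0 : 0 < cos_gap :> R := cos_gap_gt0.
suff H : (a - b) ^+ 2 <= 16 / cos_gap * `|sin a - sin b|.
  rewrite (_ : (a - b) ^+ 4 = ((a - b) ^+ 2) ^+ 2); last by rewrite -exprM.
  rewrite -[X in _ * X]real_normK ?num_real// -exprMn.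
  by rewrite lerXn2r// nnegrE ?sqr_ge0// mulr_ge0// divr_ge0// ltW.
wlog ba : a b ha hb / b <= a => [H|].
  have [/H|/ltW/H] := lerP b a; first exact.
  by rewrite distrC -sqrrN opprB; apply.
move: ha hb; rewrite !ler_norml => /andP[ha1 ha2] /andP[hb1 hb2].
have H : 1 - cos (a - b) <= sin a - sin b.
  pose u := (a - b) / 2; pose v := (a + b) / 2.
  have -> : sin a = sin (v + u) by congr sin; rewrite /u /v; field.
  have -> : sin b = sin (v - u) by congr sin; rewrite /u /v; field.
  rewrite one_sub_cos -/u sinD sinB.
  have u0 : 0 <= u by rewrite /u; lra.
  have upi : u <= pi / 2 by rewrite /u; lra.
  have pi0 := @pi_ge0 R.
  have su : 0 <= sin u by apply: sin_ge0_pi; apply/andP; split; lra.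
  have cv : sin u <= cos v.
    have <- : cos `|v| = cos v by have [|] := ger0P v; rewrite // cosN.
    have vu : `|v| <= pi / 2 - u by rewrite /u /v ler_norml; apply/andP; split; lra.
    have -> : sin u = cos (pi / 2 - u).
      by rewrite cosB cos_pihalf sin_pihalf mul0r add0r mul1r.
    by apply: cos_le_cos => //; lra.
  have := ler_wpM2l su cv; rewrite expr2; move: (sin u) (cos v) => p r; lra.
have H2 := @one_sub_cos_ge_pi (a - b) _.
apply: (@le_trans _ _ (16 / cos_gap * (1 - cos (a - b)))); last first.
  apply: ler_wpM2l; last exact: le_trans H (ler_norm _).
  by rewrite divr_ge0// ltW.
rewrite -ler_pdivrMl; last by rewrite divr_gt0.
rewrite invf_div; apply: H2; rewrite ler_norml; apply/andP; split; lra.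
Qed.

(** The approximant is a Bernstein polynomial in (1 + sin (th y)) / 2. Outside [-K, K] it stays
    close to the value of rho at a point nearer to the origin, and thus inherits the growth bound of
    rho on the whole line, which a plain uniform approximation on [-K, K] would not give. *)
Lemma trig_approx rho (C a K L e : R) : 0 <= C -> 0 <= a -> 0 < K -> 0 < e -> 0 <= L ->
  (forall y, `|rho y| <= C * expR (a * `|y|)) ->
  (forall y z, `|y| <= K -> `|z| <= K -> `|rho y - rho z| <= L * `|y - z|) ->
  exists l, (forall y, `|y| <= K -> `|trig l y - rho y| <= e) /\
            (forall y, `|trig l y| <= C * expR (a * `|y|) + e).
Proof.
move=> C0 a0 K0 e0 L0 rhoC rhoL.
have pi0 := @pi_gt0 R.
have pi2 : 0 < pi / 2 :> R by rewrite divr_gt0.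
pose th := pi / 2 / K.
have th0 : 0 < th by rewrite divr_gt0.
have thK : th * K = pi / 2 by rewrite /th divfK ?gt_eqF.
(* The triangle wave equal to y on [-K, K]: a polynomial in sin (th y) that is
   close to rho on [-K, K] is close to rho (fold y) everywhere. *)
pose fold y := asin (sin (th * y)) / th.
have sin1 y : -1 <= sin y <= 1 by rewrite -ler_norml sin_max.
have asin_le x : -1 <= x <= 1 -> `|asin x| <= pi / 2.
  by move=> hx; rewrite ler_norml asin_geNpi2// asin_lepi2.
have asin_K x : -1 <= x <= 1 -> `|asin x / th| <= K.
  move=> hx; rewrite normrM normfV (gtr0_norm th0) ler_pdivrMr// mulrC thK.
  exact: asin_le.
have foldE y : `|y| <= K -> fold y = y.
  move=> yK; rewrite /fold sinK.
    by rewrite mulrAC divff ?mul1r// gt_eqF.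
  by rewrite in_itv/= -ler_norml normrM (gtr0_norm th0) -thK ler_wpM2l// ltW.
have fold_le y : `|fold y| <= `|y|.
  have [yK|/ltW yK] := lerP `|y| K; first by rewrite foldE.
  by apply: le_trans yK; apply: asin_K.
suff [l Hl] : exists l, forall y, `|trig l y - rho (fold y)| <= e.
  exists l; split=> [y /foldE yE|y]; first by rewrite -[in rho y]yE.
  rewrite -(subrK (rho (fold y)) (trig l y)) addrC.
  apply: le_trans (ler_normD _ _) _; apply: lerD => //.
  apply: le_trans (rhoC _) _; rewrite ler_wpM2l// ler_expR ler_wpM2l//.
(* The constant in rho(u / th) - rho(v / th) = O(e / 2 + Q (sin u - sin v)^2), from X <= E + X^4 /
   E^3 with X the Lipschitz bound and E = e / 2, followed by [sin_gap]. *)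
have [Q QE] : {Q : R | Q = L ^+ 4 / (e / 2) ^+ 3 * (16 / cos_gap) ^+ 2 / th ^+ 4} by eexists.
have Q0 : 0 <= Q.
  rewrite QE; apply: divr_ge0; last by rewrite exprn_ge0// ltW.
  by rewrite mulr_ge0 ?sqr_ge0// divr_ge0// exprn_ge0// divr_ge0// ltW.
pose n := (Num.truncn (2 * Q / e)).+1.
have n0 : (0 : R) < n%:R by rewrite ltr0n.
have nQ : Q / n%:R <= e / 2.
  rewrite ler_pdivrMr//; have : 2 * Q / e <= n%:R by rewrite ltW// truncnS_gt.
  by rewrite ler_pdivrMr//; lra.
pose phi (k : nat) := rho (asin (2 * k%:R / n%:R - 1) / th).
have tf : is_trig (fun y => 2^-1 * (1 + sin (th * y))).
  by apply: is_trigM; [|apply: is_trigD; [|exact: is_trig_sin]]; exact: is_trig_cst.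
have [l lE] := is_trig_bernstein n phi tf.
exists l => y; rewrite -lE.
set s := 2^-1 * _.
have s01 : 0 <= s <= 1.
  by have /andP[] := sin1 (th * y); rewrite /s => ? ?; apply/andP; split; lra.
have sE : sin (th * y) = 2 * s - 1 by rewrite /s; field.
have H := @bernstein_error n phi s (n%:R * s) (rho (fold y)) (e / 2) (4 * Q / n%:R ^+ 2) s01 _.
apply: le_trans (H _) _; last first.
  rewrite subrr expr0n/= add0r.
  have -> : 4 * Q / n%:R ^+ 2 * (n%:R * (s * (1 - s))) = Q / n%:R * (4 * (s * (1 - s))).
    by field; rewrite gt_eqF.
  have : Q / n%:R * (4 * (s * (1 - s))) <= Q / n%:R.
    rewrite ler_piMr ?divr_ge0 ?(ltW n0)//.
    by have := sqr_ge0 (2 * s - 1); rewrite expr2; lra.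
  move: (Q / n%:R) (s * (1 - s)) nQ => ? ?; lra.
move=> k kn; rewrite /phi /fold.
have k01 : -1 <= (2 * k%:R / n%:R - 1 : R) <= 1.
  have r0 : 0 <= (k%:R / n%:R : R) by rewrite divr_ge0// ltW.
  have r1 : (k%:R / n%:R : R) <= 1 by rewrite ler_pdivrMr// mul1r ler_nat.
  by rewrite -mulrA; move: (k%:R / n%:R) r0 r1 => r *; apply/andP; split; lra.
set u := asin _; set v := asin _.
have su : sin u = 2 * k%:R / n%:R - 1 by rewrite /u asinK ?in_itv.
have sv : sin v = 2 * s - 1 by rewrite -sE /v asinK// in_itv/=.
have dE : sin u - sin v = 2 / n%:R * (k%:R - n%:R * s).
  by rewrite su sv; field; rewrite gt_eqF.
have uK : `|u / th| <= K by apply: asin_K.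
have vK : `|v / th| <= K by apply: asin_K.
apply: le_trans (rhoL _ _ uK vK) _.
have [dsmall|dbig] := lerP (L * `|u / th - v / th|) (e / 2).
  by apply: le_trans dsmall _; rewrite lerDl mulr_ge0 ?sqr_ge0// divr_ge0 ?exprn_ge0 ?mulr_ge0// ltW.
(* Raising a difference that exceeds e / 2 to the fourth power makes it comparable with the squared
   difference of sines, the quantity whose binomial mean is known. *)
have big (X E : R) : 0 < E -> E < X -> X <= X ^+ 4 / E ^+ 3.
  move=> E0 EX; rewrite ler_pdivlMr ?exprn_gt0// [leRHS]exprS.
  by rewrite ler_pM2l ?(lt_trans E0)// lerXn2r ?nnegrE ?ltW// (lt_trans E0).
have e20 : 0 < e / 2 by rewrite divr_gt0.
apply: le_trans (big _ _ e20 dbig) _.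
apply: (@le_trans _ _ (4 * Q / n%:R ^+ 2 * (k%:R - n%:R * s) ^+ 2)); last first.
  by rewrite lerDr ltW.
have -> : 4 * Q / n%:R ^+ 2 * (k%:R - n%:R * s) ^+ 2 =
    L ^+ 4 / (e / 2) ^+ 3 / th ^+ 4 * ((16 / cos_gap) ^+ 2 * (sin u - sin v) ^+ 2).
  rewrite dE QE; move: (16 / cos_gap) => w.
  by field; rewrite ?gt_eqF.
have -> : (L * `|u / th - v / th|) ^+ 4 / (e / 2) ^+ 3 =
    L ^+ 4 / (e / 2) ^+ 3 / th ^+ 4 * (u - v) ^+ 4.
  have norm4 (z : R) : `|z| ^+ 4 = z ^+ 4.
    by rewrite (exprM _ 2 2) real_normK ?num_real// -exprM.
  rewrite -mulrBl exprMn norm4 exprMn exprVn.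
  move: (L ^+ 4) ((u - v) ^+ 4) ((th ^+ 4)^-1) (((e / 2) ^+ 3)^-1) => w1 w2 w3 w4; ring.
apply: ler_wpM2l; last by apply: sin_gap; apply: asin_le.
by rewrite !divr_ge0// exprn_ge0// ltW.
Qed.

End TrigonometricApproximation.

(** * Propagation of local equilibrium *)

Section ProductComparison.
Context {R : realType} {T : eqType}.
Implicit Types (s : seq T) (a b A : T -> R).

Lemma prod_diff_le s a b A : (forall x, 1 <= A x) ->
  (forall x, `|a x| <= A x) -> (forall x, `|b x| <= A x) ->
  `|\prod_(x <- s) a x - \prod_(x <- s) b x| <=
    (\sum_(x <- s) `|a x - b x|) * \prod_(x <- s) A x.
Proof.
move=> A1 aA bA; have A0 x : 0 <= A x := le_trans ler01 (A1 x).
have prod_le (c : T -> R) r : (forall x, `|c x| <= A x) ->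
    `|\prod_(x <- r) c x| <= \prod_(x <- r) A x.
  by move=> cA; rewrite normr_prod; apply: ler_prod => x _; rewrite normr_ge0 cA.
elim: s => [|x s IH]; first by rewrite !big_nil subrr normr0 mul0r.
rewrite !big_cons.
have -> : a x * \prod_(y <- s) a y - b x * \prod_(y <- s) b y =
  (a x - b x) * \prod_(y <- s) a y +
  b x * (\prod_(y <- s) a y - \prod_(y <- s) b y) by ring.
apply: le_trans (ler_normD _ _) _; rewrite [leRHS]mulrDl !normrM.
have P0 : 0 <= \prod_(y <- s) A y by apply: prodr_ge0.
apply: lerD.
  rewrite ler_wpM2l//; apply: le_trans (prod_le _ _ aA) _; exact: ler_peMl.
by rewrite mulrCA; apply: ler_pM.
Qed.

Lemma prod_le_max_exp s A : (forall x, 1 <= A x) -> s != [::] ->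
  exists2 x, x \in s & \prod_(y <- s) A y <= A x ^+ size s.
Proof.
move=> A1; have A0 x : 0 <= A x := le_trans ler01 (A1 x).
elim: s => [//|y s IH] _; have [->|sn0] := eqVneq s [::].
  by exists y; rewrite ?mem_head// big_seq1 expr1.
have [x xs Hx] := IH sn0; rewrite big_cons/=.
have [yx|/ltW xy] := lerP (A y) (A x).
  by exists x; rewrite ?in_cons ?xs ?orbT// exprS ler_pM// prodr_ge0.
exists y; rewrite ?mem_head// exprS ler_wpM2l//; apply: le_trans Hx _.
by rewrite lerXn2r ?nnegrE.
Qed.

(** Expectations are under control for one-particle sums only. The product of the majorants is at
    most the n-th power of its largest factor, hence at most a sum of n-th powers, and the resulting
    double sum is decoupled by d B <= d^2 / k + k B^2. *)
Lemma prod_diff_linear s a b A (k : R) : 0 < k -> (forall x, 1 <= A x) ->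
  (forall x, `|a x| <= A x) -> (forall x, `|b x| <= A x) ->
  `|\prod_(x <- s) a x - \prod_(x <- s) b x| <=
    \sum_(x <- s) ((size s)%:R / k * (a x - b x) ^+ 2 +
                   (size s)%:R * k * A x ^+ (2 * size s)).
Proof.
move=> k0 A1 aA bA; have A0 x : 0 <= A x := le_trans ler01 (A1 x).
apply: le_trans (prod_diff_le s A1 aA bA) _.
have [->|sn0] := eqVneq s [::]; first by rewrite !big_nil mul0r.
have [z zs Hz] := prod_le_max_exp A1 sn0.
set n := size s in Hz *.
have {}Hz : \prod_(y <- s) A y <= \sum_(y <- s) A y ^+ n.
  apply: le_trans Hz _; rewrite (big_rem z)//= lerDl sumr_ge0// => x _.
  exact: exprn_ge0.
apply: le_trans (ler_wpM2l _ Hz) _; first exact: sumr_ge0.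
rewrite big_distrlr/=.
apply: (@le_trans _ _ (\sum_(x <- s) \sum_(y <- s)
    ((a x - b x) ^+ 2 / k + k * A y ^+ (2 * n)))).
  apply: ler_sum => x _; apply: ler_sum => y _.
  rewrite mulnC exprM -(real_normK (num_real (a x - b x))).
  have d0 : 0 <= `|a x - b x| by [].
  have B0 : 0 <= A y ^+ n by exact: exprn_ge0.
  move: (`|a x - b x|) (A y ^+ n) d0 B0 => d B d0 B0.
  have : 0 <= (d - k * B) ^+ 2 / k by rewrite divr_ge0 ?sqr_ge0// ltW.
  have -> : (d - k * B) ^+ 2 / k = d ^+ 2 / k + k * B ^+ 2 - 2 * (d * B).
    by field; rewrite gt_eqF.
  have := mulr_ge0 d0 B0; lra.
rewrite le_eqVlt; apply/orP; left; apply/eqP.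
have sumE x : \sum_(y <- s) ((a x - b x) ^+ 2 / k + k * A y ^+ (2 * n)) =
    n%:R * ((a x - b x) ^+ 2 / k) + \sum_(y <- s) k * A y ^+ (2 * n).
  by rewrite big_split/= big_const_seq count_predT iter_addr_0 mulr_natl.
rewrite (eq_bigr _ (fun x _ => sumE x)) !big_split/=.
rewrite [X in _ + X]big_const_seq count_predT iter_addr_0 -/n -[X in _ + X]mulr_natl.
congr (_ + _); first by apply: eq_bigr => x _; rewrite mulrA mulrAC.
by rewrite mulr_sumr; apply: eq_bigr => x _; rewrite mulrA.
Qed.

End ProductComparison.

Definition box (M : nat) : seq int := [seq i%:Z - M%:Z | i <- iota 0 M.*2.+1].

Lemma mem_box M (x : int) : (x \in box M) = (`|x| <= M%:Z).
Proof.
apply/mapP/idP => [[i]|xM]; first by rewrite mem_iota => iM ->; lia.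
by exists (absz (x + M%:Z)); [rewrite mem_iota; lia|lia].
Qed.

Section LocalEquilibrium.
Context {R : realType} (m : R) (p : R -> fconf -> fconf -> R).
Hypothesis m_gt0 : 0 < m.
Hypothesis p_sip : is_fsip m p.

Definition rescale (N : nat) (l : seq (R * R * R)) : seq (R * R * R) :=
  [seq (a.1.1, a.1.2 / N%:R, a.2) | a <- l].

Lemma trig_rescale N l (x : R) : trig (rescale N l) x = trig l (x / N%:R).
Proof.
rewrite /trig big_map; apply: eq_bigr => a _; rewrite /wave/=.
by rewrite mulrAC mulrA.
Qed.

Lemma trig_norm_rescale N l : trig_norm (rescale N l) = trig_norm l.
Proof. by rewrite /trig_norm big_map. Qed.

Lemma trig_lip_rescale N l : trig_lip (rescale N l) = trig_lip l / N%:R.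
Proof.
rewrite /trig_lip big_map mulr_suml; apply: eq_bigr => a _ /=.
by rewrite normrM normfV normr_nat mulrA.
Qed.

(* AM-GM with weight k splits the error of the product into one-particle errors,
   which the density bound at time N^2 t and the exponential moments control. *)
Lemma local_equilibrium_error (t C a k : R) (K N n : nat) l (rhoN : int -> R)
    (rho : R -> R) xi :
  0 < t -> (2 <= N)%N -> sector n xi -> 1 <= C -> 0 <= a -> 0 < k <= 1 ->
  expR (- K%:R) <= k ^+ 2 ->
  (forall x, 0 <= rhoN x <= C * expw a N x) ->
  (forall y, `|y| <= K%:R -> `|trig l y - rho y| <= k) ->
  (forall y, `|trig l y| <= C * expR (a * `|y|) + k) ->
  let S := N%:R^-1 * \sum_(z <- box (K * N)) (rhoN z - rho (z%:~R / N%:R)) ^+ 2 in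
  let b := 2 * n%:R * a + 2 * a + 1 in
  let del := n%:R * site_const m t * (2 * n%:R / k * S) + n%:R * (2 * n%:R * k) +
    k * (4 * n%:R * (C + 1) ^+ 2 + n%:R * (C + 1) ^+ (2 * n)) *
      (expw_const m b t * linf (expw b N) xi) in
  let T := N%:R ^+ 2 * t in
  let err := prod_err m n N (trig_norm l + 1) T (rescale N l) in
  ((prodf (dtrig m (rescale N l) T) xi - del - err)%:E <=
   fsip_expect p T xi (EFin \o prodf rhoN) <=
   (prodf (dtrig m (rescale N l) T) xi + del + err)%:E)%E.
Proof.
move=> t0 N2 nxi; have sz : size (particles xi) = n by apply/eqP; exact: nxi.
move=> C1 a0 /andP[k0 k1] eK rhoNC lrho lC /=.
(* In the exponent b, the part 2 n a serves A^(2 n), the part 2 a serves the square A^2 outside the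
   box, and the extra 1 makes the tail small. *)
set S := N%:R^-1 * _; set b := 2 * n%:R * a + 2 * a + 1; set del := _ + _ * (_ * linf _ _).
set T := N%:R ^+ 2 * t.
have N0 : (0 < N)%N by exact: leq_trans N2.
have N0' : (0 : R) < N%:R by rewrite ltr0n.
have b0 : 0 <= b by rewrite /b !addr_ge0// !mulr_ge0.
have C0 : 0 <= C by exact: le_trans C1.
have expw_ge1 c x : 0 <= c -> 1 <= expw c N x :> R.
  by move=> c0; rewrite -expR0 ler_expR mulr_ge0// divr_ge0// ltW.
have expw_le c d x : c <= d -> expw c N x <= expw d N x :> R.
  by move=> cd; rewrite ler_expR ler_wpM2r// divr_ge0// ltW.
have expwX c j x : expw c N x ^+ j = expw (j%:R * c) N x :> R.
  by rewrite /expw -expRM_natl mulrA.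
pose A x := (C + 1) * expw a N x.
pose h x := n%:R / k * (rhoN x - trig l (x%:~R / N%:R)) ^+ 2 + n%:R * k * A x ^+ (2 * n).
have A1 x : 1 <= A x.
  by rewrite /A -[leLHS]mulr1 ler_pM// ?expw_ge1// lerDr.
have lA x : `|trig l (x%:~R / N%:R)| <= A x.
  apply: le_trans (lC _) _; rewrite /A mulrDl mul1r normrM normfV normr_nat lerD//.
  exact: le_trans (expw_ge1 _ _ a0).
have rA x : `|rhoN x| <= A x.
  have /andP[r0 rC] := rhoNC x; rewrite ger0_norm//; apply: le_trans rC _.
  by rewrite /A mulrDl lerDl mul1r expR_ge0.
have h0 x : 0 <= h x.
  by rewrite addr_ge0// mulr_ge0 ?sqr_ge0 ?divr_ge0 ?mulr_ge0 ?exprn_ge0 ?(ltW k0)// (le_trans _ (A1 x)).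
apply: (@expect_close_trig _ m p m_gt0 p_sip n N _ T del (rescale N l) xi
  (prodf rhoN) (linf h)) => //.
- by rewrite mulr_ge0 ?exprn_ge0// ltW.
- by rewrite lerDr; apply: sumr_ge0.
- by rewrite trig_norm_rescale lerDl.
- by move=> z; apply: prodr_ge0 => x _; case/andP: (rhoNC x).
- by move=> z; apply: sumr_ge0.
- move=> z /eqP zn; rewrite /prodf.
  under [X in _ - X]eq_bigr => x _ do rewrite dtrig0 trig_rescale.
  have := prod_diff_linear (particles z) k0 A1 rA lA.
  by rewrite zn.
(* The factor 2 comes from splitting the squared distance of [rhoN] to the polynomial at the value
   of [rho]. *)
pose g z := 2 * n%:R / k * (rhoN z - rho (z%:~R / N%:R)) ^+ 2.
have gE : N%:R^-1 * \sum_(z <- box (K * N)) g z = 2 * n%:R / k * S.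
  by rewrite /g -mulr_sumr mulrCA.
have Cp j : 0 <= (C + 1) ^+ j by rewrite exprn_ge0// addr_ge0.
have H := @expect_linf_error _ m p m_gt0 p_sip t xi N (box (K * N)) g h (2 * n%:R * k)
  (k * (4 * n%:R * (C + 1) ^+ 2 + n%:R * (C + 1) ^+ (2 * n))) b t0 N0.
rewrite sz gE in H; apply: H => //.
- by move=> z; rewrite mulr_ge0 ?sqr_ge0// divr_ge0 ?mulr_ge0// ltW.
- by rewrite !mulr_ge0// ltW.
- apply: mulr_ge0; first exact: ltW.
  by apply: addr_ge0; (apply: mulr_ge0; last exact: Cp); rewrite ?mulr_ge0.
move=> x.
have E_ge1 : 1 <= expw b N x :> R by exact: expw_ge1.
have gsum0 : 0 <= \sum_(z <- box (K * N)) g z * (x == z)%:R.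
  by apply: sumr_ge0 => z _; rewrite mulr_ge0// mulr_ge0 ?sqr_ge0// divr_ge0 ?mulr_ge0// ltW.
have Apow : n%:R * k * A x ^+ (2 * n) <= k * (n%:R * (C + 1) ^+ (2 * n)) * expw b N x.
  rewrite /A exprMn expwX [n%:R * k]mulrC !mulrA ler_wpM2l//.
    by apply: mulr_ge0; rewrite ?mulr_ge0 ?(ltW k0).
  by apply: expw_le; rewrite /b natrM; lra.
suff quad : n%:R / k * (rhoN x - trig l (x%:~R / N%:R)) ^+ 2 <=
    \sum_(z <- box (K * N)) g z * (x == z)%:R + 2 * n%:R * k +
    k * (4 * n%:R * (C + 1) ^+ 2) * expw b N x.
  rewrite /h [in leRHS]mulrDr [in leRHS]mulrDl; lra.
have cpos : 0 <= k * (4 * n%:R * (C + 1) ^+ 2) * expw b N x.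
  apply: mulr_ge0; last exact: expR_ge0.
  apply: mulr_ge0; first exact: ltW.
  by apply: mulr_ge0; [rewrite mulr_ge0|exact: Cp].
have [xK|xK] := boolP (x \in box (K * N)).
  have : g x <= \sum_(z <- box (K * N)) g z * (x == z)%:R.
    rewrite (big_rem x)//= eqxx mulr1 lerDl; apply: sumr_ge0 => z _.
    by rewrite mulr_ge0// mulr_ge0 ?sqr_ge0// divr_ge0 ?mulr_ge0// ltW.
  suff : n%:R / k * (rhoN x - trig l (x%:~R / N%:R)) ^+ 2 <= g x + 2 * n%:R * k by lra.
  have yK : `|x%:~R / N%:R| <= K%:R :> R.
    rewrite normrM normfV normr_nat ler_pdivrMr// -natrM.
    by move: xK; rewrite mem_box -(ler_int R) intr_norm.
  have := lrho _ yK; rewrite /g; set f := trig l _; set r := rho _ => fr.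
  have : (f - r) ^+ 2 <= k ^+ 2.
    by rewrite -(real_normK (num_real (f - r))) lerXn2r ?nnegrE// ltW.
  have : (rhoN x - f) ^+ 2 <= 2 * (rhoN x - r) ^+ 2 + 2 * (f - r) ^+ 2.
    have := sqr_ge0 ((rhoN x - r) + (f - r)); rewrite !expr2; lra.
  move=> e1 e2; have {}e1 : (rhoN x - f) ^+ 2 <= 2 * (rhoN x - r) ^+ 2 + 2 * k ^+ 2 by lra.
  have nk : 0 <= n%:R / k by rewrite divr_ge0// ltW.
  apply: le_trans (ler_wpM2l nk e1) _; rewrite le_eqVlt; apply/orP; left; apply/eqP.
  by field; rewrite gt_eqF.
(* Outside the box |x| / N >= K, so the unit to spare in b gains e^K >= k^-2, which turns the factor
   1 / k of the quadratic term into k. *)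
have E1 : 1 <= k ^+ 2 * expw 1 N x.
  apply: (@le_trans _ _ (expR (- K%:R) * expw 1 N x)); last first.
    by rewrite ler_wpM2r ?expR_ge0.
  rewrite -expRD -[leLHS]expR0 ler_expR mul1r addrC subr_ge0 ler_pdivlMr// -natrM.
  by move: xK; rewrite mem_box -ltNge -(ltr_int R) intr_norm => /ltW.
have : (rhoN x - trig l (x%:~R / N%:R)) ^+ 2 <= 4 * (C + 1) ^+ 2 * expw (2 * a) N x.
  have -> : 4 * (C + 1) ^+ 2 * expw (2 * a) N x = (2 * A x) ^+ 2.
    by rewrite /A !exprMn expwX; ring.
  rewrite -(real_normK (num_real (rhoN x - _))) lerXn2r ?nnegrE//.
    by apply: mulr_ge0 => //; exact: le_trans ler01 (A1 x).
  by apply: le_trans (ler_normB _ _) _; have := lA x; have := rA x; lra.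
have E2 : expw (2 * a) N x <= k ^+ 2 * expw b N x.
  apply: (@le_trans _ _ (k ^+ 2 * (expw (2 * a) N x * expw 1 N x))).
    by rewrite mulrCA ler_peMr ?expR_ge0.
  rewrite ler_wpM2l ?sqr_ge0//.
  rewrite -expRD -mulrDl; apply: expw_le; rewrite /b.
  have : 0 <= 2 * n%:R * a by rewrite !mulr_ge0.
  lra.
move=> e1; have {}e1 : (rhoN x - trig l (x%:~R / N%:R)) ^+ 2 <=
    4 * (C + 1) ^+ 2 * (k ^+ 2 * expw b N x).
  by apply: le_trans e1 _; rewrite ler_wpM2l// mulr_ge0// sqr_ge0.
have nk : 0 <= n%:R / k by rewrite divr_ge0// ltW.
apply: le_trans (ler_wpM2l nk e1) _.
have -> : n%:R / k * (4 * (C + 1) ^+ 2 * (k ^+ 2 * expw b N x)) =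
  k * (4 * n%:R * (C + 1) ^+ 2) * expw b N x by field; rewrite gt_eqF.
by rewrite lerDr addr_ge0// !mulr_ge0// ltW.
Qed.

End LocalEquilibrium.

(** * Convergence of the lattice evolution to the heat evolution *)

Section ScalingLimits.
Context {R : realType}.

Lemma cvg_inv_nat0 : (N%:R^-1 : R) @[N --> \oo] --> 0.
Proof.
apply/gtr0_cvgV0; last exact: cvgr_idn.
by near=> N; rewrite ltr0n; near: N; exists 1%N.
Unshelve. all: by end_near. Qed.

Lemma floor_dist (x : R) : `|(Num.floor x)%:~R - x| <= 1.
Proof.
have := floor_le x; have := floorD1_gt x; rewrite intrD.
by move=> h1 h2; rewrite ler_norml; apply/andP; split; lra.
Qed.

Lemma floor_scaled_dist (N : nat) (y : R) : (0 < N)%N ->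
  `|(Num.floor (N%:R * y))%:~R / N%:R - y| <= N%:R^-1.
Proof.
move=> N0; have N0' : (0 : R) < N%:R by rewrite ltr0n.
rewrite -[leRHS]mul1r ler_pdivlMr// -[X in _ * X](gtr0_norm N0') -normrM.
by rewrite mulrBl divfK ?gt_eqF// [y * _]mulrC; exact: floor_dist.
Qed.

Lemma expw_floor_le (a : R) (N : nat) (y : R) : 0 <= a -> (0 < N)%N ->
  expw a N (Num.floor (N%:R * y)) <= expR (a * (`|y| + 1)).
Proof.
move=> a0 N0; have N0' : (0 : R) < N%:R by rewrite ltr0n.
rewrite ler_expR ler_wpM2l//.
rewrite -[X in _ / X](gtr0_norm N0') -normfV -normrM.
have -> : (Num.floor (N%:R * y))%:~R / N%:R =
  y + ((Num.floor (N%:R * y))%:~R / N%:R - y) by ring.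
apply: le_trans (ler_normD _ _) _; rewrite lerD2l.
apply: le_trans (floor_scaled_dist _ N0) _.
by rewrite invf_le1// ler1n.
Qed.

Lemma cvg_floor_scaled (y : R) :
  ((Num.floor (N%:R * y))%:~R / N%:R : R) @[N --> \oo] --> y.
Proof.
apply/cvgrPdist_le => e e0.
have /cvgrPdist_le/(_ _ e0) H := cvg_inv_nat0.
near=> N; have N0 : (0 < N)%N by near: N; exists 1%N.
rewrite distrC; apply: le_trans (floor_scaled_dist _ N0) _.
have : `|0 - N%:R^-1 : R| <= e by near: N; exact: H.
by rewrite sub0r normrN ger0_norm.
Unshelve. all: by end_near. Qed.

Lemma sin_sub_le (x : R) : `|sin x - x| <= x ^+ 2.
Proof.
wlog x0 : x / 0 < x => [H|].
  have [x0|/H//|->] := ltgtP x 0; last by rewrite sin0 subrr normr0 expr2 mulr0.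
  have := H (- x); rewrite oppr_gt0 => /(_ x0).
  by rewrite sinN -opprD normrN sqrrN.
have dsin y : y \in `]0, x[ -> is_derive y (1 : R) (sin : R -> R) (cos y).
  by move=> _; exact: is_derive_sin.
have [] := MVT x0 dsin.
  by apply: continuous_subspaceT; exact: continuous_sin.
move=> c; rewrite in_itv/= => /andP[c0 cx]; rewrite sin0 !subr0 => ->.
have -> : cos c * x - x = (cos c - cos 0) * x by rewrite cos0; ring.
rewrite normrM (gtr0_norm x0) expr2 ler_pM2r//.
by apply: le_trans (cos_lip _ _) _; rewrite subr0 gtr0_norm// ltW.
Qed.

Lemma cvg_sin_scaled (c : R) : N%:R * sin (c / N%:R) @[N --> \oo] --> c.
Proof.
apply/cvgrPdist_le => e e0.
have : c ^+ 2 * N%:R^-1 @[N --> \oo] --> c ^+ 2 * 0.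
  by apply: cvgM; [exact: cvg_cst|exact: cvg_inv_nat0].
rewrite mulr0 => /cvgrPdist_le/(_ _ e0) H.
near=> N; have N0 : (0 < N)%N by near: N; exists 1%N.
have N0' : (0 : R) < N%:R by rewrite ltr0n.
have -> : c - N%:R * sin (c / N%:R) = - (N%:R * (sin (c / N%:R) - c / N%:R)).
  by field; rewrite gt_eqF.
rewrite normrN normrM gtr0_norm//.
apply: le_trans (ler_wpM2l (ltW N0') (sin_sub_le _)) _.
have -> : N%:R * (c / N%:R) ^+ 2 = c ^+ 2 * N%:R^-1 by field; rewrite gt_eqF.
have : `|0 - c ^+ 2 * N%:R^-1| <= e by near: N; exact: H.
by rewrite sub0r normrN; apply: le_trans; exact: ler_norm.
Unshelve. all: by end_near. Qed.

(** By 1 - cos x = 2 sin^2 (x / 2) this reduces to N sin (c / N) --> c. *)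
Lemma cvg_damp_rate (m th : R) :
  damp_rate m (th / N%:R) * N%:R ^+ 2 @[N --> \oo] --> m / 2 * th ^+ 2.
Proof.
have -> : m / 2 * th ^+ 2 = 2 * m * (th / 2 * (th / 2)) by field.
have H := @cvg_sin_scaled (th / 2).
have : 2 * m * ((N%:R * sin (th / 2 / N%:R)) * (N%:R * sin (th / 2 / N%:R)))
    @[N --> \oo] --> 2 * m * (th / 2 * (th / 2)).
  by apply: cvgM; [exact: cvg_cst|exact: cvgM].
apply: cvg_trans; apply: near_eq_cvg; near=> N.
rewrite /damp_rate one_sub_cos [th / N%:R / 2]mulrAC.
by move: (sin _) => s; ring.
Unshelve. all: by end_near. Qed.

Lemma cvg_dtrig_rescale (m t : R) l (y : R) :
  dtrig m (rescale N l) (N%:R ^+ 2 * t) (Num.floor (N%:R * y)) @[N --> \oo]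
    --> heat_trig (m / 2) l t y.
Proof.
rewrite (_ : (fun N : nat => _) = (fun N : nat => \sum_(a <- l)
   expR (- (damp_rate m (a.1.2 / N%:R) * N%:R ^+ 2 * t)) *
   (a.1.1 * cos (a.1.2 * ((Num.floor (N%:R * y))%:~R / N%:R) + a.2)))); last first.
  apply/funext => N; rewrite dtrigE big_map; apply: eq_bigr => a _ /=.
  by rewrite /wave/= !mulrA [a.1.2 / _ * _]mulrAC.
apply: cvg_big => [|a _]; first exact: add_continuous.
have expH : - (damp_rate m (a.1.2 / N%:R) * N%:R ^+ 2 * t) @[N --> \oo] -->
    - (m / 2 * a.1.2 ^+ 2 * t).
  by apply: cvgN; apply: cvgM; [exact: cvg_damp_rate|exact: cvg_cst].
have cosH : a.1.2 * ((Num.floor (N%:R * y))%:~R / N%:R) + a.2 @[N --> \oo] -->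
    a.1.2 * y + a.2.
  apply: cvgD; last exact: cvg_cst.
  by apply: cvgM; [exact: cvg_cst|exact: cvg_floor_scaled].
apply: cvgM; first exact: (cvg_comp _ _ expH (@continuous_expR R _)).
by apply: cvgM; [exact: cvg_cst|exact: (cvg_comp _ _ cosH (@continuous_cos R _))].
Qed.

End ScalingLimits.

(** * Mean-square convergence of the densities *)

Section SiteError.
Context {R : realType}.

Lemma box_uniq M : uniq (box M).
Proof. by rewrite map_inj_uniq ?iota_uniq// => i j; lia. Qed.

Lemma sum_pick_le (s : seq int) (g : int -> R) x : uniq s -> (forall z, 0 <= g z) ->
  \sum_(z <- s) g z * (z == x)%:R <= g x.
Proof.
move=> us g0; have [xs|xs] := boolP (x \in s).
  rewrite (bigD1_seq x)//= eqxx mulr1 big1 ?addr0// => z /negbTE ->.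
  by rewrite mulr0.
rewrite big_seq big1// => z zs; case: eqP => [zx|_]; last by rewrite mulr0.
by rewrite -zx zs in xs.
Qed.

Definition cell (N : nat) (z : int) : set R :=
  [set` `[z%:~R / N%:R, (z + 1)%:~R / N%:R[].

(** The cells of the sites with |z| <= K N reach up to K + 1 / N, hence the right end K + 1. *)
Definition window (K : nat) : set R := [set` `[- K%:R, K%:R + 1]].

Lemma measurable_cell N z : measurable (cell N z).
Proof. exact: measurable_itv. Qed.

Lemma measurable_window K : measurable (window K).
Proof. exact: measurable_itv. Qed.

Lemma measurable_fun_cell (D : set R) N z : measurable_fun D (\1_(cell N z) : R -> R).
Proof. exact: measurable_indic (measurable_cell N z). Qed.

Lemma cell_indic (N : nat) (z : int) (y : R) : (0 < N)%N ->
  \1_(cell N z) y = (z == Num.floor (N%:R * y))%:R :> R.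
Proof.
move=> N0; have N0' : (0 : R) < N%:R by rewrite ltr0n.
rewrite indicE; congr (nat_of_bool _)%:R.
have -> : (y \in cell N z) = (z%:~R / N%:R <= y < (z + 1)%:~R / N%:R).
  by apply/idP/idP; rewrite inE /cell/= in_itv.
rewrite ler_pdivrMr// ltr_pdivlMr// [y * _]mulrC eq_sym.
apply/idP/eqP => [/floor_def //|<-].
by rewrite floor_le floorD1_gt.
Qed.

Lemma integral_cells (K N : nat) (g : int -> R) : (0 < N)%N -> (forall z, 0 <= g z) ->
  (\int[lebesgue_measure]_(y in window K)
     (\sum_(z <- box (K * N)) g z * \1_(cell N z) y)%R%:E =
   (N%:R^-1 * \sum_(z <- box (K * N)) g z)%:E)%E.
Proof.
move=> N0 g0; have N0' : (0 : R) < N%:R by rewrite ltr0n.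
have mW := measurable_window K.
under eq_integral => y _ do rewrite -sumEFin.
rewrite ge0_integral_sum//=; last first.
- by move=> z y _; rewrite lee_fin mulr_ge0.
- move=> z; apply/measurable_EFinP; apply: measurable_funM => //.
  exact: measurable_fun_cell.
rewrite mulr_sumr -sumEFin; apply: eq_big_seq => z; rewrite mem_box => zK.
under eq_integral => y _ do rewrite EFinM.
rewrite ge0_integralZl_EFin//=; last by apply/measurable_EFinP; exact: measurable_fun_cell.
rewrite (integral_indic (@lebesgue_measure R) mW (measurable_cell N z)) setIidl; last first.
  move=> y; rewrite /cell /window/= !in_itv/= => /andP[zy yz].
  have zK' : `|z%:~R| <= K%:R * N%:R :> R by rewrite -intr_norm -natrM (ler_int R _ (K * N)%N).
  move: zK'; rewrite ler_norml => /andP[z1 z2]; apply/andP; split.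
    by apply: le_trans zy; rewrite ler_pdivlMr// mulNr.
  apply: le_trans (ltW yz) _; rewrite ler_pdivrMr// mulrDl mul1r intrD lerD//.
  by rewrite ler1n.
have mc : lebesgue_measure (cell N z) = (N%:R^-1)%:E.
  apply: (eq_trans (lebesgue_measure_itv _)).
  rewrite /= lte_fin ltr_pM2r ?invr_gt0// ltr_int ltrDl ltr01 -EFinB; congr EFin.
  by rewrite -mulrBl intrD addrAC subrr add0r mul1r.
by apply: (@eq_trans _ _ ((g z)%:E * (N%:R^-1)%:E)%E); [congr mule|rewrite -EFinM mulrC].
Qed.

(** Convergence is known at floor (N y) for fixed y, not along arbitrary sites. Written as the
    integral of a step function of y, the average over sites falls under dominated convergence, with
    a constant majorant from the growth bounds. *)
Lemma cvg_site_error (r : nat -> int -> R) (rho : R -> R) (C a : R) (K : nat) :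
  0 <= C -> 0 <= a ->
  (\forall N \near \oo, forall x, 0 <= r N x <= C * expw a N x) ->
  (forall y, `|rho y| <= C * expR (a * `|y|)) -> continuous rho ->
  (forall y, r N (Num.floor (N%:R * y)) @[N --> \oo] --> rho y) ->
  N%:R^-1 * \sum_(z <- box (K * N)) (r N z - rho (z%:~R / N%:R)) ^+ 2 @[N --> \oo] --> 0.
Proof.
move=> C0 a0 [N0 _ rC] rhoC crho cvr.
(* The bounds on r hold for large N only, while the convergence theorem wants a majorant for every
   index; the early terms are set to 0. *)
pose G N z : R := if (N0.+1 <= N)%N then (r N z - rho (z%:~R / N%:R)) ^+ 2 else 0.
have G0 N z : 0 <= G N z by rewrite /G; case: ifP => // _; exact: sqr_ge0.
pose D : set R := window K.
pose F N (y : R) : \bar R := (\sum_(z <- box (K * N)) G N z * \1_(cell N z) y)%:E.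
(* On the window |y| <= K + 1, and rounding to the lattice moves y by at most 1; the factor 2
   accounts for r and rho. *)
pose M : R := 2 * (C * expR (a * (K%:R + 2))).
have Fle N y : (N0.+1 <= N)%N -> (F N y <= (G N (Num.floor (N%:R * y)))%:E)%E.
  move=> NN; rewrite lee_fin.
  under eq_bigr do rewrite cell_indic ?(leq_trans _ NN)//.
  exact: sum_pick_le (box_uniq _) (G0 N).
have F0 N y : (0 <= F N y)%E.
  by rewrite lee_fin sumr_ge0// => z _; rewrite mulr_ge0.
have Fsmall N y : (N < N0.+1)%N -> F N y = 0%E.
  move=> NN; rewrite /F big1// => z _.
  by rewrite /G leqNgt NN mul0r.
have mF N : measurable_fun D (F N).
  apply/measurable_EFinP; apply: measurable_sum => z.
  apply: measurable_funM => //; exact: measurable_fun_cell.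
have GM N y : D y -> G N (Num.floor (N%:R * y)) <= M ^+ 2.
  rewrite /D /window/= in_itv/= => /andP[yK1 yK2].
  have yK : `|y| <= K%:R + 1 by rewrite ler_norml; apply/andP; split; lra.
  rewrite /G; case: ifP => [NN|_]; last exact: sqr_ge0.
  have N1 : (0 < N)%N by exact: leq_trans NN.
  set z := Num.floor _.
  have b1 : C * expw a N z <= C * expR (a * (K%:R + 2)).
    rewrite ler_wpM2l//; apply: le_trans (expw_floor_le _ a0 N1) _.
    by rewrite ler_expR ler_wpM2l//; lra.
  have rN : `|r N z| <= C * expR (a * (K%:R + 2)).
    have /andP[r0 r1] := rC N (ltnW NN) z.
    by rewrite ger0_norm//; exact: le_trans r1 b1.
  have rr : `|rho (z%:~R / N%:R)| <= C * expR (a * (K%:R + 2)).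
    apply: le_trans (rhoC _) _; apply: le_trans b1.
    by rewrite normrM normfV normr_nat.
  rewrite -(real_normK (num_real (r N z - _))) lerXn2r ?nnegrE ?mulr_ge0 ?expR_ge0//.
  by apply: le_trans (ler_normB _ _) _; rewrite /M; lra.
have cvF y : D y -> F N y @[N --> \oo] --> 0%E.
  move=> Dy; have cG : (r N (Num.floor (N%:R * y)) -
      rho ((Num.floor (N%:R * y))%:~R / N%:R)) ^+ 2 @[N --> \oo] --> 0.
    have -> : 0 = (rho y - rho y) * (rho y - rho y) by rewrite subrr mulr0.
    have cd : r N (Num.floor (N%:R * y)) - rho ((Num.floor (N%:R * y))%:~R / N%:R)
        @[N --> \oo] --> rho y - rho y.
      apply: cvgB; first exact: cvr.
      exact: (cvg_comp _ _ (@cvg_floor_scaled R y) (crho y)).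
    exact: (cvgM cd cd).
  have cGe : ((r N (Num.floor (N%:R * y)) -
      rho ((Num.floor (N%:R * y))%:~R / N%:R)) ^+ 2)%:E @[N --> \oo] --> 0%E.
    by apply: cvg_EFin => //; near=> N.
  apply: (squeeze_cvge _ (cvg_cst 0%E) cGe); near=> N.
  have NN : (N0.+1 <= N)%N by near: N; exists N0.+1.
  rewrite F0/=; apply: le_trans (Fle N y NN) _.
  by rewrite /G NN.
have mD : measurable D by exact: measurable_window.
have iM : lebesgue_measure.-integrable D (cst (M ^+ 2)%:E : R -> \bar R).
  apply: (measurable_bounded_integrable (f := cst (M ^+ 2))) => //.
    apply: (@le_lt_trans _ _ (if ((- K%:R)%:E < (K%:R + 1)%:E)%E
      then (K%:R + 1)%:E - (- K%:R)%:E else 0)%E).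
      by rewrite le_eqVlt; apply/orP; left; apply/eqP; exact: lebesgue_measure_itv.
    by case: ifP => _; rewrite -?EFinB ltry.
  exact: bounded_cst.
have dom N y : D y -> (`|F N y| <= (M ^+ 2)%:E)%E.
  move=> Dy; rewrite gee0_abs//; have [NN|NN] := ltnP N N0.+1.
    by rewrite Fsmall// lee_fin sqr_ge0.
  by apply: le_trans (Fle N y NN) _; rewrite lee_fin GM.
have ae1 := aeW (@lebesgue_measure R) cvF.
have ae2 := aeW (@lebesgue_measure R) (fun y N => @dom N y).
have [_ _ cvI] := @dominated_convergence _ _ R (@lebesgue_measure R) D mD F
  (cst 0%E) (cst (M ^+ 2)%:E) mF (measurable_cst _) ae1 iM ae2.
have {}cvI : N%:R^-1 * \sum_(z <- box (K * N)) G N z @[N --> \oo] --> 0.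
  apply: (@fine_cvg _ _ _ _ (fun N : nat => (N%:R^-1 * \sum_(z <- box (K * N)) G N z)%:E)).
  rewrite integral0 in cvI; apply: cvg_trans cvI; apply: near_eq_cvg; near=> N.
  have N1 : (0 < N)%N by near: N; exists 1%N.
  exact: integral_cells.
apply: cvg_trans cvI; apply: near_eq_cvg; near=> N.
have NN : (N0.+1 <= N)%N by near: N; exists N0.+1.
by rewrite /G NN.
Unshelve. all: by end_near. Qed.

End SiteError.

Section SumDelta.
Context {R : realType}.

Lemma particles_sum_delta n (x : 'I_n -> int) :
  perm_eq (particles (sum_delta x)) [seq x i | i <- enum 'I_n].
Proof. exact: perm_eq_seq_mset. Qed.

Lemma sector_sum_delta n (x : 'I_n -> int) : sector n (sum_delta x).
Proof. by rewrite /sector (perm_size (particles_sum_delta x)) size_map size_enum_ord. Qed.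

Lemma linf_sum_delta n (x : 'I_n -> int) (g : int -> R) :
  linf g (sum_delta x) = \sum_(i < n) g (x i).
Proof. by rewrite /linf (perm_big _ (particles_sum_delta x)) big_map big_enum. Qed.

Lemma prodf_sum_delta n (x : 'I_n -> int) (v : int -> R) :
  prodf v (sum_delta x) = \prod_(i < n) v (x i).
Proof. by rewrite /prodf (perm_big _ (particles_sum_delta x)) big_map big_enum. Qed.

End SumDelta.

(** * Regularity of the initial datum *)

Section Lipschitz.
Context {R : realType}.

Lemma derivable_continuous (f : R -> R) : (forall y, derivable f y 1) -> continuous f.
Proof.
by move=> df y; apply: differentiable_continuous; apply/derivable1_diffP; exact: df.
Qed.

Lemma segment_bound (f : R -> R) (K : R) : 0 <= K -> continuous f ->
  exists2 M, 0 <= M & forall y, `|y| <= K -> `|f y| <= M.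
Proof.
move=> K0 cf; have KK : - K <= K by lra.
have cn : {within `[- K, K], continuous (fun y => `|f y|)}.
  apply: continuous_subspaceT => y.
  by apply: (cvg_comp _ _ (cf y)); exact: norm_continuous.
have [c cK Hc] := EVT_max KK cn.
by exists `|f c| => // y yK; apply: Hc; rewrite in_itv/= -ler_norml.
Qed.

Lemma lipschitz_on_segment (f : R -> R) (K : R) : 0 <= K ->
  (forall y, derivable f y 1) -> (forall y, derivable f^`()%classic y 1) ->
  exists2 L, 0 <= L & forall y z, `|y| <= K -> `|z| <= K -> `|f y - f z| <= L * `|y - z|.
Proof.
move=> K0 df ddf.
have [L L0 HL] := segment_bound K0 (derivable_continuous ddf).
exists L => // y z; wlog zy : y z / z < y => [H|].
  have [yz|zy|->] := ltgtP y z; [|exact: H|by rewrite !subrr normr0 mulr0].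
  by move=> yK zK; rewrite distrC (distrC y); exact: H.
rewrite !ler_norml => /andP[y1 y2] /andP[z1 z2].
have dfI x : x \in `]z, y[ -> is_derive x (1 : R) f (f^`()%classic x).
  by move=> _; rewrite derive1E; apply/derivableP; exact: df.
have [] := MVT zy dfI.
  by apply: continuous_subspaceT; exact: derivable_continuous.
move=> c; rewrite in_itv/= => /andP[zc cy] ->.
rewrite -ler_norml normrM ler_wpM2r//; apply: HL.
by rewrite ler_norml; apply/andP; split; lra.
Qed.

Variable f : R -> R.
Hypothesis f_lt1 : forall y, f y < 1.
Hypothesis df : forall y, derivable f y 1.
Hypothesis ddf : forall y, derivable f^`()%classic y 1.

Lemma continuous_odds : continuous (fun y => f y / (1 - f y)).
Proof.
move=> y; have cf := derivable_continuous df.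
apply: cvgM; first exact: cf.
apply: cvgV; first by rewrite subr_eq0 gt_eqF.
by apply: cvgB; [exact: cvg_cst|exact: cf].
Qed.

Lemma lipschitz_odds (K : R) : 0 <= K ->
  exists2 L, 0 <= L & forall y z, `|y| <= K -> `|z| <= K ->
    `|f y / (1 - f y) - f z / (1 - f z)| <= L * `|y - z|.
Proof.
move=> K0; have [L L0 HL] := lipschitz_on_segment K0 df ddf.
have cV : continuous (fun y => (1 - f y)^-1).
  move=> y; apply: cvgV; first by rewrite subr_eq0 gt_eqF.
  by apply: cvgB; [exact: cvg_cst|exact: derivable_continuous].
have [M M0 HM] := segment_bound K0 cV.
exists (M * M * L); first by rewrite !mulr_ge0.
move=> y z yK zK.
have -> : f y / (1 - f y) - f z / (1 - f z) =
    (1 - f y)^-1 * (1 - f z)^-1 * (f y - f z).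
  by field; rewrite !subr_eq0 !gt_eqF.
rewrite !normrM -!mulrA; apply: ler_pM => //; first exact: HM.
by apply: ler_pM => //; [exact: HM|exact: HL].
Qed.

End Lipschitz.

(** * Passage to the limit *)

Section Propagation.
Context {R : realType} (m : R) (p : R -> fconf -> fconf -> R).
Hypothesis m_gt0 : 0 < m.
Hypothesis p_sip : is_fsip m p.
Variables (rho : R -> R) (r : nat -> int -> R) (psi : R -> R -> R) (C a : R).
Hypothesis C1 : 1 <= C.
Hypothesis a0 : 0 <= a.
Hypothesis rC : \forall N \near \oo, forall x, 0 <= r N x <= C * expw a N x.
Hypothesis rhoC : forall y, `|rho y| <= C * expR (a * `|y|).
Hypothesis rho_lip : forall K, 0 <= K -> exists2 L, 0 <= L &
  forall y z, `|y| <= K -> `|z| <= K -> `|rho y - rho z| <= L * `|y - z|.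
Hypothesis rho_continuous : continuous rho.
Hypothesis r_rho : forall y, r N (Num.floor (N%:R * y)) @[N --> \oo] --> rho y.
Hypothesis psi_heat : heat_solution (m / 2) rho psi.

Let C0 : 0 <= C := le_trans ler01 C1.

(** The heat evolution of 1 + 2 C (e^((a+1) y) + e^(-(a+1) y)). The exponent exceeds the growth rate
    of rho by 1, so that k times this datum dominates the approximation error beyond K as well. *)
Definition heat_barrier (t y : R) : R :=
  1 + 2 * C * (expR (m / 2 * (a + 1) ^+ 2 * t) *
    (expR ((a + 1) * y) + expR (- (a + 1) * y))).

Lemma trig_profile (t k : R) : 0 <= t -> 0 < k <= 1 -> exists (K : nat) l,
  [/\ expR (- K%:R) <= k ^+ 2,
      forall y, `|y| <= K%:R -> `|trig l y - rho y| <= k,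
      forall y, `|trig l y| <= C * expR (a * `|y|) + k &
      forall y, `|heat_trig (m / 2) l t y - psi t y| <= k * heat_barrier t y].
Proof.
move=> t0 /andP[k0 k1].
(* With K >= k^-2, e^K >= 1 + K >= k^-2. *)
pose K := (Num.truncn (k ^- 2)).+1.
have K0 : (0 : R) < K%:R by rewrite ltr0n.
have kk : 0 < k ^+ 2 by rewrite exprn_gt0.
have eK : expR (- K%:R) <= k ^+ 2.
  rewrite expRN -[leRHS]invrK lef_pV2 ?posrE ?invr_gt0 ?expR_gt0//.
  apply: le_trans (expR_ge1Dx _); apply: (@le_trans _ _ K%:R); last by rewrite lerDr.
  by rewrite ltW// truncnS_gt.
have [L L0 HL] := rho_lip (ltW K0).
have [l [lK lC]] := trig_approx C0 a0 K0 k0 L0 rhoC HL.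
exists K, l; split=> // y.
have D0 : 0 < m / 2 by rewrite divr_gt0.
have -> : k * heat_barrier t y = k + (2 * C * k) *
    (expR (m / 2 * (a + 1) ^+ 2 * t) * (expR ((a + 1) * y) + expR (- (a + 1) * y))).
  by rewrite /heat_barrier mulrDr mulr1; congr (_ + _); ring.
apply: (heat_comparison D0 (heat_solution_trig (m / 2) l) psi_heat) => // {}y.
have bar0 : 0 <= 2 * C * k * (expR ((a + 1) * y) + expR (- (a + 1) * y)).
  by rewrite mulr_ge0 ?addr_ge0 ?expR_ge0// !mulr_ge0// ltW.
have [yK|Ky] := lerP `|y| K%:R; first by have := lK _ yK; lra.
apply: le_trans (ler_normB _ _) _.
have fy := lC y; have ry := rhoC y.
(* Beyond K both functions are of size C e^(a |y|), up to k; what remains is e^(- |y|) <= e^(- K) <=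
   k. *)
suff : C * expR (a * `|y|) <= C * k * (expR ((a + 1) * y) + expR (- (a + 1) * y)) by lra.
rewrite -mulrA ler_wpM2l//.
apply: (@le_trans _ _ (k * expR ((a + 1) * `|y|))); last first.
  rewrite ler_wpM2l ?(ltW k0)//.
  have [y0|y0] := ger0P y; first by rewrite lerDl expR_ge0.
  by rewrite mulrN -mulNr lerDr expR_ge0.
have -> : expR (a * `|y|) = expR (- `|y|) * expR ((a + 1) * `|y|).
  by rewrite -expRD; congr expR; ring.
rewrite ler_wpM2r ?expR_ge0//; apply: (@le_trans _ _ (expR (- K%:R))).
  by rewrite ler_expR lerN2 ltW.
apply: le_trans eK _; rewrite expr2 ler_piMl// ltW//.
Qed.

(** Rescaling divides the Lipschitz constant by N, and N^-2 (N / m + N^2 t / N) = (1 / m + t) /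
    N. *)
Lemma cvg_prod_err (t A : R) n l :
  prod_err m n N A (N%:R ^+ 2 * t) (rescale N l) @[N --> \oo] --> 0.
Proof.
have -> : 0 = trig_lip l ^+ 2 * A ^+ n * n%:R ^+ 2 * (m^-1 + t) * 0 by rewrite mulr0.
have : trig_lip l ^+ 2 * A ^+ n * n%:R ^+ 2 * (m^-1 + t) * N%:R^-1 @[N --> \oo]
    --> trig_lip l ^+ 2 * A ^+ n * n%:R ^+ 2 * (m^-1 + t) * 0.
  by apply: cvgM; [exact: cvg_cst|exact: cvg_inv_nat0].
apply: cvg_trans; apply: near_eq_cvg; near=> N.
have N0 : (0 < N)%N by near: N; exists 1%N.
rewrite /prod_err trig_lip_rescale.
have Nn0 : (N%:R : R) != 0 by rewrite gt_eqF// ltr0n.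
have mn0 : m != 0 by rewrite gt_eqF.
move: (trig_lip l) (A ^+ n) (n%:R ^+ 2) (N%:R : R) Nn0 => L P q M Mn0.
by field; rewrite ?Mn0 ?mn0.
Unshelve. all: by end_near. Qed.

(** The constant Q precedes k, whereas the polynomial and the compact depend on k; N goes to
    infinity last, with k fixed. *)
Lemma propagation (t : R) n (y : 'I_n -> R) : 0 < t -> exists2 Q, 0 <= Q &
  forall k, 0 < k <= 1 -> \forall N \near \oo,
    ((\prod_(i < n) psi t (y i) - k * Q)%:E <=
     fsip_expect p (N%:R ^+ 2 * t) (sum_delta (fun i => Num.floor (N%:R * y i)))
       (EFin \o prodf (r N)) <=
     (\prod_(i < n) psi t (y i) + k * Q)%:E)%E.
Proof.
move=> t0.
pose b := 2 * n%:R * a + 2 * a + 1.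
pose B := \sum_(i < n) expR (b * (`|y i| + 1)).
pose c := 4 * n%:R * (C + 1) ^+ 2 + n%:R * (C + 1) ^+ (2 * n).
pose Q1 := n%:R * (2 * n%:R) + c * (expw_const m b t * B).
pose A i := 1 + `|psi t (y i)| + heat_barrier t (y i).
pose Q2 := (\sum_(i < n) heat_barrier t (y i)) * \prod_(i < n) A i.
have b0 : 0 <= b by rewrite /b !addr_ge0// !mulr_ge0.
have c0 : 0 <= c.
  by rewrite /c; apply: addr_ge0; (apply: mulr_ge0; last by rewrite exprn_ge0// addr_ge0);
    rewrite ?mulr_ge0.
have ew0 : 0 <= expw_const m b t by rewrite mulr_ge0// expR_ge0.
have B0 : 0 <= B by apply: sumr_ge0 => i _; exact: expR_ge0.
have bar0 z : 0 <= heat_barrier t z.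
  by rewrite addr_ge0// mulr_ge0 ?mulr_ge0 ?addr_ge0 ?expR_ge0.
have A1 i : 1 <= A i by rewrite /A -addrA lerDl addr_ge0.
have Q20 : 0 <= Q2.
  by rewrite mulr_ge0 ?sumr_ge0 ?prodr_ge0// => i _; exact: le_trans ler01 (A1 i).
have Q10 : 0 <= Q1 by rewrite addr_ge0// ?mulr_ge0// mulr_ge0.
(* [Q1] collects the uniform and exponential errors and [Q2] the distance from the evolved
   polynomial to psi. The 3 stands for quantities that vanish as N grows and are eventually at most
   k: the site error, the interaction error and the gap between lattice and heat evolutions. *)
exists (Q1 + 3 + Q2); first by rewrite addr_ge0// addr_ge0.
move=> k /[dup] k01 /andP[k0 k1].
have [K [l [eK lK lC lpsi]]] := trig_profile (ltW t0) k01.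
have w_psi : `|\prod_(i < n) heat_trig (m / 2) l t (y i) - \prod_(i < n) psi t (y i)| <= k * Q2.
  apply: le_trans (prod_diff_le (A := A) _ A1 _ _) _.
  - move=> i; have := lpsi (y i).
    have := ler_normD (heat_trig (m / 2) l t (y i) - psi t (y i)) (psi t (y i)).
    rewrite subrK /A; have : k * heat_barrier t (y i) <= heat_barrier t (y i).
      by rewrite ler_piMl.
    lra.
  - by move=> i; rewrite /A; have := bar0 (y i); lra.
  rewrite /Q2 mulrA ler_wpM2r//.
    by apply: prodr_ge0 => i _; exact: le_trans ler01 (A1 i).
  by rewrite mulr_sumr; apply: ler_sum => i _.
have site := cvg_site_error K C0 a0 rC rhoC rho_continuous r_rho.
have perr := cvg_prod_err t (trig_norm l + 1) n l.
have pw : \prod_(i < n) dtrig m (rescale N l) (N%:R ^+ 2 * t) (Num.floor (N%:R * y i))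
    @[N --> \oo] --> \prod_(i < n) heat_trig (m / 2) l t (y i).
  by apply: cvg_big => [|i _]; [exact: mul_continuous|exact: cvg_dtrig_rescale].
have site' : n%:R * site_const m t * (2 * n%:R / k) * (N%:R^-1 *
     \sum_(z <- box (K * N)) (r N z - rho (z%:~R / N%:R)) ^+ 2) @[N --> \oo] --> 0.
  by rewrite -[X in _ --> X](mulr0 (n%:R * site_const m t * (2 * n%:R / k)));
    apply: cvgM; [exact: cvg_cst|exact: site].
near=> N.
have N2 : (2 <= N)%N by near: N; exists 2%N.
have N0 : (0 < N)%N by exact: leq_trans N2.
have rN : forall x, 0 <= r N x <= C * expw a N x by near: N.
have siteN : `|n%:R * site_const m t * (2 * n%:R / k) * (N%:R^-1 *
     \sum_(z <- box (K * N)) (r N z - rho (z%:~R / N%:R)) ^+ 2)| <= k.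
  by near: N; move/cvgr0Pnorm_le: site'; apply.
have perrN : `|prod_err m n N (trig_norm l + 1) (N%:R ^+ 2 * t) (rescale N l)| <= k.
  by near: N; move/cvgr0Pnorm_le: perr; apply.
have pwN : `|\prod_(i < n) heat_trig (m / 2) l t (y i) -
    \prod_(i < n) dtrig m (rescale N l) (N%:R ^+ 2 * t) (Num.floor (N%:R * y i))| <= k.
  by near: N; move/cvgrPdist_le: pw; apply.
set xi := sum_delta _.
have lB : linf (expw b N) xi <= B.
  rewrite linf_sum_delta; apply: ler_sum => i _; exact: expw_floor_le.
have := local_equilibrium_error m_gt0 p_sip t0 N2 (sector_sum_delta _) C1 a0 k01 eK rN lK lC
  (xi := xi).
rewrite /= -/b -/c prodf_sum_delta.
set P := \prod_(i < n) dtrig _ _ _ _ in pwN *.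
set E := fsip_expect _ _ _ _; set W := \prod_(i < n) heat_trig _ _ _ _ in pwN w_psi.
set V := \prod_(i < n) psi _ _ in w_psi *.
set err := prod_err _ _ _ _ _ _ in perrN *.
set S := N%:R^-1 * _ in siteN *.
have dE : n%:R * site_const m t * (2 * n%:R / k * S) =
  n%:R * site_const m t * (2 * n%:R / k) * S by rewrite !mulrA.
rewrite dE; set s := n%:R * _ * _ * S in siteN *.
have dQ : n%:R * (2 * n%:R * k) + k * c * (expw_const m b t * linf (expw b N) xi) <= k * Q1.
  rewrite /Q1 [leRHS]mulrDr; apply: lerD.
    by rewrite le_eqVlt; apply/orP; left; apply/eqP; ring.
  by rewrite -mulrA ler_wpM2l ?(ltW k0)// ler_wpM2l// ler_wpM2l.
have kQE (u v w : R) : k * (u + v + w) = k * u + k * v + k * w by ring.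
move: siteN perrN pwN w_psi; rewrite !ler_norml => /andP[s1 s2] /andP[e1 e2] /andP[p1 p2] /andP[w1 w2].
move=> /andP[H1 H2]; apply/andP; split.
  by apply: le_trans H1; rewrite lee_fin kQE; lra.
by apply: le_trans H2 _; rewrite lee_fin kQE; lra.
Unshelve. all: by end_near. Qed.

End Propagation.

Lemma cvge_of_bounds {R : realType} (u : nat -> \bar R) (V Q : R) : 0 <= Q ->
  (forall k, 0 < k <= 1 ->
     \forall N \near \oo, ((V - k * Q)%:E <= u N <= (V + k * Q)%:E)%E) ->
  u N @[N --> \oo] --> V%:E.
Proof.
move=> Q0 H; have fin (x y : R) (z : \bar R) : (x%:E <= z <= y%:E)%E -> z \is a fin_num.
  by move=> /andP[xz zy]; rewrite fin_numElt (lt_le_trans (ltNyr x) xz) (le_lt_trans zy (ltry y)).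
apply: cvg_EFin.
  by have := H 1; rewrite ltr01 lexx => /(_ isT); apply: filterS => N; exact: fin.
apply/cvgrPdist_le => e e0.
pose k := Num.min 1 (e / (Q + 1)).
have Q1 : 0 < Q + 1 by rewrite ltr_wpDl.
have k01 : 0 < k <= 1 by rewrite lt_min ltr01 divr_gt0//= ge_min lexx.
have kQ : k * Q <= e.
  apply: (@le_trans _ _ (e / (Q + 1) * Q)).
    by rewrite ler_wpM2r// ge_min lexx orbT.
  by rewrite mulrAC ler_pdivrMr// ler_wpM2l ?(ltW e0)// lerDl.
have := H k k01; apply: filterS => N uN.
have /fineK uE := fin _ _ _ uN; move: uN; rewrite -uE !lee_fin => /andP[u1 u2].
by rewrite /= ler_norml; apply/andP; split; lra.
Qed.

(* Without lam_growth the claim is false: lam_approx is a pointwise limit and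
   does not control lam N at sites such as floor (sqrt N), which floor (N y)
   visits only finitely often for each fixed y. *)
Theorem mainTheorem2 (R : realType) (m : R) (m_gt0 : 0 < m)
  (p : R -> fconf -> fconf -> R) (p_sip : is_fsip m p)
  (prof : R -> R) (prof_ge0 : forall y, 0 <= prof y)
  (prof_lt1 : forall y, prof y < 1) (prof_smooth : smooth prof)
  (lam : nat -> int -> R) (lam_ge0 : forall N x, 0 <= lam N x)
  (lam_lt1 : forall N x, lam N x < 1)
  (mu : nat -> probability Omega R)
  (mu_product : forall N, is_negbin_product m (lam N) (mu N))
  (lam_approx : forall (n : nat) (y : 'I_n -> R), (0 < n)%N ->
    (\int[mu N]_eta
       (dual m (sum_delta (fun i => Num.floor (N%:R * y i))) eta)%:E)%E
      @[N --> \oo]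
      --> (\prod_(i < n) (prof (y i) / (1 - prof (y i))))%:E)
  (lam_growth : exists C a : R, \forall N \near \oo, forall x : int,
    lam N x / (1 - lam N x) <= C * expR (a * (`|x%:~R| / N%:R)))
  (psi : R -> R -> R)
  (psi_heat : heat_solution (m / 2) (fun y => prof y / (1 - prof y)) psi)
  (t : R) (t_gt0 : 0 < t) (n : nat) (n_gt0 : (0 < n)%N) (y : 'I_n -> R) :
  (\int[mu N]_eta
     sip_expect_dual m p (N%:R ^+ 2 * t)
       (sum_delta (fun i => Num.floor (N%:R * y i))) eta)%E
    @[N --> \oo]
    --> (\prod_(i < n) psi t (y i))%:E.

Proof.
have [C [a lamC]] := lam_growth.
pose r N x := lam N x / (1 - lam N x).
pose rho z := prof z / (1 - prof z).
(* The factor e^|a| compensates the rounding to the lattice when the growth bound passes from r to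
   its limit rho, so that one constant serves both. *)
pose C1 := (`|C| + 1) * expR `|a|.
have lam01 N x : 0 <= lam N x < 1 by rewrite lam_ge0 lam_lt1.
have r0 N x : 0 <= r N x by rewrite divr_ge0 ?subr_ge0// ltW.
have rC : \forall N \near \oo, forall x, 0 <= r N x <= (`|C| + 1) * expw `|a| N x.
  apply: filterS lamC => N H x; rewrite r0/=; apply: le_trans (H x) _.
  apply: (@le_trans _ _ ((`|C| + 1) * expR (a * (`|x%:~R| / N%:R)))).
    by rewrite ler_wpM2r ?expR_ge0//; have := ler_norm C; lra.
  by rewrite ler_wpM2l// ler_expR ler_wpM2r ?divr_ge0// ler_norm.
have eC : (`|C| + 1) <= C1 by rewrite /C1 ler_peMr// -expR0 ler_expR.
have C1_ge1 : 1 <= C1 by apply: le_trans eC; rewrite lerDr.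
have rC1 : \forall N \near \oo, forall x, 0 <= r N x <= C1 * expw `|a| N x.
  apply: filterS rC => N H x; have /andP[-> /=] := H x => Hx.
  by apply: le_trans Hx _; rewrite ler_wpM2r ?expR_ge0.
have r_rho z : r N (Num.floor (N%:R * z)) @[N --> \oo] --> rho z.
  (* For one particle the integral of the duality function is r at that site, so [lam_approx]
     becomes pointwise convergence of r. *)
  have := lam_approx 1%N (fun=> z) isT; rewrite big_ord1 => /fine_cvg.
  rewrite (_ : _ \o _ = fun N => r N (Num.floor (N%:R * z)))//.
  apply/funext => N /=.
  by rewrite (integral_dual m_gt0 (lam01 N) (mu_product N)) prodf_sum_delta big_ord1.
have rho_growth z : `|rho z| <= C1 * expR (`|a| * `|z|).
  rewrite ger0_norm; last by rewrite divr_ge0 ?subr_ge0// ltW.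
  apply: (ler_cvg_to (r_rho z) (cvg_cst _)); near=> N.
  have N0 : (0 < N)%N by near: N; exists 1%N.
  have /andP[_] : 0 <= r N (Num.floor (N%:R * z)) <=
      (`|C| + 1) * expw `|a| N (Num.floor (N%:R * z)).
    by move: (Num.floor _); near: N.
  move=> Hr; apply: le_trans Hr _; rewrite /C1 -mulrA -expRD ler_wpM2l//.
  apply: le_trans (expw_floor_le z (normr_ge0 a) N0) _.
  by rewrite ler_expR; lra.
have dprof z : derivable prof z 1 by exact: (prof_smooth 0%N z).
have ddprof z : derivable prof^`()%classic z 1 by exact: (prof_smooth 1%N z).
have [Q Q0 HQ] := propagation m_gt0 p_sip C1_ge1 (normr_ge0 a) rC1 rho_growth
  (lipschitz_odds prof_lt1 dprof ddprof) (continuous_odds prof_lt1 dprof)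
  r_rho psi_heat y t_gt0.
apply: (cvge_of_bounds Q0) => k k01; apply: filterS (HQ k k01) => N.
by rewrite (integral_sip_expect_dual m_gt0 (lam01 N) (mu_product N))// mulr_ge0 ?exprn_ge0// ltW.
Unshelve. all: by end_near. Qed.
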